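(* Let $\mu$ be a finitely supported probability measure on the positive semigroup $\mathrm{Br}_3^+$. Then the functions $\chi(t)$ and $\lambda(t)$ are subharmonic on $\mathbb{C}$, with $\chi(t)$ continuous on $\mathbb{C}$ and $\lambda(t)$ continuous on $\mathbb{C}\setminus\{0\}$.
   Context: $\mathrm{Br}_3 = \langle \sigma_1, \sigma_2 \mid \sigma_1\sigma_2\sigma_1 = \sigma_2\sigma_1\sigma_2\rangle$ is the 3-strand braid group; $\mathrm{Br}_3^+$ is its semigroup of positive braids (products of positive powers of $\sigma_1,\sigma_2$). The reduced Burau representation $B_t : \mathrm{Br}_3 \to \mathrm{GL}_2(\mathbb{Z}[t^{\pm1}])$ is given by $B_t(\sigma_1) = \begin{pmatrix} -t & 1\\ 0 & 1\end{pmatrix}$, $B_t(\sigma_2) = \begin{pmatrix} 1 & 0 \\ t & -t\end{pmatrix}$; for positive braids its entries are polynomials in $t$. Let $w_n=g_1g_2\cdots g_n$ be the random walk driven by $\mu$ (the $g_i$ being independent with law $\mu$). Its Lyapunov exponent is the function of $t\in\mathbb{C}$ given by $\lambda(t)=\lim_{n\to\infty}\frac1n\int\log\|B_t(w_n)\|\,d\mathbb{P}$, where $\|\cdot\|$ is any matrix norm, and where $\lambda(0)=-\infty$. Set $\log^+x=\max\{0,\log x\}$ and $\chi(t)=\max\{\lambda(t),\log^+|t|\}$. A function $f\in L^1_{loc}(W)$ on an open set $W\subseteq\mathbb{C}$ is weakly subharmonic if its distributional Laplacian is a positive distribution (hence a positive measure); it is subharmonic if it is weakly subharmonic and upper sem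icontinuous.
   Formalization: At t = 0, λ is given by the limit formula, not set to −∞; the two agree unless μ is supported on powers of a single generator, where the formula gives λ(0) = 0 and the value −∞ would break upper semicontinuity (e.g. μ = δ_{σ1}, λ(t) = log⁺|t| for t ≠ 0). *)

(* Defs.v *)
From HB Require Import structures.
From mathcomp Require Import all_boot all_order all_algebra fraction.
From mathcomp Require Import generic_quotient finmap complex.
From mathcomp Require Import all_classical all_reals all_analysis measurable_realfun.

Set Implicit Arguments.
Unset Strict Implicit.
Unset Printing Implicit Defensive.

Import Order.TTheory GRing.Theory Num.Theory.
Import numFieldNormedType.Exports.
Import ComplexField.Normc.

Local Open Scope classical_set_scope.
Local Open Scope ring_scope.

(* The letter (i, e) stands for a generator or its inverse: i = false for     *)
(* sigma_1, i = true for sigma_2; e = true for the inverse.                   *)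
Definition word := seq (bool * bool).

Definition s1 : bool * bool := (false, false).
Definition s2 : bool * bool := (true, false).
Definition inv_letter (x : bool * bool) := (x.1, ~~ x.2).

Inductive braid_eq : word -> word -> Prop :=
| braid_eq_refl u : braid_eq u u
| braid_eq_sym u v : braid_eq u v -> braid_eq v u
| braid_eq_trans u v w : braid_eq u v -> braid_eq v w -> braid_eq u w
| braid_eq_cancel u v x : braid_eq (u ++ [:: x; inv_letter x] ++ v) (u ++ v)
| braid_eq_braid u v :
    braid_eq (u ++ [:: s1; s2; s1] ++ v) (u ++ [:: s2; s1; s2] ++ v).

Definition braid_eqb : rel word := fun u v => `[< braid_eq u v >].

Lemma braid_eqb_equiv : equiv_class_of braid_eqb.
Proof.
split=> [u|u v|v u w].
- exact/asboolP/braid_eq_refl.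
- by apply/asboolP/asboolP; exact: braid_eq_sym.
- by move=> /asboolP uv /asboolP vw; apply/asboolP/(braid_eq_trans uv).
Qed.

Canonical braid_eqb_equiv_rel := EquivRelPack braid_eqb_equiv.

Local Open Scope quotient_scope.
Definition Br3 := {eq_quot braid_eqb}.
HB.instance Definition _ := Choice.on Br3.
HB.instance Definition _ := EqQuotient.on Br3.

Definition braid (u : word) : Br3 := \pi_Br3%qT u.

Lemma braidP u v : braid u = braid v <-> braid_eq u v.
Proof.
rewrite /braid; split=> [/eqP|uv].
  by rewrite eqmodE => /asboolP.
by apply/eqP; rewrite eqmodE; apply/asboolP.
Qed.

Lemma braid_repr (x : Br3) : braid (repr x) = x. Proof. exact: reprK. Qed.

Lemma braid_eq_cat u u' v v' :
  braid_eq u u' -> braid_eq v v' -> braid_eq (u ++ v) (u' ++ v').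
Proof.
move=> uu' vv'; apply: (@braid_eq_trans _ (u' ++ v)).
  elim: uu' => {u u' vv'} [u|u w _|u w w' _ h1 _|a b x|a b].
  - exact: braid_eq_refl.
  - exact: braid_eq_sym.
  - exact: braid_eq_trans.
  - by rewrite -!catA; exact: braid_eq_cancel.
  - by rewrite -!catA; exact: braid_eq_braid.
elim: vv' => {uu' v v'} [v|v w _|v w w' _ h1 _|a b x|a b].
- exact: braid_eq_refl.
- exact: braid_eq_sym.
- exact: braid_eq_trans.
- by rewrite !(catA u'); exact: braid_eq_cancel.
- by rewrite !(catA u'); exact: braid_eq_braid.
Qed.

Definition inv_word (u : word) : word := rev (map inv_letter u).

Lemma inv_letterK : involutive inv_letter.
Proof. by case=> i e; rewrite /inv_letter /= negbK. Qed.

Lemma inv_wordK : involutive inv_word.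
Proof. by move=> u; rewrite /inv_word map_rev revK (mapK inv_letterK). Qed.

Lemma braid_eq_catV u : braid_eq (u ++ inv_word u) [::].
Proof.
elim: u => [|x u IH]; first exact: braid_eq_refl.
have -> : (x :: u) ++ inv_word (x :: u)
    = [:: x] ++ (u ++ inv_word u) ++ [:: inv_letter x].
  by rewrite /inv_word /= rev_cons -cats1 catA.
apply: (@braid_eq_trans _ ([:: x] ++ [::] ++ [:: inv_letter x])).
  by do 2?apply: braid_eq_cat => //; exact: braid_eq_refl.
exact: (@braid_eq_cancel [::] [::]).
Qed.

Lemma braid_eq_inv u v :
  braid_eq u v -> braid_eq (inv_word u) (inv_word v).
Proof.
move=> uv.
have h1 : braid_eq (inv_word u ++ (v ++ inv_word v)) (inv_word u).
  rewrite -[X in braid_eq _ X]cats0; apply: braid_eq_cat.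
    exact: braid_eq_refl.
  exact: braid_eq_catV.
apply: braid_eq_trans (braid_eq_sym h1) _; rewrite catA -[X in braid_eq _ X]cat0s.
apply: braid_eq_cat; last exact: braid_eq_refl.
apply: braid_eq_trans (braid_eq_catV (inv_word u)); rewrite inv_wordK.
by apply: braid_eq_cat; [exact: braid_eq_refl|exact: braid_eq_sym].
Qed.

Definition mul_braid (x y : Br3) : Br3 := braid (repr x ++ repr y).
Definition inv_braid (x : Br3) : Br3 := braid (inv_word (repr x)).

Lemma mul_braidE u v : mul_braid (braid u) (braid v) = braid (u ++ v).
Proof. by apply/braidP/braid_eq_cat; apply/braidP; rewrite braid_repr. Qed.

Lemma inv_braidE u : inv_braid (braid u) = braid (inv_word u).
Proof. by apply/braidP/braid_eq_inv/braidP; rewrite braid_repr. Qed.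

Lemma mul_braidA : associative mul_braid.
Proof.
move=> x y z; rewrite -(braid_repr x) -(braid_repr y) -(braid_repr z).
by rewrite !mul_braidE catA.
Qed.

Lemma mul1_braid : left_id (braid [::]) mul_braid.
Proof. by move=> x; rewrite -(braid_repr x) mul_braidE. Qed.

Lemma mul_braid1 : right_id (braid [::]) mul_braid.
Proof. by move=> x; rewrite -(braid_repr x) mul_braidE cats0. Qed.

Lemma mul_braidV : right_inverse (braid [::]) inv_braid mul_braid.
Proof.
move=> x; rewrite -(braid_repr x) inv_braidE mul_braidE.
exact/braidP/braid_eq_catV.
Qed.

Lemma mulV_braid : left_inverse (braid [::]) inv_braid mul_braid.
Proof.
move=> x; rewrite -(braid_repr x) inv_braidE mul_braidE.
apply/braidP; have := braid_eq_catV (inv_word (repr x)).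
by rewrite inv_wordK.
Qed.

HB.instance Definition _ := isGroup.Build Br3
  mul_braidA mul1_braid mul_braid1 mulV_braid mul_braidV.

(* sigma false is sigma_1 and sigma true is sigma_2.                          *)
Definition sigma (i : bool) : Br3 := braid [:: (i, false)].

Definition positive : {pred Br3} :=
  [pred x | `[< exists s : seq bool, x = (\prod_(i <- s) sigma i)%g >]].

Lemma positive_monoid_closed : monoid_closed positive.
Proof.
split=> [|x y /asboolP[s ->] /asboolP[s' ->]]; apply/asboolP.
  by exists [::]; rewrite big_nil.
by exists (s ++ s'); rewrite big_cat.
Qed.

Definition Br3p := {x : Br3 | positive x}.
HB.instance Definition _ := SubChoice.on Br3p.
HB.instance Definition _ :=
  SubChoice_isSubMonoid.Build Br3 positive Br3p positive_monoid_closed.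
HB.instance Definition _ := isPointed.Build Br3p (1%g : Br3p).
HB.instance Definition _ := @isMeasurable.Build default_measure_display Br3p
  discrete_measurable discrete_measurable0
  discrete_measurableC discrete_measurableU.

(* The ring Z[t, t^-1] is taken inside its fraction field Q(t).               *)
Definition mx2 (A : pzRingType) (a b c d : A) : 'M[A]_2 :=
  \matrix_(i, j) (if i == 0 then if j == 0 then a else b
                  else if j == 0 then c else d).

Definition burau_gen_poly (i : bool) : 'M[{poly int}]_2 :=
  if i then mx2 1 0 'X (- 'X) else mx2 (- 'X) 1 0 1.

Definition burau_gen (i : bool) : 'M[{fraction {poly int}}]_2 :=
  map_mx (@tofrac _) (burau_gen_poly i).

Definition burau_letter (x : bool * bool) : 'M[{fraction {poly int}}]_2 :=
  if x.2 then (burau_gen x.1)^-1 else burau_gen x.1.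

Definition burau_word (u : word) : 'M[{fraction {poly int}}]_2 :=
  \prod_(x <- u) burau_letter x.

Definition burau (x : Br3) : 'M[{fraction {poly int}}]_2 := burau_word (repr x).

Lemma det_mx22 (A : comPzRingType) (M : 'M[A]_2) :
  \det M = M 0 0 * M 1 1 - M 0 1 * M 1 0.
Proof.
rewrite (expand_det_row _ 0) !big_ord_recl big_ord0 addr0 /cofactor !det_mx11.
rewrite !mxE /= expr0 mul1r expr1 mulN1r mulrN.
by congr (_ * M _ _ - M _ _ * M _ _); apply/val_inj.
Qed.

Lemma burau_gen_unit i : burau_gen i \is a GRing.unit.
Proof.
suff h : burau_gen i \in unitmx by exact: h.
rewrite unitmxE det_map_mx unitfE tofrac_eq0 det_mx22.
by case: i; rewrite !mxE /= ?mulr1 ?mul1r ?mul0r ?subr0 oppr_eq0 polyX_eq0.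
Qed.

Lemma burau_braid_rel :
  burau_word [:: s1; s2; s1] = burau_word [:: s2; s1; s2].
Proof.
rewrite /burau_word !big_cons !big_nil !mulr1 /burau_letter /= /burau_gen.
rewrite -!mulmxE -!map_mxM; congr map_mx; apply/matrixP => i j.
rewrite !mxE !big_ord_recl !big_ord0 !mxE !big_ord_recl !big_ord0 !mxE /=.
by case: i => [[|[|//]] ?]; case: j => [[|[|//]] ?] /=;
  rewrite ?(mulr0, mul0r, mulr1, mul1r, addr0, add0r, mulrN, mulNr, opprK,
    addNr, addrN, subrr).
Qed.

Lemma burau_wordP u v : braid_eq u v -> burau_word u = burau_word v.
Proof.
elim=> {u v} [//|//|u v w _ -> _ -> //|u v [i e]|u v].
- rewrite /burau_word !big_cat /= !big_cons big_nil mulr1.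
  suff -> : burau_letter (i, e) * burau_letter (inv_letter (i, e)) = 1.
    by rewrite mul1r.
  by case: e; rewrite /burau_letter /= ?mulVr ?mulrV// burau_gen_unit.
- rewrite /burau_word !big_cat /=; congr (_ * (_ * _)).
  exact: burau_braid_rel.
Qed.

Lemma burau_braid u : burau (braid u) = burau_word u.
Proof. by apply/burau_wordP/braidP; rewrite braid_repr. Qed.

Lemma burau1 : burau 1%g = 1.
Proof. by rewrite burau_braid /burau_word big_nil. Qed.

Lemma burauM x y : burau (x * y)%g = burau x * burau y.
Proof.
rewrite -(braid_repr x) -(braid_repr y) -[(_ * _)%g]/(mul_braid _ _).
by rewrite mul_braidE !burau_braid /burau_word big_cat.
Qed.

Lemma burau_sigma i : burau (sigma i) = burau_gen i.
Proof. by rewrite burau_braid /burau_word big_seq1. Qed.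

Lemma burau_positive (x : Br3p) :
  exists M : 'M[{poly int}]_2, map_mx (@tofrac _) M = burau (val x).
Proof.
case: x => x /=; rewrite /positive /= => /asboolP[s ->].
exists (\prod_(i <- s) burau_gen_poly i).
elim: s => [|i s IH]; first by rewrite !big_nil burau1 map_mx1.
by rewrite !big_cons burauM -IH burau_sigma -!mulmxE -map_mxM.
Qed.

Definition burau_poly (x : Br3p) : 'M[{poly int}]_2 :=
  sval (cid (burau_positive x)).

Lemma burau_polyE (x : Br3p) :
  map_mx (@tofrac _) (burau_poly x) = burau (val x).
Proof. exact: svalP (cid (burau_positive x)). Qed.

Section Lyapunov.
Context {R : realType}.

Definition burau_at (t : R[i]) (x : Br3p) : 'M[R[i]]_2 :=
  map_mx (fun p : {poly int} => (map_poly intr p).[t]) (burau_poly x).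

Definition is_norm (N : 'M[R[i]]_2 -> R) : Prop :=
  [/\ forall A B, N (A + B) <= N A + N B,
      forall (c : R[i]) A, N (c *: A) = normc c * N A &
      forall A, N A = 0 -> A = 0].

Definition finitely_supported (mu : probability Br3p R) : Prop :=
  exists2 A : set Br3p, finite_set A & mu A = 1%E.

Section walk.
Context {d : measure_display} {T : measurableType d} (P : probability T R).

Definition mutually_independent {d'} {T' : measurableType d'}
    (X : nat -> {RV P >-> T'}) : Prop :=
  forall (J : {fset nat}) (A : nat -> set T'), (forall i, measurable (A i)) ->
    P (\bigcap_(i in [set` J]) (X i @^-1` A i)) =
    (\prod_(i <- J) P (X i @^-1` A i))%E.

Definition iid_with_law {d'} {T' : measurableType d'}
    (X : nat -> {RV P >-> T'}) (mu : probability T' R) : Prop :=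
  mutually_independent X /\
  forall i, distribution P (X i) = mu :> (set T' -> \bar R).

Definition walk (g : nat -> {RV P >-> Br3p}) (n : nat) (x : T) : Br3p :=
  (\prod_(i < n) g i x)%g.

(* lne 0 = -oo, so the defining limit makes sense at t = 0 as well. There it  *)
(* is -oo unless the g i almost surely are powers of a single generator:      *)
(* burau_at 0 kills every positive braid containing sigma_1 sigma_2.          *)
Definition lyapunov (N : 'M[R[i]]_2 -> R) (g : nat -> {RV P >-> Br3p})
    (t : R[i]) : \bar R :=
  limn (fun n =>
    (n%:R^-1)%:E * \int[P]_x lne (N (burau_at t (walk g n x)))%:E)%E.

Definition log_plus (t : R[i]) : \bar R := maxe 0%E (lne (normc t)%:E).

Definition chi (N : 'M[R[i]]_2 -> R) (g : nat -> {RV P >-> Br3p})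
    (t : R[i]) : \bar R :=
  maxe (lyapunov N g t) (log_plus t).

End walk.
End Lyapunov.

(* The complex plane is R * R, with the product topology and measure.         *)
Section Subharmonic.
Context {R : realType}.
Local Notation R2 := (measurableTypeR R * measurableTypeR R)%type.

Definition toC (z : R * R) : R[i] := Complex z.1 z.2.

Implicit Types (W : set (R * R)) (f : R * R -> \bar R) (phi : R * R -> R).

Definition lebesgue2 : set R2 -> \bar R :=
  (@lebesgue_measure R \x @lebesgue_measure R)%E.
HB.instance Definition _ := Measure.on lebesgue2.

Definition smooth phi : Prop := forall (s : seq (R * R)) (z : R * R),
  differentiable (foldr (fun v (h : R * R -> R) => 'D_v h) phi s) z.

Definition laplacian phi (z : R * R) : R :=
  'D_(1, 0) ('D_(1, 0) phi) z + 'D_(0, 1) ('D_(0, 1) phi) z.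

Definition tsupport phi : set (R * R) := closure [set z | phi z != 0].

Definition test_function W phi : Prop :=
  [/\ smooth phi, compact (tsupport phi) & tsupport phi `<=` W].

(* Functions with values in [-oo, +oo[ are taken with codomain \bar R; the     *)
(* bound f < +oo is part of upper_semicontinuous.                             *)
Definition L1loc W f : Prop :=
  [/\ open W, @measurable_fun _ _ R2 _ W f &
      forall K, compact K -> K `<=` W -> lebesgue2.-integrable K f].

(* The distributional Laplacian of f is phi |-> \int f * laplacian phi.       *)
Definition weakly_subharmonic W f : Prop :=
  L1loc W f /\
  forall phi, test_function W phi -> (forall z, 0 <= phi z) ->
    (0 <= \int[lebesgue2]_(z in W) (f z * (laplacian phi z)%:E))%E.

Definition upper_semicontinuous W f : Prop :=
  forall z, W z -> (f z < +oo)%E /\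
    forall a : R, (f z < a%:E)%E -> \forall w \near z, (f w < a%:E)%E.

Definition subharmonic W f : Prop :=
  weakly_subharmonic W f /\ upper_semicontinuous W f.

End Subharmonic.

(* Main.v *)
Require Import Defs.
From HB Require Import structures.
From mathcomp Require Import all_boot all_order all_algebra.
From mathcomp Require Import finmap complex ring lra.
From mathcomp Require Import all_classical all_reals all_analysis measurable_realfun.

(** Let [s i], of weights [p i > 0], be the atoms of the law of the steps, and let
    [A_t i] be the Burau matrix of [s i] at [t]. Integrals of functions of the walk
    at time [n] are finite sums over words of length [n] in the letters [i]
    ([integral_walk]), and all norms are equivalent ([is_norm_ln]). Since the
    determinant of [A_t i] is a power of [- t], for [t] other than 0 the function
    [lyapunov] is the exponent [lexp p A_t] of a finite family of invertible
    matrices, the infimum and the limit of the expected logarithm of the norm of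
    products of length [n], divided by [n] ([lyapunov_nondegenerate]).

    Continuity off the origin is a theorem of Bocker and Viana: with fixed positive
    weights, [lexp] is a continuous function of the matrices ([lexp_continuous]).
    As an infimum of continuous functions it is upper semicontinuous. For lower
    semicontinuity, suppose first that the two exponents of the family differ and
    that no invariant line has a drift below the exponent. By an argument of
    Furstenberg and Kifer ([slow_invariant_line]), almost every orbit of every
    vector then expands at the full rate. Compactness of the sphere turns this into
    an estimate over a bounded number of steps, which persists for nearby families
    and bounds their exponents below ([lexp_lsc_no_slow_line]). If the exponents
    coincide, half of the logarithm of the determinant is a continuous lower bound.
    If there is a slow invariant line, a rescaling transverse to it leads to a
    limit family where the slow line has disappeared, or the line persists in the
    nearby families and their exponents are explicit ([lexp_lsc_upper]).

    For subharmonicity, the logarithm of the modulus of a polynomial, truncated from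
    below, satisfies up to O(r^3) the mean value inequality on the four points
    [z + r], [z - r], [z + i r], [z - i r] ([submean_ln_poly]). Unlike inequalities
    between derivatives, this passes directly to sums and maxima. Integrated against
    a test function and transposed, the four-point difference tends to the
    Laplacian, so such functions are weakly subharmonic
    ([submean_weakly_subharmonic]). The entries of the products are polynomials in
    [t], so the expected logarithm of the largest entry, suitably truncated and
    divided by [n], is of this kind. It converges to the exponent off the origin,
    and the determinant bounds it below by a multiple of [- ln |t|] near the origin.
    This pole is locally integrable, and dominated convergence gives the
    distributional inequality for the limit ([weakly_subharmonic_limit]). Taking the
    maximum with [ln max(|t|, 1)] treats [chi] in the same way.

    At the origin the generators become idempotent matrices whose products take
    finitely many values. Hence the exponent there is 0, or [-oo] if some product
    vanishes ([lyapunov0]). In both cases it is upper semicontinuous at the origin,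
    by subadditivity ([lyapunov_usc_origin]). As [chi] is nonnegative and takes the
    value 0 at the origin, it is continuous there. *)

Import Order.TTheory GRing.Theory Num.Theory.
Import numFieldNormedType.Exports.
Import ComplexField.Normc.

Set Implicit Arguments.
Unset Strict Implicit.
Unset Printing Implicit Defensive.

Local Open Scope classical_set_scope.
Local Open Scope ring_scope.

(** * Expectation over random words *)

Section Expectation.
Context {R : realType} {I : finType} (p : I -> R).
Implicit Types (n : nat) (F G : seq I -> R).

(** The letters of a word are independent of law [p]; the recursion on the
    first letter replaces the product measure on words. *)
Fixpoint expect n F : R :=
  if n is m.+1 then \sum_i p i * expect m (fun w => F (i :: w)) else F [::].

Lemma eq_expect n F G :
  (forall w, size w = n -> F w = G w) -> expect n F = expect n G.
Proof.
elim: n F G => [|n IH] F G FG /=; first exact: FG.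
by apply: eq_bigr => i _; congr (_ * _); apply: IH => w sw; apply: FG; rewrite /= sw.
Qed.

Lemma expectD n F G :
  expect n (fun w => F w + G w) = expect n F + expect n G.
Proof.
elim: n F G => [|n IH] F G //=.
by rewrite -big_split; apply: eq_bigr => i _; rewrite IH mulrDr.
Qed.

Lemma expectZ n c F : expect n (fun w => c * F w) = c * expect n F.
Proof.
elim: n F => [|n IH] F //=.
by rewrite mulr_sumr; apply: eq_bigr => i _; rewrite IH mulrCA.
Qed.

Lemma expectN n F : expect n (fun w => - F w) = - expect n F.
Proof. by rewrite -mulN1r -expectZ; apply: eq_expect => w _; rewrite mulN1r. Qed.

Lemma expectB n F G :
  expect n (fun w => F w - G w) = expect n F - expect n G.
Proof. by rewrite expectD expectN. Qed.

Lemma expect_sum (J : Type) (s : seq J) n (F : J -> seq I -> R) :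
  expect n (fun w => \sum_(j <- s) F j w) = \sum_(j <- s) expect n (F j).
Proof.
elim: s => [|j s IH].
  rewrite big_nil (@eq_expect _ _ (fun=> 0 * 0)); last by move=> w _; rewrite big_nil mul0r.
  by rewrite (expectZ _ 0 (fun=> 0)) mul0r.
by rewrite big_cons -IH -expectD; apply: eq_expect => w _; rewrite big_cons.
Qed.

Lemma expect_cat m n F :
  expect (m + n) F = expect m (fun u => expect n (fun v => F (u ++ v))).
Proof.
elim: m F => [|m IH] F //=.
by apply: eq_bigr => i _; congr (_ * _); rewrite IH.
Qed.

Lemma expect_rcons n F :
  expect n.+1 F = expect n (fun w => \sum_i p i * F (rcons w i)).
Proof.
rewrite -addn1 expect_cat; apply: eq_expect => w _ /=.
by apply: eq_bigr => i _; rewrite cats1.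
Qed.

Lemma expect_rev n F : expect n (fun w => F (rev w)) = expect n F.
Proof.
elim: n F => [|n IH] F //.
rewrite expect_rcons /= (expect_sum (index_enum I)); apply: eq_bigr => i _.
rewrite expectZ -[RHS]/(p i * expect n (fun w => F (i :: w))) -(IH (fun w => F (i :: w))).
by congr (_ * _); apply: eq_expect => w _; rewrite rev_rcons.
Qed.

Hypothesis p_gt0 : forall i, 0 < p i.
Hypothesis p_sum1 : \sum_i p i = 1.

Lemma le_expect n F G :
  (forall w, size w = n -> F w <= G w) -> expect n F <= expect n G.
Proof.
elim: n F G => [|n IH] F G FG /=; first exact: FG.
apply: ler_sum => i _; rewrite ler_pM2l//.
by apply: IH => w sw; apply: FG; rewrite /= sw.
Qed.

Lemma expect_cst n c : expect n (fun=> c) = c.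
Proof.
elim: n => [|n IH] //=.
by rewrite IH -mulr_suml p_sum1 mul1r.
Qed.

Lemma expect_ge0 n F : (forall w, size w = n -> 0 <= F w) -> 0 <= expect n F.
Proof. by move=> F0; rewrite -(expect_cst n 0); exact: le_expect. Qed.

Lemma expect_le n F c : (forall w, size w = n -> F w <= c) -> expect n F <= c.
Proof. by move=> Fc; rewrite -(expect_cst n c); exact: le_expect. Qed.

Lemma expect_ge n F c : (forall w, size w = n -> c <= F w) -> c <= expect n F.
Proof. by move=> Fc; rewrite -(expect_cst n c); exact: le_expect. Qed.

Lemma ler_norm_expect n F : `|expect n F| <= expect n (fun w => `|F w|).
Proof.
rewrite ler_norml -expectN; apply/andP; split; apply: le_expect => w _.
  by rewrite lerNl -normrN ler_norm.
exact: ler_norm.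
Qed.

End Expectation.

(** * Law of large numbers for blocks of letters *)

Section LawOfLargeNumbers.
Context {R : realType} {I : finType} (p : I -> R).
Hypothesis p_gt0 : forall i, 0 < p i.
Hypothesis p_sum1 : \sum_i p i = 1.
Implicit Types (F : seq I -> R).

Fixpoint block_sum m F k (w : seq I) : R :=
  if k is l.+1 then F (take m w) + block_sum m F l (drop m w) else 0.

Lemma words_bounded m F : exists B : R, forall w, size w = m -> `|F w| <= B.
Proof.
exists (\sum_(t : m.-tuple I) `|F t|) => w sw.
have -> : w = tval (Tuple (introT eqP sw)) by [].
by rewrite (bigD1 (Tuple (introT eqP sw))) //= lerDl sumr_ge0.
Qed.

Lemma expect_block_sum m F k :
  expect p (k * m) (block_sum m F k) = k%:R * expect p m F.
Proof.
elim: k => [|k IH]; first by rewrite mul0n mul0r.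
rewrite mulSn expect_cat -(@eq_expect _ _ p m (fun u => F u + k%:R * expect p m F)).
  by rewrite expectD (expect_cst p_sum1) -natr1 mulrDl mul1r addrC.
move=> u su; rewrite -IH -[F u in LHS](expect_cst p_sum1 (k * m)) -expectD.
by apply: eq_expect => v _ /=; rewrite take_size_cat// drop_size_cat.
Qed.

(** The blocks are independent and centred, so the cross terms vanish and the
    variance is additive. *)
Lemma variance_block_sum m F B k : 0 <= B ->
  (forall w, size w = m -> `|F w - expect p m F| <= B) ->
  expect p (k * m) (fun w => (block_sum m F k w - k%:R * expect p m F) ^+ 2)
    <= k%:R * B ^+ 2.
Proof.
set a := expect p m F => B0 FB.
elim: k => [|k IH]; first by rewrite mul0n /= !mul0r subr0 expr0n.
rewrite mulSn expect_cat.
set V := expect p (k * m) _ in IH.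
rewrite (@eq_expect _ _ p m _ (fun u => (F u - a) ^+ 2 + V)); last first.
  move=> u su; rewrite -[X in X + V](expect_cst p_sum1 (k * m)) -expectD.
  apply/eqP; rewrite -subr_eq0 -expectB; apply/eqP.
  rewrite (@eq_expect _ _ p (k * m) _
    (fun v => 2 * (F u - a) * (block_sum m F k v - k%:R * a))).
    rewrite expectZ expectB expect_block_sum (expect_cst p_sum1).
    by rewrite subrr mulr0.
  move=> v sv /=; rewrite take_size_cat// drop_size_cat// -natr1.
  ring.
rewrite expectD (expect_cst p_sum1) -natr1 mulrDl mul1r addrC lerD//.
apply: (expect_le p_gt0 p_sum1) => w sw; rewrite -real_normK ?num_real//.
by rewrite lerXn2r ?nnegrE// FB.
Qed.

(** Mean absolute deviation is controlled by the variance, which is linear in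
    the number of blocks while its square root is what counts. *)
Lemma block_sum_deviation m F (e : R) : 0 < e ->
  exists k0, forall k, (k0 <= k)%N ->
    expect p (k * m) (fun w => `|block_sum m F k w - k%:R * expect p m F|)
      <= e * k%:R.
Proof.
move=> e0; set a := expect p m F.
have [B FB] := words_bounded m (fun w => F w - a).
pose B' := Num.max B 0.
have B'0 : 0 <= B' by rewrite le_max lexx orbT.
have FB' w : size w = m -> `|F w - a| <= B'.
  by move=> sw; rewrite le_max FB.
(* |Z| <= Z^2/(2c) + c/2 with c = e k *)
exists (Num.truncn (B' ^+ 2 / e ^+ 2)).+1 => k k0k.
have k0 : 0 < k%:R :> R by rewrite ltr0n (leq_trans _ k0k).
have Bk : B' ^+ 2 <= e ^+ 2 * k%:R.
  rewrite -ler_pdivrMl ?exprn_gt0// mulrC ltW//.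
  apply: lt_le_trans (truncnS_gt _) _; by rewrite ler_nat.
have c0 : 0 < e * k%:R by rewrite mulr_gt0.
apply: le_trans (_ : (2 * (e * k%:R))^-1 * (k%:R * B' ^+ 2) + e * k%:R / 2 <= _).
  apply: le_trans (_ : expect p (k * m) (fun w => (2 * (e * k%:R))^-1 *
    (block_sum m F k w - k%:R * a) ^+ 2 + e * k%:R / 2) <= _).
    apply: (le_expect p_gt0) => w _.
    set Z := _ - k%:R * a; set c := e * k%:R in c0 *.
    have -> : (2 * c)^-1 * Z ^+ 2 + c / 2 = (Z ^+ 2 + c ^+ 2) / (2 * c).
      by field; rewrite gt_eqF.
    rewrite ler_pdivlMr ?mulr_gt0//.
    rewrite -(real_normK (num_real Z)).
    have : 0 <= (`|Z| - c) ^+ 2 by rewrite sqr_ge0.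
    nra.
  rewrite expectD (expect_cst p_sum1) expectZ.
  rewrite lerD2r. rewrite ler_pM2l ?invr_gt0 ?mulr_gt0//.
  exact: variance_block_sum.
have -> : (2 * (e * k%:R))^-1 * (k%:R * B' ^+ 2) + e * k%:R / 2
    = (k%:R * B' ^+ 2 + (e * k%:R) ^+ 2) / (2 * (e * k%:R)).
  by field; rewrite !gt_eqF.
rewrite ler_pdivrMr ?mulr_gt0//.
have : k%:R * B' ^+ 2 <= k%:R * (e ^+ 2 * k%:R) by rewrite ler_pM2l.
nra.
Qed.

Lemma markov_expect n F (c : R) : 0 < c ->
  (forall w, size w = n -> 0 <= F w) ->
  expect p n (fun w => (c <= F w)%R%:R) <= expect p n F / c.
Proof.
move=> c0 F0; rewrite ler_pdivlMr// mulrC -expectZ.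
apply: (le_expect p_gt0) => w sw; case: (lerP c (F w)) => [cF|_]; first by rewrite mulr1.
by rewrite mulr0 F0.
Qed.

End LawOfLargeNumbers.

(** * Complex two by two matrices *)

Section TwoByTwo.
Context {R : realType}.
Local Notation C := R[i].

Lemma normc_ge0 (x : C) : 0 <= normc x.
Proof. by case: x => a b; rewrite sqrtr_ge0. Qed.

Lemma ler_normcD (x y : C) : normc (x + y) <= normc x + normc y.
Proof. by have := ComplexField.lec_normD x y; rewrite /ComplexField.lec /= => /andP[]. Qed.

Lemma normcN (x : C) : normc (- x) = normc x.
Proof. by case: x => a b /=; rewrite !sqrrN. Qed.

Lemma normc_eq0 (x : C) : (normc x == 0) = (x == 0).
Proof. by apply/eqP/eqP => [/eq0_normc//|->]; rewrite normc0. Qed.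

Lemma normc_gt0 (x : C) : (0 < normc x) = (x != 0).
Proof. by rewrite lt_def normc_ge0 andbT normc_eq0. Qed.

Lemma ler_normcB (x y : C) : normc (x - y) <= normc x + normc y.
Proof. by rewrite -(normcN y) ler_normcD. Qed.

Lemma ler_dist_normc (x y : C) : `|normc x - normc y| <= normc (x - y).
Proof.
have h (a b : C) : normc a - normc b <= normc (a - b).
  by have := ler_normcD (a - b) b; rewrite subrK -lerBlDr.
by rewrite ler_norml h andbT lerNl opprB -(normcN (x - y)) opprB h.
Qed.

Lemma normc_real (a : R) : normc (a%:C)%C = `|a|.
Proof. by rewrite /= expr0n addr0 sqrtr_sqr. Qed.

Lemma normcX (x : C) n : normc (x ^+ n) = normc x ^+ n.
Proof. by elim: n => [|n IH]; rewrite ?expr0 ?normc1// !exprS normcM IH. Qed.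

Lemma ord2P (P : 'I_2 -> Prop) : P 0 -> P 1 -> forall i, P i.
Proof.
by move=> P0 P1 [[|[|//]] h]; [have -> : Ordinal h = 0 by exact/val_inj
  |have -> : Ordinal h = 1 by exact/val_inj].
Qed.

Lemma sum_ord2 (V : nmodType) (f : 'I_2 -> V) : \sum_i f i = f 0 + f 1.
Proof. by rewrite !big_ord_recl big_ord0 addr0; congr (_ + f _); exact/val_inj. Qed.

Lemma mulmx2E (m n : nat) (A : 'M[C]_(m, 2)) (B : 'M[C]_(2, n)) i j :
  (A *m B) i j = A i 0 * B 0 j + A i 1 * B 1 j.
Proof. by rewrite mxE sum_ord2. Qed.

Lemma mx2P (A B : 'M[C]_2) : A 0 0 = B 0 0 -> A 0 1 = B 0 1 ->
  A 1 0 = B 1 0 -> A 1 1 = B 1 1 -> A = B.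
Proof.
move=> h00 h01 h10 h11; apply/matrixP => i j.
by move: i j; apply: ord2P => [|]; apply: ord2P.
Qed.

Lemma cv2P (u v : 'cV[C]_2) : u 0 0 = v 0 0 -> u 1 0 = v 1 0 -> u = v.
Proof. by move=> h0 h1; apply/matrixP => i j; rewrite ord1; move: i; apply: ord2P. Qed.

Definition vec (x y : C) : 'cV[C]_2 := \col_i (if i == 0 then x else y).

Lemma vec0E x y : vec x y 0 0 = x. Proof. by rewrite mxE. Qed.
Lemma vec1E x y : vec x y 1 0 = y. Proof. by rewrite mxE. Qed.

Lemma mx2E (a b c d : C) :
  (mx2 a b c d 0 0 = a) * (mx2 a b c d 0 1 = b) *
  (mx2 a b c d 1 0 = c) * (mx2 a b c d 1 1 = d).
Proof. by rewrite /mx2 !mxE. Qed.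

Definition vnorm (v : 'cV[C]_2) : R := normc (v 0 0) + normc (v 1 0).

Definition mnorm (A : 'M[C]_2) : R :=
  normc (A 0 0) + normc (A 0 1) + normc (A 1 0) + normc (A 1 1).

Lemma vnorm_ge0 (v : 'cV[C]_2) : 0 <= vnorm v.
Proof. by rewrite addr_ge0 ?normc_ge0. Qed.

Lemma mnorm_ge0 (A : 'M[C]_2) : 0 <= mnorm A.
Proof. by rewrite !addr_ge0 ?normc_ge0. Qed.

Lemma vnorm_eq0 (v : 'cV[C]_2) : (vnorm v == 0) = (v == 0).
Proof.
rewrite /vnorm paddr_eq0 ?normc_ge0// !normc_eq0.
apply/andP/eqP => [[/eqP v0 /eqP v1]|->]; last by rewrite !mxE eqxx.
by apply: cv2P; rewrite mxE.
Qed.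

Lemma vnorm_gt0 (v : 'cV[C]_2) : (0 < vnorm v) = (v != 0).
Proof. by rewrite lt_def vnorm_ge0 andbT vnorm_eq0. Qed.

Lemma vnormZ (c : C) (v : 'cV[C]_2) : vnorm (c *: v) = normc c * vnorm v.
Proof. by rewrite /vnorm !mxE !normcM mulrDr. Qed.

Lemma mnorm_eq0 (A : 'M[C]_2) : mnorm A = 0 -> A = 0.
Proof.
move=> h; have := normc_ge0 (A 0 0); have := normc_ge0 (A 0 1).
have := normc_ge0 (A 1 0); have := normc_ge0 (A 1 1); move: h.
rewrite /mnorm => *.
by apply: mx2P; rewrite mxE; apply: eq0_normc; lra.
Qed.

Lemma mnormZ (c : C) (A : 'M[C]_2) : mnorm (c *: A) = normc c * mnorm A.
Proof. by rewrite /mnorm !mxE !normcM !mulrDr. Qed.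

Lemma ler_entry_mnorm (A : 'M[C]_2) k l : normc (A k l) <= mnorm A.
Proof.
have := normc_ge0 (A 0 0); have := normc_ge0 (A 0 1).
have := normc_ge0 (A 1 0); have := normc_ge0 (A 1 1).
rewrite /mnorm; move: k l; apply: ord2P; apply: ord2P; lra.
Qed.

Lemma normcMD (a b c d : C) :
  normc (a * b + c * d) <= normc a * normc b + normc c * normc d.
Proof. by rewrite -!normcM ler_normcD. Qed.

Lemma vnormM (A : 'M[C]_2) (v : 'cV[C]_2) : vnorm (A *m v) <= mnorm A * vnorm v.
Proof.
rewrite /vnorm !mulmx2E /mnorm.
have := normcMD (A 0 0) (v 0 0) (A 0 1) (v 1 0).
have := normcMD (A 1 0) (v 0 0) (A 1 1) (v 1 0).
have := normc_ge0 (A 0 0); have := normc_ge0 (A 0 1).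
have := normc_ge0 (A 1 0); have := normc_ge0 (A 1 1).
have := normc_ge0 (v 0 0); have := normc_ge0 (v 1 0).
nra.
Qed.

Lemma mnorm_col (A : 'M[C]_2) : mnorm A = vnorm (col 0 A) + vnorm (col 1 A).
Proof. by rewrite /mnorm /vnorm !mxE; ring. Qed.

Lemma mnormM (A B : 'M[C]_2) : mnorm (A *m B) <= mnorm A * mnorm B.
Proof.
have colM j : col j (A *m B) = A *m col j B.
  by apply/matrixP => k l; rewrite !mxE; apply: eq_bigr => h _; rewrite mxE.
rewrite (mnorm_col (A *m B)) (mnorm_col B) mulrDr !colM.
by rewrite lerD// vnormM.
Qed.

Lemma det2E (A : 'M[C]_2) : \det A = A 0 0 * A 1 1 - A 0 1 * A 1 0.
Proof. exact: det_mx22. Qed.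

Lemma det_vnorm (A : 'M[C]_2) (v : 'cV[C]_2) : normc (\det A) * vnorm v <= mnorm A * vnorm (A *m v).
Proof.
pose B : 'M[C]_2 := mx2 (A 1 1) (- A 0 1) (- A 1 0) (A 0 0).
have -> : mnorm A = mnorm B by rewrite /mnorm /B !mx2E !normcN; ring.
rewrite -vnormZ; apply: le_trans (vnormM _ _); rewrite le_eqVlt; apply/orP; left.
apply/eqP; congr vnorm; apply: cv2P; rewrite !mulmx2E !mxE det2E /=; ring.
Qed.

Lemma det_mnorm (A : 'M[C]_2) : normc (\det A) <= mnorm A ^+ 2.
Proof.
rewrite det2E; apply: le_trans (ler_normcB _ _) _; rewrite !normcM /mnorm.
have := normc_ge0 (A 0 0); have := normc_ge0 (A 0 1).
have := normc_ge0 (A 1 0); have := normc_ge0 (A 1 1).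
nra.
Qed.

End TwoByTwo.

(** * The Lyapunov exponent of a finite family of matrices *)

Section LyapunovExponent.
Context {R : realType} {I : finType} (p : I -> R).
Hypothesis p_gt0 : forall i, 0 < p i.
Hypothesis p_sum1 : \sum_i p i = 1.
Local Notation C := R[i].
Implicit Types (A : I -> 'M[C]_2) (w : seq I).

(** The first letter acts first on column vectors, so that the prefixes of a word
    describe the orbit of a vector. *)
Fixpoint wprod A w : 'M[C]_2 :=
  if w is i :: v then wprod A v *m A i else 1%:M.

Lemma wprod_cat A u v : wprod A (u ++ v) = wprod A v *m wprod A u.
Proof. by elim: u => [|i u IH] /=; rewrite ?mulmx1// IH mulmxA. Qed.

Lemma det_wprod A w : \det (wprod A w) = \prod_(i <- w) \det (A i).
Proof.
elim: w => [|i w IH]; first by rewrite det1 big_nil.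
by rewrite /= det_mulmx IH big_cons mulrC.
Qed.

Definition growth A n := expect p n (fun w => ln (mnorm (wprod A w))).

(** By Fekete's lemma this infimum is the limit of [growth A n / n], that is the
    top Lyapunov exponent of independent products of law [p]. *)
Definition lexp A := inf [set growth A n.+1 / n.+1%:R | n in [set: nat]].

Definition mean (x : I -> R) := \sum_i p i * x i.

Definition ldet A := mean (fun i => ln (normc (\det (A i)))).

Definition nondegenerate A := forall i, \det (A i) != 0.

Lemma mnorm1 : mnorm (1%:M : 'M[C]_2) = 2.
Proof. by rewrite /mnorm !mxE !eqxx ?mulr1n ?mulr0n normc1 normc0; lra. Qed.

Lemma expect_letters (x : I -> R) n :
  expect p n (fun w => \sum_(i <- w) x i) = n%:R * mean x.
Proof.
elim: n => [|n IH]; first by rewrite mul0r /= big_nil.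
rewrite /= -natr1 mulrDl mul1r -IH addrC.
rewrite -[X in _ + X]mul1r -p_sum1 mulr_suml /mean -big_split; apply: eq_bigr => i _ /=.
rewrite -mulrDr; congr (_ * _).
rewrite -[x i in RHS](expect_cst p_sum1 n) -expectD.
by apply: eq_expect => w _; rewrite big_cons.
Qed.

Lemma letters_deviation (x : I -> R) (e : R) : 0 < e ->
  exists n0, forall n, (n0 <= n)%N ->
    expect p n (fun w => `|\sum_(i <- w) x i - n%:R * mean x|) <= e * n%:R.
Proof.
move=> e0.
have [n0 h] := block_sum_deviation p_gt0 p_sum1 1 (fun w => \sum_(i <- w) x i) e0.
exists n0 => n /h; rewrite muln1 expect_letters mul1r.
congr (_ <= _); apply: eq_expect => w <-; congr (`|_ - _|).
elim: w => [|i w IH]; first by rewrite big_nil.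
by rewrite /= take0 drop0 IH !big_cons big_nil addr0.
Qed.

Lemma ler_mean (x y : I -> R) : (forall i, x i <= y i) -> mean x <= mean y.
Proof. by move=> xy; apply: ler_sum => i _; rewrite ler_pM2l. Qed.

Lemma meanD (x y : I -> R) : mean (fun i => x i + y i) = mean x + mean y.
Proof. by rewrite /mean -big_split; apply: eq_bigr => i _; rewrite mulrDr. Qed.

Lemma meanZ c (x : I -> R) : mean (fun i => c * x i) = c * mean x.
Proof. by rewrite /mean mulr_sumr; apply: eq_bigr => i _; rewrite mulrCA. Qed.

Lemma mean_cst (c : R) : mean (fun=> c) = c.
Proof. by rewrite /mean -mulr_suml p_sum1 mul1r. Qed.

Section Nondegenerate.
Variable A : I -> 'M[C]_2.
Hypothesis A_nd : nondegenerate A.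

Lemma det_wprod_neq0 w : \det (wprod A w) != 0.
Proof.
by elim: w => [|i w IH] /=; rewrite ?det1 ?oner_eq0// det_mulmx mulf_neq0.
Qed.

Lemma mnorm_gt0_det (M : 'M[C]_2) : \det M != 0 -> 0 < mnorm M.
Proof.
move=> dM; rewrite lt_def mnorm_ge0 andbT; apply: contra dM => /eqP M0.
by rewrite (mnorm_eq0 M0) det2E !mxE !mul0r subr0.
Qed.

Lemma mnorm_wprod_gt0 w : 0 < mnorm (wprod A w).
Proof. by rewrite mnorm_gt0_det// det_wprod_neq0. Qed.

Lemma mulmx_neq0 (M : 'M[C]_2) (v : 'cV[C]_2) : \det M != 0 -> v != 0 -> M *m v != 0.
Proof.
move=> dM v0; rewrite -vnorm_gt0; have := det_vnorm M v.
rewrite -vnorm_gt0 in v0; rewrite -normc_gt0 in dM => h.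
have := lt_le_trans (mulr_gt0 dM v0) h.
by rewrite pmulr_rgt0// mnorm_gt0_det// -normc_gt0.
Qed.

Lemma ln_mnorm_wprod_cat u v : ln (mnorm (wprod A (u ++ v))) <=
  ln (mnorm (wprod A u)) + ln (mnorm (wprod A v)).
Proof.
have uv := mnorm_wprod_gt0; rewrite -lnM ?posrE//.
by rewrite ler_ln ?posrE ?mulr_gt0// wprod_cat mulrC mnormM.
Qed.

Lemma growthD m n : growth A (m + n) <= growth A m + growth A n.
Proof.
rewrite /growth expect_cat.
rewrite -[X in _ <= _ + X](expect_cst p_sum1 m) -expectD.
apply: (le_expect p_gt0) => u _.
rewrite -[X in _ <= X + _](expect_cst p_sum1 n) -expectD.
by apply: (le_expect p_gt0) => v _; exact: ln_mnorm_wprod_cat.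
Qed.

Lemma growth0 : growth A 0 = ln 2.
Proof. by rewrite /growth /= mnorm1. Qed.

Lemma growth_mul k m : (0 < k)%N -> growth A (k * m) <= k%:R * growth A m.
Proof.
case: k => // k _; elim: k => [|k IH]; first by rewrite mul1n mul1r.
rewrite mulSn; apply: le_trans (growthD _ _) _.
by rewrite -(natr1 k.+1) mulrDl mul1r addrC lerD2r.
Qed.

Lemma ln_det_wprod w : ln (normc (\det (wprod A w))) =
  \sum_(i <- w) ln (normc (\det (A i))).
Proof.
rewrite det_wprod; elim: w => [|i w IH]; first by rewrite !big_nil normc1 ln1.
rewrite !big_cons normcM lnM ?posrE ?normc_gt0//; first by rewrite IH.
by rewrite -det_wprod det_wprod_neq0.
Qed.

(** In dimension two the determinant is bounded by the square of the norm, so the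
    two exponents, whose sum is [ldet A], have the larger one at least half of it. *)
Lemma growth_ge n : n%:R * (ldet A / 2) <= growth A n.
Proof.
rewrite mulrA /ldet -expect_letters mulrC -expectZ; apply: (le_expect p_gt0) => w _.
rewrite -ln_det_wprod.
have h := det_mnorm (wprod A w); have d0 : 0 < normc (\det (wprod A w)).
  by rewrite normc_gt0 det_wprod_neq0.
have : ln (normc (\det (wprod A w))) <= ln (mnorm (wprod A w) ^+ 2).
  by rewrite ler_ln ?posrE ?exprn_gt0 ?mnorm_wprod_gt0.
by rewrite lnXn ?mnorm_wprod_gt0// -mulr_natl; lra.
Qed.

Lemma lexp_has_inf : has_inf [set growth A n.+1 / n.+1%:R | n in [set: nat]].
Proof.
split; first by exists (growth A 1 / 1), 0%N.
exists (ldet A / 2) => _ [n _ <-].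
by rewrite ler_pdivlMr// mulrC growth_ge.
Qed.

Lemma lexp_le n : (0 < n)%N -> n%:R * lexp A <= growth A n.
Proof.
case: n => // n _; rewrite mulrC -ler_pdivlMr//.
by apply: ge_inf; [exact: lexp_has_inf.2 | exists n].
Qed.

Lemma lexp_approx (e : R) : 0 < e ->
  exists2 m, (0 < m)%N & growth A m < m%:R * (lexp A + e).
Proof.
move=> e0; have [_ [n _ <-]] := inf_adherent e0 lexp_has_inf.
by rewrite ltr_pdivrMr// => h; exists n.+1 => //; rewrite mulrC.
Qed.

(** Subadditivity repeats a block of nearly optimal length, which absorbs the
    constant [D]. *)
Lemma lexp_ge (c D : R) : (forall n, n%:R * c - D <= growth A n) -> c <= lexp A.
Proof.
move=> h; apply/ler_addgt0Pr => e e0.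
have [m m0 hm] := lexp_approx e0.
rewrite leNgt; apply/negP => hc.
pose d := m%:R * (c - (lexp A + e)).
have d0 : 0 < d by rewrite mulr_gt0 ?ltr0n ?subr_gt0.
pose k := (Num.truncn (D / d)).+1.
have kd : D < k%:R * d by rewrite -ltr_pdivrMr// truncnS_gt.
have k0 : 0 < k%:R :> R by rewrite ltr0n.
have := h (k * m)%N; have := growth_mul m (isT : (0 < k)%N).
rewrite natrM.
have : k%:R * growth A m < k%:R * (m%:R * (lexp A + e)) by rewrite ltr_pM2l.
rewrite /d in kd; nra.
Qed.

Lemma ldet_le_lexp : ldet A / 2 <= lexp A.
Proof. by apply: (@lexp_ge _ 0) => n; rewrite subr0 growth_ge. Qed.

Lemma ln_wprod_block m k w : size w = (k * m)%N ->
  ln (mnorm (wprod A w)) <=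
    ln 2 + block_sum m (fun u => ln (mnorm (wprod A u))) k w.
Proof.
elim: k w => [|k IH] w sw.
  by rewrite (size0nil sw) /= mnorm1 addr0.
rewrite -{1}(cat_take_drop m w) /= addrCA; apply: le_trans (ln_mnorm_wprod_cat _ _) _.
by rewrite lerD2l IH// size_drop sw mulSn addKn.
Qed.

Lemma ln2_ge0 : 0 <= ln 2 :> R.
Proof. by rewrite ln_ge0// ler1n. Qed.

(** The norm of a random product is unlikely to lag behind its exponent: its
    logarithm is bounded above by a sum of independent blocks, which
    concentrates, while its mean is at least [n * lexp A]. *)
Lemma lexp_lower_deviation (kappa K eta : R) : kappa < lexp A -> 0 < K -> 0 < eta ->
  exists n, expect p n
    (fun w => (mnorm (wprod A w) <= K * expR (n%:R * kappa))%R%:R) < eta.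
Proof.
move=> kl K0 eta0.
pose e := lexp A - kappa; have e0 : 0 < e by rewrite subr_gt0.
pose d := eta * e / 7; have d0 : 0 < d by rewrite !mulr_gt0.
have [m m0 hm] := lexp_approx d0.
pose F w := ln (mnorm (wprod A w)).
have [k0 hk0] := block_sum_deviation p_gt0 p_sum1 m F d0.
pose B := Num.max (ln 2 / d) (2 * ln K / e).
pose k := maxn k0 (Num.truncn B).+1.
have kB : B < k%:R.
  by apply: lt_le_trans (truncnS_gt _) _; rewrite ler_nat leq_maxr.
have k_gt0 : (0 < k)%N by rewrite /k leq_max orbT.
have kR0 : 0 < k%:R :> R by rewrite ltr0n.
have mR1 : 1 <= m%:R :> R by rewrite ler1n.
move: kB; rewrite gt_max => /andP[]; rewrite !ltr_pdivrMr// => k1 k2.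
exists (k * m)%N.
pose a := expect p m F.
pose V w := (ln 2 + block_sum m F k w - F w) + `|block_sum m F k w - k%:R * a|.
have V0 w : size w = (k * m)%N -> 0 <= V w.
  by move=> sw; rewrite addr_ge0// subr_ge0 ln_wprod_block.
pose c := k%:R * m%:R * e / 2.
have c0 : 0 < c by rewrite !mulr_gt0// ltr0n.
apply: le_lt_trans (_ : expect p (k * m) V / c < _).
  apply: le_trans (markov_expect p_gt0 c0 V0).
  apply: (le_expect p_gt0) => w sw; rewrite ler_nat.
  case: (lerP (mnorm _)) => // hw; case: lerP => //.
  rewrite ltNge => /negP[].
  move: hw; rewrite -ler_ln ?posrE ?mnorm_wprod_gt0 ?mulr_gt0 ?expR_gt0//.
  rewrite lnM ?posrE ?expR_gt0// expRK natrM -/(F w) => hw.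
  have ha : m%:R * lexp A <= a by exact: lexp_le.
  have hka : k%:R * (m%:R * lexp A) <= k%:R * a by rewrite ler_pM2l.
  have := ler_norm (- (block_sum m F k w - k%:R * a)); rewrite normrN.
  have := ln2_ge0; rewrite /V /c.
  have : k%:R * e <= k%:R * m%:R * e by rewrite ler_pM2r// ler_peMr// ltW.
  rewrite /e in k2 *.
  lra.
rewrite ltr_pdivrMr// /V expectD expectB expectD (expect_cst p_sum1) expect_block_sum//.
have := hk0 k (leq_maxl _ _); rewrite -/a.
have := lexp_le (_ : (0 < k * m)%N); rewrite muln_gt0 k_gt0 m0 => /(_ isT).
rewrite natrM /growth -/F.
have hka : k%:R * a < k%:R * (m%:R * (lexp A + d)) by rewrite ltr_pM2l.
have kd : k%:R * d <= k%:R * m%:R * d by rewrite ler_pM2r// ler_peMr// ltW.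
have ce : eta * c = 7 / 2 * (k%:R * m%:R * d) by rewrite /c /d; field.
have : 0 < k%:R * m%:R * d by rewrite !mulr_gt0// ltr0n.
rewrite ce; lra.
Qed.

End Nondegenerate.

End LyapunovExponent.

(** * Limits of complex matrices along a filter *)

Section ComplexLimits.
Context {R : realType} {X : Type} (F : set_system X) {FF : Filter F}.
Local Notation C := R[i].

(** Complex limits are taken on the real and imaginary parts, where the topology
    of the reals is at hand. *)
Definition clim (f : X -> C) (l : C) :=
  complex.Re (f x) @[x --> F] --> complex.Re l /\ complex.Im (f x) @[x --> F] --> complex.Im l.

Lemma clim_cst (c : C) : clim (fun=> c) c.
Proof. by split; exact: cvg_cst. Qed.

Lemma ReD (x y : C) : complex.Re (x + y) = complex.Re x + complex.Re y.
Proof. by case: x y => [a b] [c d]. Qed.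

Lemma ImD (x y : C) : complex.Im (x + y) = complex.Im x + complex.Im y.
Proof. by case: x y => [a b] [c d]. Qed.

Lemma ReN (x : C) : complex.Re (- x) = - complex.Re x. Proof. by case: x. Qed.

Lemma ImN (x : C) : complex.Im (- x) = - complex.Im x. Proof. by case: x. Qed.

Lemma climD f g l m : clim f l -> clim g m -> clim (fun x => f x + g x) (l + m).
Proof.
move=> [fr fi] [gr gi]; rewrite /clim; split.
  by rewrite ReD; under eq_fun do rewrite ReD; apply: cvgD.
by rewrite ImD; under eq_fun do rewrite ImD; apply: cvgD.
Qed.

Lemma climN f l : clim f l -> clim (fun x => - f x) (- l).
Proof.
move=> [fr fi]; rewrite /clim; split.
  by rewrite ReN; under eq_fun do rewrite ReN; apply: cvgN.
by rewrite ImN; under eq_fun do rewrite ImN; apply: cvgN.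
Qed.

Lemma climB f g l m : clim f l -> clim g m -> clim (fun x => f x - g x) (l - m).
Proof. by move=> fl gm; apply: climD fl (climN gm). Qed.

Lemma ReM (x y : C) : complex.Re (x * y) = complex.Re x * complex.Re y - complex.Im x * complex.Im y.
Proof. by case: x y => [a b] [c d]. Qed.

Lemma ImM (x y : C) : complex.Im (x * y) = complex.Re x * complex.Im y + complex.Im x * complex.Re y.
Proof. by case: x y => [a b] [c d]. Qed.

Lemma climM f g l m : clim f l -> clim g m -> clim (fun x => f x * g x) (l * m).
Proof.
move=> [fr fi] [gr gi]; rewrite /clim; split.
  under eq_fun do rewrite ReM; rewrite ReM.
  by apply: cvgB; exact: cvgM.
under eq_fun do rewrite ImM; rewrite ImM.
by apply: cvgD; exact: cvgM.
Qed.

Lemma normcE (x : C) : normc x = Num.sqrt (complex.Re x ^+ 2 + complex.Im x ^+ 2).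
Proof. by case: x. Qed.

Lemma clim_normc f l : clim f l -> normc (f x) @[x --> F] --> normc l.
Proof.
move=> [fr fi]; rewrite normcE; under eq_fun do rewrite normcE.
apply: continuous_cvg; first exact: sqrt_continuous.
by rewrite !expr2; under eq_fun do rewrite !expr2; apply: cvgD; apply: cvgM.
Qed.

Lemma clim_near f l : clim f l <->
  (forall e, 0 < e -> \forall x \near F, normc (f x - l) < e).
Proof.
split=> [fl e e0|h].
  have := clim_normc (climB fl (clim_cst l)); rewrite subrr normc0.
  by move=> /cvgr_lt; exact.
have Re_le (z : C) : `|complex.Re z| <= normc z.
  by rewrite normcE -sqrtr_sqr ler_wsqrtr// lerDl sqr_ge0.
have Im_le (z : C) : `|complex.Im z| <= normc z.
  by rewrite normcE -sqrtr_sqr ler_wsqrtr// lerDr sqr_ge0.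
split; apply/cvgrPdist_lt => e e0; move: (h _ e0); apply: filterS => x.
  by apply: le_lt_trans; rewrite distrC -ReN -ReD; exact: Re_le.
by apply: le_lt_trans; rewrite distrC -ImN -ImD; exact: Im_le.
Qed.

Lemma clim_horner (q : {poly C}) f l :
  clim f l -> clim (fun x => q.[f x]) q.[l].
Proof.
move=> fl; elim/poly_ind: q => [|q c IH].
  by rewrite horner0; under eq_fun do rewrite horner0; exact: clim_cst.
rewrite !hornerE; under eq_fun do rewrite !hornerE.
by apply: climD; [exact: climM|exact: clim_cst].
Qed.

Lemma clim_eq_near f g l : (\forall x \near F, f x = g x) -> clim f l -> clim g l.
Proof.
move=> fg /clim_near fl; apply/clim_near => e /fl; apply: filterS2 fg => x ->.
by [].
Qed.

Definition mlim m n (f : X -> 'M[C]_(m, n)) (L : 'M[C]_(m, n)) :=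
  forall i j, clim (fun x => f x i j) (L i j).

Lemma mlim_cst m n (L : 'M[C]_(m, n)) : mlim (fun=> L) L.
Proof. by move=> i j; exact: clim_cst. Qed.

Lemma mlimM m n (f : X -> 'M[C]_(m, 2)) (g : X -> 'M[C]_(2, n)) L K :
  mlim f L -> mlim g K -> mlim (fun x => f x *m g x) (L *m K).
Proof.
move=> fL gK i j; rewrite mulmx2E.
by under eq_fun do rewrite mulmx2E; apply: climD; apply: climM.
Qed.

Lemma mlimZ m n (a : X -> C) (f : X -> 'M[C]_(m, n)) l L :
  clim a l -> mlim f L -> mlim (fun x => a x *: f x) (l *: L).
Proof.
move=> al fL i j; rewrite mxE.
by under eq_fun do rewrite mxE; apply: climM.
Qed.

Lemma mlim_det (f : X -> 'M[C]_2) L : mlim f L -> clim (fun x => \det (f x)) (\det L).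
Proof.
move=> fL; rewrite det2E.
by under eq_fun do rewrite det2E; apply: climB; apply: climM.
Qed.

Lemma mlim_mnorm f L : mlim f L -> mnorm (f x) @[x --> F] --> mnorm L.
Proof. by move=> fL; do 3?apply: cvgD; apply: clim_normc. Qed.

Lemma mlim_vnorm f L : mlim f L -> vnorm (f x) @[x --> F] --> vnorm L.
Proof. by move=> fL; apply: cvgD; apply: clim_normc. Qed.

Lemma mlim_wprod (I : finType) (f : X -> I -> 'M[C]_2) A w :
  (forall i, mlim (f^~ i) (A i)) -> mlim (fun x => wprod (f x) w) (wprod A w).
Proof.
by move=> fA; elim: w => [|i w IH] /=; [exact: mlim_cst|exact: mlimM].
Qed.

Lemma cvg_sum (J : Type) (s : seq J) (f : X -> J -> R) (g : J -> R) :
  (forall j, f x j @[x --> F] --> g j) ->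
  \sum_(j <- s) f x j @[x --> F] --> \sum_(j <- s) g j.
Proof.
move=> fg; elim: s => [|j s IH].
  by rewrite big_nil; under eq_fun do rewrite big_nil; exact: cvg_cst.
by rewrite big_cons; under eq_fun do rewrite big_cons; exact: cvgD.
Qed.

Lemma cvg_expect (I : finType) (p : I -> R) n (f : X -> seq I -> R) (g : seq I -> R) :
  (forall w, f x w @[x --> F] --> g w) ->
  expect p n (f x) @[x --> F] --> expect p n g.
Proof.
move: f g; elim: n => [|n IH] f g fg; first exact: fg.
apply: (@cvg_sum _ (index_enum I)
  (fun x i => p i * expect p n (fun w => f x (i :: w)))
  (fun i => p i * expect p n (fun w => g (i :: w)))) => i.
by apply: cvgMl_tmp; apply: IH => w; exact: fg.
Qed.

Lemma cvg_ln (f : X -> R) (l : R) : 0 < l -> f x @[x --> F] --> l ->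
  ln (f x) @[x --> F] --> ln l.
Proof. by move=> l0; apply: continuous_cvg; exact: continuous_ln. Qed.

Section Families.
Context {I : finType} (p : I -> R).
Variables (f : X -> I -> 'M[C]_2) (A : I -> 'M[C]_2).
Hypothesis fA : forall i, mlim (f^~ i) (A i).
Hypothesis A_nd : nondegenerate A.

Lemma cvg_growth n : growth p (f x) n @[x --> F] --> growth p A n.
Proof.
apply: cvg_expect => w; apply: cvg_ln; first exact: mnorm_wprod_gt0.
by apply: mlim_mnorm; apply: mlim_wprod.
Qed.

Lemma near_nondegenerate : \forall x \near F, nondegenerate (f x).
Proof.
have : \forall x \near F, forall i, i \in index_enum I -> 0 < normc (\det (f x i)).
  elim: (index_enum I) => [|i s IH]; first by apply: nearW.
  have hi : \forall x \near F, 0 < normc (\det (f x i)).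
    have /cvgr_gt := clim_normc (mlim_det (fA i)); apply.
    by rewrite normc_gt0 A_nd.
  apply: filterS2 hi IH => x hx hs j; rewrite inE => /predU1P[->//|/hs//].
by apply: filterS => x h i; rewrite -normc_gt0 h// mem_index_enum.
Qed.

Lemma cvg_ldet : ldet p (f x) @[x --> F] --> ldet p A.
Proof.
apply: (@cvg_sum _ (index_enum I) (fun x i => p i * ln (normc (\det (f x i))))
  (fun i => p i * ln (normc (\det (A i))))) => i.
apply: cvgMl_tmp; apply: cvg_ln; first by rewrite normc_gt0 A_nd.
exact/clim_normc/mlim_det.
Qed.

End Families.
End ComplexLimits.

Lemma ultra_fmap (X Y : Type) (h : X -> Y) (U : set_system X) :
  UltraFilter U -> UltraFilter (h @ U).
Proof.
move=> UF; have PF : ProperFilter U by exact: ultra_proper.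
split; first exact: fmap_proper_filter.
move=> G GF hUG; rewrite eqEsubset; split => // B GB.
have [//|nB] := in_ultra_setVsetC (h @^-1` B) UF.
have GnB : G (~` B) by apply: hUG.
have FG : Filter G by exact: filter_filter.
by have /filter_ex[y []] : G (B `&` ~` B) by exact: filterI.
Qed.

Section UltraLimits.
Context {R : realType} {X : Type} (U : set_system X) {UF : UltraFilter U}.
Local Notation C := R[i].

(** Compactness of closed discs, in a form that needs no subsequences. *)
Lemma bounded_ultra_lim (f : X -> C) (K : R) :
  (\forall x \near U, normc (f x) <= K) -> exists l, clim U f l.
Proof.
have PF : ProperFilter U by exact: ultra_proper.
have lim1 (h : X -> R) : (\forall x \near U, `|h x| <= K) ->
    exists l : R, h x @[x --> U] --> l.
  move=> hK; have := @segment_compact R (- K) K; rewrite compact_ultra.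
  move=> /(_ (h @ U) (ultra_fmap h UF)); case.
    by apply: filterS hK => x; rewrite /= in_itv /= ler_norml.
  by move=> l [_ hl]; exists l.
move=> fK.
have Re_le (z : C) : `|complex.Re z| <= normc z.
  by rewrite normcE -sqrtr_sqr ler_wsqrtr// lerDl sqr_ge0.
have Im_le (z : C) : `|complex.Im z| <= normc z.
  by rewrite normcE -sqrtr_sqr ler_wsqrtr// lerDr sqr_ge0.
have [|a ha] := lim1 (fun x => complex.Re (f x)).
  by apply: filterS fK => x; apply: le_trans.
have [|b hb] := lim1 (fun x => complex.Im (f x)).
  by apply: filterS fK => x; apply: le_trans.
by exists (Complex a b); split.
Qed.

End UltraLimits.

(** * Probability that an orbit stays bounded *)

Section StayProbability.
Context {R : realType} {I : finType} (p : I -> R).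
Hypothesis p_gt0 : forall i, 0 < p i.
Hypothesis p_sum1 : \sum_i p i = 1.
Local Notation C := R[i].

Definition wedge (u v : 'cV[C]_2) : C := u 0 0 * v 1 0 - u 1 0 * v 0 0.

Lemma wedgeM (M : 'M[C]_2) u v : wedge (M *m u) (M *m v) = \det M * wedge u v.
Proof. rewrite /wedge !mulmx2E det2E; ring. Qed.

Lemma wedgeC u v : wedge v u = - wedge u v.
Proof. rewrite /wedge; ring. Qed.

Lemma wedgeZl c u v : wedge (c *: u) v = c * wedge u v.
Proof. rewrite /wedge !mxE; ring. Qed.

Lemma wedgeZr c u v : wedge u (c *: v) = c * wedge u v.
Proof. rewrite /wedge !mxE; ring. Qed.

Lemma wedge0 u v : u != 0 -> v != 0 -> wedge u v = 0 ->
  exists2 c, c != 0 & v = c *: u.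
Proof.
move=> u0 v0; rewrite /wedge => /eqP; rewrite subr_eq0 => /eqP h.
have [u00|u00] := eqVneq (u 0 0) 0.
  have u10 : u 1 0 != 0.
    by apply: contra u0 => /eqP u10; apply/eqP/cv2P; rewrite mxE.
  have v00 : v 0 0 = 0.
    by apply: (mulfI u10); rewrite -h u00 mul0r mulr0.
  have vE : v = (v 1 0 / u 1 0) *: u.
    by apply: cv2P; rewrite mxE ?u00 ?mulr0// divfK.
  exists (v 1 0 / u 1 0) => //.
  by apply: contra v0 => /eqP c0; rewrite vE c0 scale0r.
have vE : v = (v 0 0 / u 0 0) *: u.
  apply: cv2P; rewrite mxE; first by rewrite divfK.
  by apply: (mulfI u00); rewrite h; field.
exists (v 0 0 / u 0 0) => //.
by apply: contra v0 => /eqP c0; rewrite vE c0 scale0r.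
Qed.

Lemma wedge_neq0 u v : wedge u v != 0 -> u != 0 /\ v != 0.
Proof.
by move=> uv; split; apply: contra uv => /eqP ->; rewrite /wedge !mxE
  ?mul0r ?mulr0 subr0.
Qed.

Definition frame (u v : 'cV[C]_2) : 'M[C]_2 := mx2 (u 0 0) (v 0 0) (u 1 0) (v 1 0).

Lemma det_frame u v : \det (frame u v) = wedge u v.
Proof. by rewrite det2E !mx2E /wedge; ring. Qed.

Lemma mnorm_mul_frame M u v : mnorm (M *m frame u v) = vnorm (M *m u) + vnorm (M *m v).
Proof. by rewrite /mnorm /vnorm !mulmx2E !mx2E; ring. Qed.

Lemma mnorm_le_frame M u v : wedge u v != 0 ->
  mnorm M <= (vnorm (M *m u) + vnorm (M *m v)) * mnorm (invmx (frame u v)).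
Proof.
move=> uv; rewrite -mnorm_mul_frame; apply: le_trans (mnormM _ _).
by rewrite -mulmxA mulmxV ?mulmx1// unitmxE det_frame unitfE.
Qed.

Section Family.
Variable B : I -> 'M[C]_2.

Fixpoint stay (w : seq I) (v : 'cV[C]_2) : bool :=
  (vnorm v <= 1) && (if w is i :: w' then stay w' (B i *m v) else true).

Definition stayp n v := expect p n (fun w => (stay w v)%:R).

Lemma stay_catl u w v : stay (u ++ w) v -> stay u v.
Proof.
elim: u v => [|i u IH] v /=; first by case: w => [|j w] /= /andP[->].
by case/andP => -> /IH.
Qed.

Lemma stay_last w v : stay w v -> vnorm (wprod B w *m v) <= 1.
Proof.
elim: w v => [|i w IH] v /=; first by rewrite mul1mx andbT.
by case/andP => _ /IH; rewrite mulmxA.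
Qed.

Lemma stayp_ge0 n v : 0 <= stayp n v.
Proof. by apply: (expect_ge0 p_gt0 p_sum1) => w _. Qed.

Lemma stayp_le1 n v : stayp n v <= 1.
Proof. by apply: (expect_le p_gt0 p_sum1) => w _; case: stay. Qed.

Lemma stayp_decr m n v : stayp (m + n) v <= stayp m v.
Proof.
rewrite /stayp expect_cat; apply: (le_expect p_gt0) => u _.
apply: (expect_le p_gt0 p_sum1) => w _; rewrite ler_nat.
by have := @stay_catl u w v; case: stay => // ->.
Qed.

Lemma stayp_le m n v : (m <= n)%N -> stayp n v <= stayp m v.
Proof. by move=> mn; rewrite -(subnKC mn) stayp_decr. Qed.

Lemma staypS n v : stayp n.+1 v <= \sum_i p i * stayp n (B i *m v).
Proof.
apply: ler_sum => i _; rewrite ler_pM2l//; apply: (le_expect p_gt0) => w _.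
by rewrite ler_nat /=; case: (_ <= _).
Qed.

(** The probability that the orbit of [v] never leaves the unit ball. *)
Definition stayoo v := inf [set stayp n v | n in [set: nat]].

Lemma stayoo_has_inf v : has_inf [set stayp n v | n in [set: nat]].
Proof.
by split; [exists (stayp 0 v), 0%N|exists 0 => _ [n _ <-]; exact: stayp_ge0].
Qed.

Lemma stayoo_le n v : stayoo v <= stayp n v.
Proof. by apply: ge_inf; [exact: (stayoo_has_inf v).2|exists n]. Qed.

Lemma stayoo_ge c v : (forall n, c <= stayp n v) -> c <= stayoo v.
Proof.
move=> h; apply: lb_le_inf; first exact: (stayoo_has_inf v).1.
by move=> _ [n _ <-].
Qed.

Lemma stayoo_approx e v : 0 < e -> exists n, stayp n v < stayoo v + e.
Proof.
by move=> e0; have [_ [n _ <-]] := inf_adherent e0 (stayoo_has_inf v); exists n.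
Qed.

Lemma stayooS v : stayoo v <= \sum_i p i * stayoo (B i *m v).
Proof.
apply/ler_addgt0Pr => e e0.
have h (i : I) : exists n, stayp n (B i *m v) < stayoo (B i *m v) + e.
  exact: stayoo_approx.
have [m hm] := choice h.
pose N := (\sum_i m i)%N.
apply: le_trans (stayoo_le N.+1 v) _; apply: le_trans (staypS _ _) _.
rewrite -[e in leRHS]mul1r -p_sum1 mulr_suml -big_split; apply: ler_sum => i _ /=.
rewrite -mulrDr ler_pM2l//; apply: le_trans (ltW (hm i)).
by apply: stayp_le; rewrite /N (bigD1 i)//= leq_addr.
Qed.

(** The probability that the orbit of the line of [v] stays bounded. *)
Definition boundp v := sup [set stayoo (c *: v) | c in [set c : C | c != 0]].

Lemma boundp_has_sup v : has_sup [set stayoo (c *: v) | c in [set c : C | c != 0]].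
Proof.
split; first by exists (stayoo (1 *: v)), 1 => //=; rewrite oner_eq0.
by exists 1 => _ [c _ <-]; apply: le_trans (stayoo_le 0 _) _; exact: stayp_le1.
Qed.

Lemma boundp_ge c v : c != 0 -> stayoo (c *: v) <= boundp v.
Proof. by move=> c0; apply: ub_le_sup; [exact: (boundp_has_sup v).2|exists c]. Qed.

Lemma boundp_approx e v : 0 < e ->
  exists2 c, c != 0 & boundp v - e < stayoo (c *: v).
Proof.
by move=> e0; have [_ [c c0 <-] h] := sup_adherent e0 (boundp_has_sup v); exists c.
Qed.

Lemma boundp_le1 v : boundp v <= 1.
Proof.
apply: ge_sup; first exact: (boundp_has_sup v).1.
by move=> _ [c _ <-]; apply: le_trans (stayoo_le 0 _) _; exact: stayp_le1.
Qed.

Lemma boundpZ c v : c != 0 -> boundp (c *: v) = boundp v.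
Proof.
move=> c0; rewrite /boundp; congr sup; rewrite eqEsubset; split => _ [d d0 <-].
  by exists (d * c); rewrite /= ?scalerA// mulf_neq0.
by exists (d / c); rewrite /= ?scalerA ?divfK// mulf_neq0 ?invr_eq0.
Qed.

(** Subharmonicity along the walk: an orbit that is bounded from the start is
    bounded after one step. *)
Lemma boundpS v : boundp v <= \sum_i p i * boundp (B i *m v).
Proof.
apply: ge_sup; first exact: (boundp_has_sup v).1.
move=> _ [c c0 <-]; apply: le_trans (stayooS _) _.
by apply: ler_sum => i _; rewrite ler_pM2l// -scalemxAr boundp_ge.
Qed.

End Family.
End StayProbability.

(** * The lines with bounded orbits *)

Section InvariantLines.
Context {R : realType} {I : finType} (p : I -> R).
Hypothesis p_gt0 : forall i, 0 < p i.
Hypothesis p_sum1 : \sum_i p i = 1.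
Local Notation C := R[i].
Variables (A : I -> 'M[C]_2) (kappa : R).
Hypothesis A_nd : nondegenerate A.

(** Dividing by the rate [kappa] turns expansion slower than [kappa] into bounded
    orbits. *)
Definition rescale i : 'M[C]_2 := (expR (- kappa))%:C%C *: A i.

Local Notation B := rescale.
Local Notation distinct := (pairwise (fun u v : 'cV[C]_2 => wedge u v != 0)).

Lemma normc_expR (x : R) : normc (expR x)%:C%C = expR x.
Proof. by rewrite normc_real ger0_norm ?expR_ge0. Qed.

Lemma expRC_neq0 (x : R) : (expR x)%:C%C != 0 :> C.
Proof. by rewrite -normc_eq0 normc_expR gt_eqF ?expR_gt0. Qed.

Lemma wprod_rescale w :
  wprod B w = (expR (- ((size w)%:R * kappa)))%:C%C *: wprod A w.
Proof.
elim: w => [|i w IH] /=; first by rewrite mul0r oppr0 expR0 scale1r.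
rewrite IH /rescale -scalemxAl -scalemxAr scalerA -rmorphM /= -expRD.
by congr (((expR _))%:C%C *: _); rewrite -natr1; ring.
Qed.

Lemma boundp_rescale i v : boundp p B (B i *m v) = boundp p B (A i *m v).
Proof. by rewrite /B -scalemxAl boundpZ// expRC_neq0. Qed.

Hypothesis kappa_lt : kappa < lexp p A.

Lemma rescaled_norm_large (K eta : R) : 0 < K -> 0 < eta -> exists n,
  expect p n (fun w => (mnorm (wprod B w) <= K)%R%:R) < eta.
Proof.
move=> K0 eta0.
have [n hn] := lexp_lower_deviation p_gt0 p_sum1 A_nd kappa_lt K0 eta0.
exists n; rewrite (le_lt_trans _ hn)//; apply: (le_expect p_gt0) => w <-.
rewrite ler_nat wprod_rescale mnormZ normc_expR expRN.
by rewrite ler_pdivrMl ?expR_gt0// mulrC.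
Qed.

Lemma count_le1 (T : Type) (P : pred T) (s : seq T) :
  pairwise (fun u v => ~~ (P u && P v)) s -> (count P s <= 1)%N.
Proof.
elim: s => //= u s IH /andP[us /IH h].
case Pu : (P u); last by [].
suff -> : count P s = 0%N by [].
move: us; rewrite Pu; elim: s {IH h} => //= v s IH /andP[/= nv /IH ->].
by rewrite (negbTE nv).
Qed.

Lemma ler_sum_mem (T : eqType) (s : seq T) (f : T -> R) v :
  (forall u, 0 <= f u) -> v \in s -> f v <= \sum_(u <- s) f u.
Proof.
move=> f0; elim: s => // u s IH; rewrite inE big_cons => /predU1P[->|/IH h].
  by rewrite lerDl sumr_ge0.
by apply: le_trans h _; rewrite lerDr.
Qed.

(** Two independent vectors cannot both have a bounded orbit when the norm of
    the product is unbounded, so that over independent lines these events are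
    disjoint. *)
Lemma sum_boundp s : distinct s -> \sum_(v <- s) boundp p B v <= 1.
Proof.
move=> ds; rewrite leNgt; apply/negP => s1.
pose eta := (\sum_(v <- s) boundp p B v - 1) / 2 / (size s).+1%:R.
have eta0 : 0 < eta by rewrite !divr_gt0// subr_gt0.
have hc' (v : 'cV[C]_2) : exists c : C, c != 0 /\ boundp p B v - eta < stayoo p B (c *: v).
  by have [c c0 h] := boundp_approx p_gt0 p_sum1 B v eta0; exists c.
have [c hc] := choice hc'.
pose t : seq 'cV[C]_2 := [seq c v *: v | v <- s].
have dt : distinct t.
  rewrite pairwise_map; apply: sub_pairwise ds => u v uv.
  by rewrite /= wedgeZl wedgeZr !mulf_neq0 ?(hc _).1.
pose K := \sum_(u <- t) \sum_(v <- t) 2 * mnorm (invmx (frame u v)) + 1.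
have K0 : 0 < K.
  rewrite ltr_wpDl// sumr_ge0// => u _; rewrite sumr_ge0// => v _.
  by rewrite mulr_ge0// mnorm_ge0.
have [n] := rescaled_norm_large K0 eta0.
rewrite ltNge => /negP; apply.
have st0 : 0 < (size s).+1%:R :> R by [].
rewrite -(ler_pM2l st0).
(* outside the rare event that the norm is at most K, at most one vector of t stays *)
have le1 : \sum_(v <- t) stayp p B n v <=
  1 + (size s)%:R * expect p n (fun w => (mnorm (wprod B w) <= K)%R%:R).
  rewrite -expect_sum -[X in _ <= X + _](expect_cst p_sum1 n) -expectZ -expectD.
  apply: (le_expect p_gt0) => w _.
  have -> : \sum_(v <- t) (stay B w v)%:R = (count (stay B w) t)%:R :> R.
    by elim: (t) => [|v r IH]; rewrite ?big_nil// big_cons IH /= natrD.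
  have [wK|wK] /= := lerP (mnorm (wprod B w)) K.
    rewrite mulr1 -(size_map (fun v => c v *: v) s) -/t.
    by apply: le_trans (_ : (size t)%:R <= _); rewrite ?ler_nat ?count_size// lerDr.
  rewrite mulr0 addr0 -[1]/(1%:R) ler_nat; apply: count_le1.
  apply: (@sub_in_pairwise _ (mem t) _ _ _ t _ dt); last exact/allP.
  move=> u v ut vt uv; apply/negP => /andP[/stay_last su /stay_last sv].
  move: wK; rewrite ltNge => /negP; apply.
  apply: le_trans (mnorm_le_frame _ uv) _.
  apply: le_trans (_ : 2 * mnorm (invmx (frame u v)) <= _).
    by rewrite ler_wpM2r ?mnorm_ge0//; lra.
  rewrite /K; apply: ler_wpDr => //.
  pose f x : R := \sum_(y <- t) 2 * mnorm (invmx (frame x y)).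
  have hf : f u <= \sum_(x <- t) f x.
    have f0 x : 0 <= f x.
      by apply: sumr_ge0 => y _; rewrite mulr_ge0// mnorm_ge0.
    exact: ler_sum_mem f0 ut.
  apply: le_trans hf.
  apply: (@ler_sum_mem _ t (fun y => 2 * mnorm (invmx (frame u y)))) => // y.
  by rewrite mulr_ge0// mnorm_ge0.
have lb : \sum_(v <- s) (boundp p B v - eta) <= \sum_(v <- t) stayp p B n v.
  rewrite big_map; apply: ler_sum => v _.
  by apply: le_trans (ltW (hc v).2) _; exact: stayoo_le.
have sE : \sum_(v <- s) (boundp p B v - eta) =
    \sum_(v <- s) boundp p B v - (size s)%:R * eta.
  rewrite big_split /=; congr (_ + _).
  by rewrite big_const_seq count_predT iter_addr_0 mulNrn mulr_natl.
rewrite sE in lb.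
have etaE : \sum_(v <- s) boundp p B v - 1 = 2 * ((size s).+1%:R * eta).
  by rewrite /eta; field; rewrite gt_eqF.
set E := expect p n _ in le1 *.
have E0 : 0 <= E by apply: (expect_ge0 p_gt0 p_sum1).
have := le_trans lb le1; rewrite -natr1 in etaE *; nra.
Qed.

(** The lines of maximal probability of a bounded orbit are finite in number
    and are permuted by the family, by harmonicity. *)
Lemma maximal_bounded_lines v0 : v0 != 0 -> 0 < boundp p B v0 ->
  exists s, [/\ s != [::], distinct s,
    (forall u, u \in s -> u != 0 /\ 0 < boundp p B u) &
    forall u i, u \in s -> exists2 u', u' \in s & exists2 c, c != 0 & A i *m u = c *: u'].
Proof.
move=> v00 b0.
pose Q := [set boundp p B v | v in [set v | v != 0]].
have Qsup : has_sup Q.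
  split; first by exists (boundp p B v0), v0.
  by exists 1 => _ [v _ <-]; exact: boundp_le1.
pose M := sup Q.
have leM v : v != 0 -> boundp p B v <= M.
  by move=> v1; apply: ub_le_sup; [exact: Qsup.2|exists v].
have M0 : 0 < M by apply: lt_le_trans b0 (leM _ v00).
pose big s := distinct s /\ forall u, u \in s -> u != 0 /\ M / 2 < boundp p B u.
have bigE s : big s -> (size s <= Num.truncn (2 / M))%N.
  move=> [ds hs]; rewrite truncn_ge_nat ?divr_ge0//; last exact: ltW.
  have := sum_boundp ds.
  have h : \sum_(v <- s) M / 2 <= \sum_(v <- s) boundp p B v.
    by rewrite !big_seq; apply: ler_sum => u /hs[_ /ltW].
  move=> /(le_trans h).
  rewrite big_const_seq count_predT iter_addr_0 -(mulr_natl (M / 2)) => h2.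
  by rewrite ler_pdivlMr//; lra.
(* a maximal set of lines with probability above half the supremum exhausts them *)
have [s [[ds hs] smax]] : exists s, big s /\ forall t, big t -> (size t <= size s)%N.
  pose P n := `[< exists2 s, big s & size s = n >].
  have P0 : exists n, P n by exists 0%N; apply/asboolP; exists [::].
  have Pb n : P n -> (n <= Num.truncn (2 / M))%N.
    by move=> /asboolP[s /bigE + <-].
  case: (ex_maxnP P0 Pb) => n /asboolP[s bs sn] hn; exists s; split=> // t bt.
  by rewrite sn hn//; apply/asboolP; exists t.
have absorb v : v != 0 -> M / 2 < boundp p B v -> exists2 u, u \in s &
    exists2 c, c != 0 & v = c *: u.
  move=> v1 hv; apply: contrapT => nu.
  have : big (v :: s).
    split=> /=; last by move=> u; rewrite inE => /predU1P[->|/hs].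
    rewrite ds andbT; apply/allP => u us.
    apply/negP => /eqP vu; apply: nu; exists u => //.
    have u0 := (hs u us).1; apply: wedge0 => //.
    by rewrite wedgeC vu oppr0.
  by move=> /smax /=; rewrite ltnn.
(* among these finitely many lines the supremum M is attained *)
pose F := [seq u <- s | boundp p B u == M].
have toF v : v != 0 -> boundp p B v = M -> exists2 u, u \in F &
    exists2 c, c != 0 & v = c *: u.
  move=> v1 vM; have [|u us [c c0 vE]] := absorb v v1.
    by rewrite vM ltr_pdivrMr// ltr_pMr// ltr1n.
  exists u; last by exists c.
  by rewrite mem_filter us andbT -vM vE boundpZ.
have [u0 u0s u0M] : exists2 u, u \in s & boundp p B u = M.
  have hmax (t : seq 'cV[C]_2) : {subset t <= s} -> t != [::] -> exists2 u, u \in t &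
      forall v, v \in t -> boundp p B v <= boundp p B u.
    elim: t => // u t IH ts _; case: (eqVneq t [::]) => [->|t0].
      by exists u; rewrite ?mem_head// => v; rewrite inE => /eqP ->.
    have [|x xt hx] := IH _ t0; first by move=> y yt; rewrite ts// inE yt orbT.
    have [ux|xu] := lerP (boundp p B u) (boundp p B x).
      by exists x; rewrite ?inE ?xt ?orbT// => y; rewrite inE => /predU1P[->|/hx].
    exists u; rewrite ?mem_head// => y; rewrite inE => /predU1P[->//|/hx].
    by move=> h; apply: le_trans h (ltW xu).
  have M2 : 0 < M / 2 by rewrite divr_gt0.
  have near_sup e : 0 < e -> e <= M / 2 -> exists2 u, u \in s & M - e < boundp p B u.
    move=> e0 eM; have [_ [v v1 <-] hv] := sup_adherent e0 Qsup.
    have [|u us [c c0 vE]] := absorb v v1.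
      by apply: le_lt_trans hv; rewrite -/M; lra.
    by exists u => //; rewrite vE boundpZ in hv.
  have s0 : s != [::] by have [u + _] := near_sup _ M2 (lexx _); case: (s).
  have [//|u us hu] := hmax s _ s0; exists u => //.
  apply/eqP; rewrite eq_le leM ?(hs _ us).1//=; apply/ler_addgt0Pr => e e0.
  have e'0 : 0 < Num.min e (M / 2) by rewrite lt_min e0.
  have [|x xs hx] := near_sup _ e'0; first by rewrite ge_min lexx orbT.
  have := hu x xs; have : Num.min e (M / 2) <= e by rewrite ge_min lexx.
  lra.
exists F; split.
- apply/eqP => F0; have : u0 \in F by rewrite mem_filter u0M eqxx.
  by rewrite F0.
- by apply: subseq_pairwise ds; exact: filter_subseq.
- by move=> u; rewrite mem_filter => /andP[/eqP -> /hs[]].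
move=> u i; rewrite mem_filter => /andP[/eqP uM us].
have u1 := (hs _ us).1.
have Au j : A j *m u != 0 by apply: mulmx_neq0.
(* M is at most an average of values that are at most M, so all of them equal M *)
apply: toF => //; apply/eqP; rewrite eq_le leM//=.
have := boundpS p_gt0 p_sum1 B u.
rewrite (eq_bigr (fun i => p i * boundp p B (A i *m u))); last first.
  by move=> j _; rewrite boundp_rescale.
rewrite uM (bigD1 i)//= => h.
have : \sum_(j | j != i) p j * boundp p B (A j *m u) <= \sum_(j | j != i) p j * M.
  by apply: ler_sum => j _; rewrite ler_pM2l// leM.
move=> /(lerD (lexx (p i * boundp p B (A i *m u)))) /(le_trans h).
rewrite -mulr_suml.
have : \sum_(j | j != i) p j = 1 - p i.
  by rewrite -p_sum1 [in RHS](bigD1 i)//= [RHS]addrAC subrr add0r.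
by move=> -> h'; rewrite -(ler_pM2l (p_gt0 i)); lra.
Qed.

End InvariantLines.

(** * Expansion on permuted lines *)

Section LineConfigurations.
Context {R : realType} {I : finType} (p : I -> R).
Hypothesis p_gt0 : forall i, 0 < p i.
Hypothesis p_sum1 : \sum_i p i = 1.
Local Notation C := R[i].
Variable (A : I -> 'M[C]_2).
Hypothesis A_nd : nondegenerate A.

Definition lnc (x : C) : R := ln (normc x).

Lemma lncM x y : x != 0 -> y != 0 -> lnc (x * y) = lnc x + lnc y.
Proof. by move=> x0 y0; rewrite /lnc normcM lnM ?posrE ?normc_gt0. Qed.

Lemma eigen_neq0 i (u v : 'cV[C]_2) c : u != 0 -> A i *m u = c *: v -> c != 0.
Proof.
move=> u0 e; apply: contra (mulmx_neq0 (A_nd i) u0) => /eqP c0.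
by rewrite e c0 scale0r.
Qed.

Lemma wprod_eigen (u : 'cV[C]_2) (a : I -> C) w : (forall i, A i *m u = a i *: u) ->
  wprod A w *m u = (\prod_(i <- w) a i) *: u.
Proof.
move=> Au; elim: w => [|i w IH]; first by rewrite mul1mx big_nil scale1r.
by rewrite /= -mulmxA Au -scalemxAr IH scalerA big_cons.
Qed.

Lemma lnc_prod (a : I -> C) w : (forall i, a i != 0) ->
  \prod_(i <- w) a i != 0 /\ lnc (\prod_(i <- w) a i) = \sum_(i <- w) lnc (a i).
Proof.
move=> a0; elim: w => [|i w [IH0 IH]].
  by rewrite !big_nil oner_neq0 /lnc normc1 ln1.
by rewrite !big_cons mulf_neq0// lncM// IH.
Qed.

(** On an invariant line the logarithm of the expansion is a sum of independent
    variables: if it stays below [n * kappa] with positive probability, its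
    drift is at most [kappa]. *)
Lemma drift_le_of_bounded (kappa : R) (u : 'cV[C]_2) (a : I -> C) : u != 0 ->
  (forall i, A i *m u = a i *: u) ->
  0 < boundp p (rescale A kappa) u -> mean p (fun i => lnc (a i)) <= kappa.
Proof.
move=> u0 Au b0; set x := fun i => lnc (a i).
have a0 i : a i != 0 := eigen_neq0 u0 (Au i).
rewrite leNgt; apply/negP => km.
have b20 : 0 < boundp p (rescale A kappa) u / 2 by rewrite divr_gt0.
have [c c0 hc] := boundp_approx p_gt0 p_sum1 (rescale A kappa) u b20.
set eta := boundp p _ u in b0 b20 hc.
pose d := mean p x - kappa; have d0 : 0 < d by rewrite subr_gt0.
pose e := eta * d / 8; have e0 : 0 < e by rewrite divr_gt0// mulr_gt0.
have [n0 hn0] := letters_deviation p_gt0 p_sum1 x e0.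
pose D := - ln (vnorm (c *: u)).
pose n := maxn n0 (Num.truncn (2 * D / d)).+1.
have nR0 : 0 < n%:R :> R by rewrite ltr0n leq_max orbT.
have nD : D < n%:R * d / 2.
  rewrite ltr_pdivlMr// mulrC -ltr_pdivrMr//.
  by apply: lt_le_trans (truncnS_gt _) _; rewrite ler_nat leq_maxr.
have := hn0 n (leq_maxl _ _); set E := expect p n _ => hE.
have nd0 : 0 < n%:R * d / 2 by rewrite divr_gt0// mulr_gt0.
have : stayp p (rescale A kappa) n (c *: u) <= E / (n%:R * d / 2).
  apply: le_trans (markov_expect p_gt0 nd0 _) => //.
  apply: (le_expect p_gt0) => w sw; rewrite ler_nat.
  case st : stay => //; case: lerP => //; rewrite ltNge => /negP[].
  have cu0 : 0 < vnorm (c *: u) by rewrite vnormZ mulr_gt0 ?normc_gt0 ?vnorm_gt0.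
  have [pr0 prE] := lnc_prod w a0.
  have := stay_last st; rewrite wprod_rescale -scalemxAl -scalemxAr (wprod_eigen _ Au).
  rewrite scalerA mulrC -scalerA !vnormZ normc_expR mulrA -mulrA -vnormZ => h1.
  have : ln (expR (- ((size w)%:R * kappa)) *
      (normc (\prod_(i <- w) a i) * vnorm (c *: u))) <= 0.
    by apply: ln_le0; move: h1; rewrite !vnormZ; congr (_ <= _); ring.
  rewrite lnM ?posrE ?expR_gt0 ?mulr_gt0 ?normc_gt0// expRK.
  rewrite lnM ?posrE ?normc_gt0// -/(lnc _) prE sw -/x => h2.
  have := ler_norm (- (\sum_(i <- w) x i - n%:R * mean p x)); rewrite normrN.
  move: nD h2; rewrite /D /d; lra.
have h3 : E / (n%:R * d / 2) <= eta / 4.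
  rewrite ler_pdivrMr//; apply: le_trans hE _; rewrite /e; lra.
move=> /le_trans/(_ h3) h4.
have := stayoo_le p_gt0 p_sum1 (rescale A kappa) n (c *: u).
move: hc h4; lra.
Qed.

(** Products that are conformal up to a constant factor have equal exponents in
    all directions. *)
Lemma lexp_le_ldet (K : R) : 0 < K ->
  (forall w, mnorm (wprod A w) ^+ 2 <= K * normc (\det (wprod A w))) ->
  lexp p A <= ldet p A / 2.
Proof.
move=> K0 h; rewrite leNgt; apply/negP => g.
have hn n : (0 < n)%N -> n%:R * lexp p A <= ln K / 2 + n%:R * (ldet p A / 2).
  move=> n0; apply: le_trans (lexp_le p_gt0 p_sum1 A_nd n0) _.
  rewrite mulrA [X in _ + X]mulrC -(expect_letters p_sum1) -expectZ.
  rewrite -[X in X + _](expect_cst p_sum1 n) -expectD.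
  apply: (le_expect p_gt0) => w _; rewrite -ln_det_wprod//.
  have m0 := mnorm_wprod_gt0 A_nd w.
  have d0 : 0 < normc (\det (wprod A w)) by rewrite normc_gt0 det_wprod_neq0.
  have : ln (mnorm (wprod A w) ^+ 2) <= ln (K * normc (\det (wprod A w))).
    by rewrite ler_ln ?posrE ?exprn_gt0 ?mulr_gt0.
  rewrite lnXn// lnM ?posrE// -mulr_natl; lra.
pose g' := lexp p A - ldet p A / 2; have g0 : 0 < g' by rewrite subr_gt0.
pose n := (Num.truncn (ln K / 2 / g')).+1.
have : ln K / 2 < n%:R * g' by rewrite -ltr_pdivrMr// truncnS_gt.
by have := hn n isT; rewrite /g'; lra.
Qed.

Lemma wedge_scale (M : 'M[C]_2) (u v u' v' : 'cV[C]_2) (c d : C) : M *m u = c *: u' -> M *m v = d *: v' ->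
  normc c * normc d * normc (wedge u' v') = normc (\det M) * normc (wedge u v).
Proof.
move=> hu hv; rewrite -!normcM -wedgeM hu hv wedgeZl wedgeZr.
by rewrite mulrA.
Qed.

(** The expansions [c], [d] on two permuted lines satisfy [|c||d|] comparable to
    the modulus of the determinant. With a third line this holds for three pairs,
    which forces each expansion to be comparable to the square root of the
    determinant: the products are nearly conformal. *)
Lemma three_lines (s : seq 'cV[C]_2) (u v w : 'cV[C]_2) :
  pairwise (fun u v : 'cV[C]_2 => wedge u v != 0) s ->
  [:: u; v; w] = take 3 s ->
  (forall u i, u \in s -> exists2 u', u' \in s & exists2 c, c != 0 & A i *m u = c *: u') ->
  lexp p A <= ldet p A / 2.
Proof.
move=> ds s3 inv.
have uvw x : x \in [:: u; v; w] -> x \in s by rewrite s3; exact: mem_take.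
have [/and3P[] uv uw _ vw] : ([&& wedge u v != 0, wedge u w != 0 & true] * (wedge v w != 0))%type.
  have : pairwise (fun u v : 'cV[C]_2 => wedge u v != 0) [:: u; v; w].
    by rewrite s3; apply: subseq_pairwise ds; exact: take_subseq.
  by rewrite /= !andbT => /andP[/andP[-> ->] ->].
have path_inv x r : x \in s -> exists2 x', x' \in s & exists2 c, c != 0 &
    wprod A r *m x = c *: x'.
  elim: r x => [|i r IH] x xs.
    by exists x => //; exists 1; rewrite ?oner_neq0// mul1mx scale1r.
  have [y ys [c c0 hc]] := inv x i xs.
  have [z zs [d d0 hd]] := IH y ys.
  exists z => //; exists (c * d); first by rewrite mulf_neq0.
  by rewrite /= -mulmxA hc -scalemxAr hd scalerA.
(* the wedges of distinct lines of s lie between 1/W and W *)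
pose W : R := \sum_(x <- s) \sum_(y <- s) (normc (wedge x y) + (normc (wedge x y))^-1).
have t0 (x y : 'cV[C]_2) : 0 <= normc (wedge x y) + (normc (wedge x y))^-1.
  by rewrite addr_ge0// ?invr_ge0 normc_ge0.
have leW x y : x \in s -> y \in s -> normc (wedge x y) + (normc (wedge x y))^-1 <= W.
  move=> xs ys.
  have h0 z : 0 <= \sum_(y <- s) (normc (wedge z y) + (normc (wedge z y))^-1).
    exact: sumr_ge0.
  apply: le_trans (ler_sum_mem h0 xs).
  exact: (ler_sum_mem (t0 x) ys).
have bnd x y : x \in s -> y \in s -> wedge x y != 0 ->
    normc (wedge x y) <= W /\ 1 <= W * normc (wedge x y).
  move=> xs ys xy; have := leW x y xs ys; have n0 : 0 < normc (wedge x y) by rewrite normc_gt0.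
  move=> h; split; first by apply: le_trans h; rewrite lerDl invr_ge0 ltW.
  rewrite -ler_pdivrMr// mul1r; apply: le_trans h.
  by rewrite lerDr ltW.
have W0 : 0 < W.
  have [|||h _] := bnd u v; rewrite ?uvw ?inE ?eqxx ?orbT//.
  by apply: lt_le_trans h; rewrite normc_gt0.
have pair r x y x' y' c d : x \in s -> y \in s -> wedge x y != 0 -> x' \in s -> y' \in s ->
    wprod A r *m x = c *: x' -> wprod A r *m y = d *: y' ->
    normc c * normc d <= W ^+ 2 * normc (\det (wprod A r)) /\
    normc (\det (wprod A r)) <= W ^+ 2 * (normc c * normc d).
  move=> xs ys xy xs' ys' hx hy.
  have e := wedge_scale hx hy.
  have dr0 : normc (\det (wprod A r)) != 0 by rewrite normc_eq0 det_wprod_neq0.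
  have xy' : wedge x' y' != 0.
    rewrite -normc_eq0; apply/eqP => h; move: e; rewrite h mulr0 => /esym/eqP.
    by rewrite mulf_eq0 (negbTE dr0) normc_eq0 (negbTE xy).
  have [b1 b2] := bnd _ _ xs ys xy; have [b3 b4] := bnd _ _ xs' ys' xy'.
  have c0 := normc_ge0 c; have d0 := normc_ge0 d; have dd0 := normc_ge0 (\det (wprod A r)).
  have cd0 := mulr_ge0 c0 d0.
  move: e b1 b2 b3 b4 cd0 dd0; set P := normc c * normc d; set Q := normc (\det _).
  set s1 := normc (wedge x y); set s2 := normc (wedge x' y') => e b1 b2 b3 b4 P0 Q0.
  split.
    apply: le_trans (_ : W * (P * s2) <= _).
      by rewrite mulrCA ler_peMr.
    by rewrite e expr2 -!mulrA ler_pM2l// mulrC ler_wpM2r.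
  apply: le_trans (_ : W * (Q * s1) <= _).
    by rewrite mulrCA ler_peMr.
  by rewrite -e expr2 -!mulrA ler_pM2l// mulrA mulrC ler_wpM2r.
have [W1] : exists W1 : R, forall x, x \in s -> vnorm x <= W1.
  by exists (\sum_(x <- s) vnorm x) => x xs; apply: ler_sum_mem => // ?; exact: vnorm_ge0.
move=> hW1.
have W10 : 0 <= W1 by apply: le_trans (hW1 u _); rewrite ?vnorm_ge0// uvw ?inE ?eqxx.
pose K1 := mnorm (invmx (frame u v)).
have K10 : 0 <= K1 := mnorm_ge0 _.
apply: (@lexp_le_ldet ((2 * W1 * K1) ^+ 2 * W ^+ 6 + 1)).
  by rewrite ltr_wpDl// mulr_ge0 ?sqr_ge0// exprn_ge0// ltW.
move=> r.
have us : u \in s by rewrite uvw ?inE ?eqxx.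
have vs : v \in s by rewrite uvw ?inE ?eqxx ?orbT.
have ws : w \in s by rewrite uvw ?inE ?eqxx ?orbT.
have [u' us' [c c0 hu]] := path_inv u r us.
have [v' vs' [d d0 hv]] := path_inv v r vs.
have [w' ws' [e e0 hw]] := path_inv w r ws.
have [uv1 uv2] := pair r _ _ _ _ _ _ us vs uv us' vs' hu hv.
have [uw1 uw2] := pair r _ _ _ _ _ _ us ws uw us' ws' hu hw.
have [vw1 vw2] := pair r _ _ _ _ _ _ vs ws vw vs' ws' hv hw.
have dr0 : 0 < normc (\det (wprod A r)) by rewrite normc_gt0 det_wprod_neq0.
(* x^2 = (xy)(xz)/(yz) *)
have sq (x y z D : R) : 0 < x -> 0 < y -> 0 < z -> 0 < D ->
    x * y <= W ^+ 2 * D -> x * z <= W ^+ 2 * D -> D <= W ^+ 2 * (y * z) ->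
    x ^+ 2 <= W ^+ 6 * D.
  move=> x0 y0 z0 D0 h1 h2 h3.
  have W20 : 0 < W ^+ 2 by rewrite exprn_gt0.
  have h4 : (x * y) * (x * z) <= (W ^+ 2 * D) * (W ^+ 2 * D).
    by apply: ler_pM => //; rewrite mulr_ge0// ltW.
  have h5 : x ^+ 2 * D <= x ^+ 2 * (W ^+ 2 * (y * z)) by rewrite ler_pM2l ?exprn_gt0.
  have h6 : W ^+ 2 * ((x * y) * (x * z)) <= W ^+ 2 * ((W ^+ 2 * D) * (W ^+ 2 * D)).
    by rewrite ler_pM2l.
  rewrite -(ler_pM2r D0).
  have -> : W ^+ 6 * D * D = W ^+ 2 * ((W ^+ 2 * D) * (W ^+ 2 * D)) by ring.
  by apply: le_trans h6; apply: le_trans h5 _; rewrite le_eqVlt; apply/orP; left; apply/eqP; ring.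
have n0 (x : C) : x != 0 -> 0 < normc x by rewrite normc_gt0.
have cc := sq _ _ _ _ (n0 _ c0) (n0 _ d0) (n0 _ e0) dr0 uv1 uw1 vw2.
have dc : normc d * normc c <= W ^+ 2 * normc (\det (wprod A r)) by rewrite mulrC.
have dd := sq _ _ _ _ (n0 _ d0) (n0 _ c0) (n0 _ e0) dr0 dc vw1 uw2.
have := mnorm_le_frame (wprod A r) uv; rewrite hu hv !vnormZ -/K1.
set D := normc (\det _) in dr0 cc dd *.
have W6 : 0 <= W ^+ 6 * D by rewrite mulr_ge0 ?exprn_ge0// ltW.
pose S := Num.sqrt (W ^+ 6 * D).
have cS : normc c <= S by rewrite -(ger0_norm (normc_ge0 c)) -sqrtr_sqr ler_wsqrtr.
have dS : normc d <= S by rewrite -(ger0_norm (normc_ge0 d)) -sqrtr_sqr ler_wsqrtr.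
have h1 : normc c * vnorm u' <= S * W1.
  by apply: ler_pM; rewrite ?normc_ge0 ?vnorm_ge0 ?hW1.
have h2 : normc d * vnorm v' <= S * W1.
  by apply: ler_pM; rewrite ?normc_ge0 ?vnorm_ge0 ?hW1.
have h3 : (normc c * vnorm u' + normc d * vnorm v') * K1 <= (2 * (S * W1)) * K1.
  by rewrite ler_wpM2r//; lra.
move=> /le_trans/(_ h3) h4.
have : mnorm (wprod A r) ^+ 2 <= (2 * (S * W1) * K1) ^+ 2.
  by rewrite ler_pXn2r// nnegrE ?mnorm_ge0// !mulr_ge0// sqrtr_ge0.
have -> : (2 * (S * W1) * K1) ^+ 2 = (2 * W1 * K1) ^+ 2 * S ^+ 2 by ring.
rewrite sqr_sqrtr// => h5; apply: le_trans h5 _.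
by have := ltW dr0; lra.
Qed.

End LineConfigurations.

(** * Swapped lines and slow lines *)

Section SwappedLines.
Context {R : realType} {I : finType} (p : I -> R).
Hypothesis p_gt0 : forall i, 0 < p i.
Hypothesis p_sum1 : \sum_i p i = 1.
Local Notation C := R[i].

Section Cocycle.
Variables (x : I -> R) (sg : I -> bool).
Hypothesis swap : exists i, sg i.

(** The difference of the logarithmic expansions of two lines along a word: a
    letter that swaps them reverses the sign of what follows. *)
Fixpoint swapped_sum (w : seq I) : R :=
  if w is i :: v then x i + (-1) ^+ sg i * swapped_sum v else 0.

Let tau := mean p (fun i => (-1) ^+ sg i).

Lemma mean_sign_bound : -1 <= tau < 1.
Proof.
have [j sj] := swap.
have lo : -1 <= tau.
  rewrite -(mean_cst p_sum1 (-1)); apply: ler_mean => // i.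
  by case: (sg i); rewrite ?expr1 ?expr0//; lra.
rewrite lo /=; rewrite -p_sum1 /tau /mean (bigD1 j)//= [ltRHS](bigD1 j)//=.
rewrite sj expr1 mulrN1; have pj := p_gt0 j.
have : \sum_(i | i != j) p i * (-1) ^+ sg i <= \sum_(i | i != j) p i.
  by apply: ler_sum => i _; have := p_gt0 i; case: (sg i); rewrite ?expr1 ?expr0; lra.
lra.
Qed.

Lemma expect_swapped_sum n : (1 - tau) * expect p n swapped_sum = mean p x * (1 - tau ^+ n).
Proof.
elim: n => [|n IH]; first by rewrite expr0 subrr !mulr0.
have -> : expect p n.+1 swapped_sum = mean p x + tau * expect p n swapped_sum.
  rewrite /= /tau /mean mulr_suml -big_split; apply: eq_bigr => i _ /=.
  rewrite -mulrA -mulrDr; congr (_ * _).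
  by rewrite -expectZ -[x i in RHS](expect_cst p_sum1 n) -expectD.
by rewrite mulrDr mulrCA IH exprS; ring.
Qed.

(** The sign changes have mean [tau < 1], so the mean of the sum stays bounded and
    its second moment grows linearly. *)
Lemma variance_swapped_sum : exists2 K, 0 <= K &
  forall n, expect p n (fun w => swapped_sum w ^+ 2) <= n%:R * K.
Proof.
have /andP[t1 t2] := mean_sign_bound.
have tau0 : 0 < 1 - tau by rewrite subr_gt0.
pose M := 2 * `|mean p x| / (1 - tau).
have hM n : `|expect p n swapped_sum| <= M.
  rewrite /M ler_pdivlMr// -{1}(gtr0_norm tau0) -normrM mulrC expect_swapped_sum normrM.
  rewrite mulrC ler_wpM2r// (le_trans (ler_normB _ _))// normr1.
  have : `|tau ^+ n| <= 1 by rewrite normrX exprn_ile1// ler_norml t1 ltW.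
  lra.
have M0 : 0 <= M := le_trans (normr_ge0 _) (hM 0%N).
pose c := mean p (fun i => x i * (-1) ^+ sg i).
pose K := mean p (fun i => x i ^+ 2) + 2 * `|c| * M.
have K0 : 0 <= K.
  rewrite addr_ge0//; last by apply: mulr_ge0 M0; apply: mulr_ge0.
  by apply: sumr_ge0 => i _; rewrite mulr_ge0 ?sqr_ge0// ltW.
exists K => //; elim=> [|n IH]; first by rewrite /= expr0n mul0r.
have -> : expect p n.+1 (fun w => swapped_sum w ^+ 2) =
    mean p (fun i => x i ^+ 2) + 2 * c * expect p n swapped_sum +
    expect p n (fun w => swapped_sum w ^+ 2).
  set m := expect p n swapped_sum; set V := expect p n _.
  rewrite -[V in RHS](mean_cst p_sum1) [2 * c * m]mulrAC /c -meanZ -!meanD.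
  apply: eq_bigr => i _; congr (_ * _).
  rewrite -[x i ^+ 2](expect_cst p_sum1 n) /V /m.
  rewrite [2 * _ * _]mulrAC -!expectZ -!expectD.
  apply: eq_expect => w _ /=.
  by case: (sg i); rewrite ?expr1 ?expr0; ring.
have -> : n.+1%:R * K = K + n%:R * K by rewrite -(natr1 n); ring.
apply: lerD IH; rewrite lerD2l -!mulrA ler_pM2l//.
apply: le_trans (ler_norm _) _; by rewrite normrM; apply: ler_pM => //; rewrite normr_ge0.
Qed.

End Cocycle.

Variable (A : I -> 'M[C]_2).
Hypothesis A_nd : nondegenerate A.

(** When some element swaps two permuted lines, the difference of the two
    logarithmic expansions keeps changing sign, so it grows diffusively. *)
Lemma swapped_lines (u v : 'cV[C]_2) (sg : I -> bool) (a b : I -> C) :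
  wedge u v != 0 -> (exists i, sg i) ->
  (forall i, A i *m u = a i *: (if sg i then v else u)) ->
  (forall i, A i *m v = b i *: (if sg i then u else v)) ->
  lexp p A <= ldet p A / 2.
Proof.
move=> uv sw Au Av; have [u0 v0] := wedge_neq0 uv.
have a0 i : a i != 0 := eigen_neq0 A_nd u0 (Au i).
have b0 i : b i != 0 := eigen_neq0 A_nd v0 (Av i).
pose x i := lnc (a i) - lnc (b i).
pose D := swapped_sum x sg.
have word w : exists al be tau, [/\ al != 0, be != 0,
    wprod A w *m u = al *: (if tau then v else u),
    wprod A w *m v = be *: (if tau then u else v) & lnc al - lnc be = D w].
  elim: w => [|i w [al [be [tau [al0 be0 hu hv hD]]]]].
    by exists 1, 1, false; rewrite !mul1mx !scale1r !oner_neq0 subrr.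
  rewrite /= /D /= -!mulmxA Au Av; case: (sg i).
    exists (a i * be), (b i * al), (~~ tau); split; rewrite ?mulf_neq0//.
    - by rewrite -scalemxAr hv scalerA; case: (tau).
    - by rewrite -scalemxAr hu scalerA; case: (tau).
    - by rewrite !lncM// expr1 -/D -hD /x; ring.
  exists (a i * al), (b i * be), tau; split; rewrite ?mulf_neq0//.
  - by rewrite -scalemxAr hu scalerA.
  - by rewrite -scalemxAr hv scalerA.
  - by rewrite !lncM// expr0 -/D -hD /x; ring.
pose K1 := 2 * (vnorm u + vnorm v) * mnorm (invmx (frame u v)).
have K10 : 0 < K1.
  apply: mulr_gt0; first by rewrite mulr_gt0// addr_gt0 ?vnorm_gt0.
  by rewrite mnorm_gt0_det// det_inv invr_eq0 det_frame.
have lnb w : ln (mnorm (wprod A w)) <=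
    ln K1 + 2^-1 * ln (normc (\det (wprod A w))) + 2^-1 * `|D w|.
  have [al [be [tau [al0 be0 hu hv hD]]]] := word w.
  have dE : ln (normc (\det (wprod A w))) = lnc al + lnc be.
    have := wedge_scale hu hv.
    have -> : normc (wedge (if tau then v else u) (if tau then u else v)) = normc (wedge u v).
      by case: (tau) => //; rewrite wedgeC normcN.
    by move/mulIf => <-; rewrite ?normc_eq0// lnM ?posrE ?normc_gt0.
  have m0 := mnorm_wprod_gt0 A_nd w.
  have [m mE] : exists m, m = Num.max (normc al) (normc be) by eexists.
  have m_gt0 : 0 < m by rewrite mE lt_max normc_gt0 al0.
  have hm : mnorm (wprod A w) <= K1 * m.
    apply: le_trans (mnorm_le_frame _ uv) _; rewrite hu hv !vnormZ /K1 mulrAC.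
    rewrite ler_wpM2r ?mnorm_ge0//.
    have ale : normc al <= m by rewrite mE le_max lexx.
    have ble : normc be <= m by rewrite mE le_max lexx orbT.
    have := vnorm_ge0 u; have := vnorm_ge0 v; have := normc_ge0 al; have := normc_ge0 be.
    by case: (tau); nra.
  have lnm : ln m = 2^-1 * (lnc al + lnc be) + 2^-1 * `|lnc al - lnc be|.
    rewrite mE; have [h|h] := lerP (normc al) (normc be).
      have : lnc al <= lnc be by rewrite ler_ln ?posrE ?normc_gt0.
      by move=> h2; rewrite ler0_norm ?subr_le0// -/(lnc _); lra.
    have : lnc be <= lnc al by rewrite ler_ln ?posrE ?normc_gt0// ltW.
    by move=> h2; rewrite ger0_norm ?subr_ge0// -/(lnc _); lra.
  have : ln (mnorm (wprod A w)) <= ln (K1 * m) by rewrite ler_ln ?posrE// mulr_gt0.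
  by rewrite lnM ?posrE// lnm -hD dE; lra.
have [K K0 hK] := variance_swapped_sum x sw.
rewrite leNgt; apply/negP => g.
pose g' := lexp p A - ldet p A / 2; have g0 : 0 < g' by rewrite subr_gt0.
(* |D| <= D^2/(2c) + c/2, with c such that the second moment contributes n g'/4 at most *)
have [c cE] : exists c, c = (K + 1) / g' by eexists.
have c0 : 0 < c by rewrite cE divr_gt0// ltr_wpDl.
have hn n : (0 < n)%N -> n%:R * (g' / 2) <= ln K1 + c / 4.
  move=> n0; have := lexp_le p_gt0 p_sum1 A_nd n0.
  have : growth p A n <= ln K1 + n%:R * (ldet p A / 2) + (n%:R * K / (4 * c) + c / 4).
    apply: le_trans (_ : expect p n (fun w => (ln K1 + c / 4) +
      (2^-1 * \sum_(i <- w) ln (normc (\det (A i))) + (4 * c)^-1 * D w ^+ 2)) <= _).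
      apply: (le_expect p_gt0) => w _; apply: le_trans (lnb w) _.
      rewrite -ln_det_wprod//.
      have : `|D w| <= (2 * c)^-1 * D w ^+ 2 + c / 2.
        have -> : (2 * c)^-1 * D w ^+ 2 + c / 2 = (D w ^+ 2 + c ^+ 2) / (2 * c).
          by field; rewrite gt_eqF.
        have -> : D w ^+ 2 = `|D w| ^+ 2 by rewrite real_normK ?num_real.
        rewrite ler_pdivlMr ?mulr_gt0//.
        have : 0 <= (`|D w| - c) ^+ 2 by rewrite sqr_ge0.
        by nra.
      have -> : (4 * c)^-1 * D w ^+ 2 = 2^-1 * ((2 * c)^-1 * D w ^+ 2).
        by field; rewrite gt_eqF.
      by lra.
    rewrite expectD (expect_cst p_sum1) expectD expectZ (expect_letters p_sum1) expectZ.
    have : (4 * c)^-1 * expect p n (fun w => D w ^+ 2) <= (4 * c)^-1 * (n%:R * K).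
      by rewrite ler_pM2l ?hK// invr_gt0 mulr_gt0.
    by rewrite -/(ldet p A) [n%:R * K / _]mulrC; lra.
  have : n%:R * K / (4 * c) <= n%:R * (g' / 4).
    rewrite ler_pdivrMr ?mulr_gt0// -mulrA ler_wpM2l//.
    have -> : g' / 4 * (4 * c) = K + 1 by rewrite cE; field; rewrite gt_eqF.
    by rewrite lerDl.
  have : 0 <= n%:R * g' by rewrite mulr_ge0// ltW.
  by rewrite /g'; lra.
pose n := (Num.truncn ((ln K1 + c / 4) / (g' / 2))).+1.
have : ln K1 + c / 4 < n%:R * (g' / 2).
  by rewrite -ltr_pdivrMr ?divr_gt0// truncnS_gt.
by have := hn n isT; lra.
Qed.

Variable kappa : R.
Hypothesis kappa_lt : kappa < lexp p A.
Hypothesis gap : ldet p A / 2 < lexp p A.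

(** Furstenberg-Kifer alternative: a vector that the random products expand too
    slowly with positive probability betrays an invariant line of small drift.
    The lines most likely to have a bounded orbit are permuted; three of them, or
    two that are swapped, would force the exponents to coincide, so one of them
    is invariant. *)
Lemma slow_invariant_line (v0 : 'cV[C]_2) :
  v0 != 0 -> 0 < boundp p (rescale A kappa) v0 ->
  exists (u : 'cV[C]_2) (a : I -> C), [/\ u != 0, forall i, A i *m u = a i *: u &
    mean p (fun i => lnc (a i)) <= kappa].
Proof.
move=> v00 b0.
have [s [s0 ds hs inv]] := maximal_bounded_lines p_gt0 p_sum1 A_nd kappa_lt v00 b0.
have fixed u : u \in s -> (forall i, exists c : C, A i *m u = c *: u) ->
    exists (u : 'cV[C]_2) (a : I -> C), [/\ u != 0, forall i, A i *m u = a i *: u &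
    mean p (fun i => lnc (a i)) <= kappa].
  move=> us /choice[a ha]; exists u, a; have [u0 bu] := hs _ us; split=> //.
  exact: (drift_le_of_bounded p_gt0 p_sum1 A_nd u0 ha bu).
case: s => [//|u [|v [|w s]]] in s0 ds hs inv fixed *.
- apply: (fixed u); rewrite ?mem_head// => i.
  by have [u' + [c _ ->]] := inv u i (mem_head _ _); rewrite inE => /eqP ->; exists c.
- have uv : wedge u v != 0 by move: ds => /= /andP[/andP[]].
  have us : u \in [:: u; v] by rewrite mem_head.
  have vs : v \in [:: u; v] by rewrite !inE eqxx orbT.
  have [u0 v0'] := wedge_neq0 uv.
  have [fx|/existsNP[j nj]] := pselect (forall i, exists c : C, A i *m u = c *: u).
    exact: fixed us fx.
  (* some A j sends u to the line of v, hence every A i fixes or swaps both *)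
  have su i : exists c : C * bool, A i *m u = c.1 *: (if c.2 then v else u).
    have [u' + [c _ ->]] := inv u i us; rewrite !inE => /orP[/eqP ->|/eqP ->].
      by exists (c, false).
    by exists (c, true).
  have [ac hac] := choice su.
  have sv i : exists c, A i *m v = c *: (if (ac i).2 then u else v).
    have [v' + [c c0 hv]] := inv v i vs; rewrite !inE => /orP[/eqP v'u|/eqP v'v].
      rewrite v'u in hv; have := wedgeM (A i) u v; rewrite hac hv.
      case: (ac i).2; first by exists c.
      rewrite wedgeZl wedgeZr /wedge [_ * u 0 0]mulrC subrr !mulr0 => /esym/eqP.
      by rewrite mulf_eq0 (negbTE (A_nd i)) (negbTE uv).
    rewrite v'v in hv; have := wedgeM (A i) u v; rewrite hac hv.
    case: (ac i).2; last by exists c.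
    rewrite wedgeZl wedgeZr /wedge [_ * v 0 0]mulrC subrr !mulr0 => /esym/eqP.
    by rewrite mulf_eq0 (negbTE (A_nd i)) (negbTE uv).
  have [b hb] := choice sv.
  have := @swapped_lines u v (fun i => (ac i).2) (fun i => (ac i).1) b uv _ hac hb.
  rewrite leNgt gap => /(_ _)/wrap[]//; exists j.
  by case E : (ac j).2 => //; case: nj; exists (ac j).1; rewrite hac E.
- have := @three_lines _ _ p p_gt0 p_sum1 A A_nd (u :: v :: w :: s) u v w ds.
  by rewrite /= take0 leNgt gap => /(_ erefl inv).
Qed.

End SwappedLines.

(** * Lower semicontinuity away from slow lines *)

Section LowerSemicontinuity.
Context {R : realType} {I : finType} (p : I -> R).
Hypothesis p_gt0 : forall i, 0 < p i.
Hypothesis p_sum1 : \sum_i p i = 1.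
Local Notation C := R[i].

Lemma near_fin (X : Type) (F : set_system X) {FF : Filter F} (T : finType)
    (P : T -> X -> Prop) :
  (forall t, \forall x \near F, P t x) -> \forall x \near F, forall t, P t x.
Proof.
move=> h.
have : \forall x \near F, forall t, t \in index_enum T -> P t x.
  elim: (index_enum T) => [|t s IH]; first exact: nearW.
  by apply: filterS2 (h t) IH => x hx hs j; rewrite inE => /predU1P[->//|/hs].
by apply: filterS => x hx t; apply: hx; rewrite mem_index_enum.
Qed.

Lemma near_gt (X : Type) (F : set_system X) {FF : Filter F} (h : X -> R) (l z : R) :
  h x @[x --> F] --> l -> z < l -> \forall x \near F, z < h x.
Proof. by move=> hl zl; have /cvgr_gt := hl; apply. Qed.

Lemma near_lt (X : Type) (F : set_system X) {FF : Filter F} (h : X -> R) (l z : R) :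
  h x @[x --> F] --> l -> l < z -> \forall x \near F, h x < z.
Proof. by move=> hl zl; have /cvgr_lt := hl; apply. Qed.

Lemma near_not_stay (X : Type) (F : set_system X) {FF : Filter F}
    (g : X -> I -> 'M[C]_2) (B : I -> 'M[C]_2) (u : X -> 'cV[C]_2) (u0 : 'cV[C]_2) w :
  (forall i, mlim F (g^~ i) (B i)) -> mlim F u u0 ->
  ~~ stay B w u0 -> \forall x \near F, ~~ stay (g x) w (u x).
Proof.
move=> gB; elim: w u u0 => [|i w IH] u u0 uu0.
  rewrite /= andbT -ltNge => h.
  by apply: filterS (near_gt (mlim_vnorm uu0) h) => x; rewrite andbT -ltNge.
rewrite /= negb_and => /orP[|h].
  rewrite -ltNge => h.
  by apply: filterS (near_gt (mlim_vnorm uu0) h) => x; rewrite negb_and -ltNge => ->.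
have : \forall x \near F, ~~ stay (g x) w (g x i *m u x) by
  apply: (IH (fun x => g x i *m u x) (B i *m u0)) => //; exact: mlimM.
by apply: filterS => x; rewrite negb_and => ->; rewrite orbT.
Qed.

(** Leaving the closed unit ball along a given word is an open condition. *)
Lemma stayp_usc (X : Type) (F : set_system X) {FF : ProperFilter F}
    (g : X -> I -> 'M[C]_2) (B : I -> 'M[C]_2) (u : X -> 'cV[C]_2) (u0 : 'cV[C]_2)
    n (d : R) :
  (forall i, mlim F (g^~ i) (B i)) -> mlim F u u0 ->
  (\forall x \near F, d <= stayp p (g x) n (u x)) -> d <= stayp p B n u0.
Proof.
move=> gB uu0 h.
have : \forall x \near F, forall t : n.-tuple I, stay (g x) t (u x) -> stay B t u0.
  apply: near_fin => t; case st : (stay B t u0); first exact: nearW.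
  by apply: filterS (near_not_stay gB uu0 (negbT st)) => x /negbTE ->.
move=> /(filterI h)/filter_ex[x [dx hx]].
apply: le_trans dx _; apply: (le_expect p_gt0) => w sw; rewrite ler_nat.
have := hx (Tuple (introT eqP sw)) => /=.
by case: stay => // ->.
Qed.

Lemma mlim_bounded (X : Type) (U : set_system X) {UF : UltraFilter U}
    (u : X -> 'cV[C]_2) (K : R) :
  (\forall x \near U, vnorm (u x) <= K) -> exists u0, mlim U u u0.
Proof.
move=> uK.
have [|a ha] := @bounded_ultra_lim R X U UF (fun x => u x 0 0) K.
  by apply: filterS uK => x; apply: le_trans; rewrite /vnorm lerDl normc_ge0.
have [|b hb] := @bounded_ultra_lim R X U UF (fun x => u x 1 0) K.
  by apply: filterS uK => x; apply: le_trans; rewrite /vnorm lerDr normc_ge0.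
by exists (vec a b) => i j; rewrite ord1; move: i; apply: ord2P; rewrite ?vec0E ?vec1E.
Qed.

Lemma mlim_unit (X : Type) (F : set_system X) {FF : ProperFilter F}
    (u : X -> 'cV[C]_2) (u0 : 'cV[C]_2) :
  mlim F u u0 -> (\forall x \near F, vnorm (u x) = 1) -> vnorm u0 = 1.
Proof.
move=> /mlim_vnorm h h1; apply/eqP; rewrite eq_le; apply/andP; split; rewrite leNgt.
  apply/negP => u1; have /filter_ex[x [-> ]] : \forall x \near F, vnorm (u x) = 1 /\ 1 < vnorm (u x).
    by apply: filterS2 h1 (near_gt h u1).
  by rewrite ltxx.
apply/negP => u1; have /filter_ex[x [-> ]] : \forall x \near F, vnorm (u x) = 1 /\ vnorm (u x) < 1.
  by apply: filterS2 h1 (near_lt h u1).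
by rewrite ltxx.
Qed.

(** Compactness of the unit sphere makes the length uniform in the direction. *)
Lemma stayp_uniform (B : I -> 'M[C]_2) (d : R) : 0 < d ->
  (forall u, u != 0 -> stayoo p B u <= 0) ->
  exists N, forall u, vnorm u = 1 -> stayp p B N u < d.
Proof.
move=> d0 h; apply: contrapT => /forallNP nN.
have hu N : exists u, vnorm u = 1 /\ d <= stayp p B N u.
  have /existsNP[u /not_implyP[u1 /negP]] := nN N; rewrite -leNgt => hu.
  by exists u.
have [u hu'] := choice hu.
have [W [WU W_oo]] := @ultraFilterLemma nat \oo _.
have PW : ProperFilter W by exact: ultra_proper.
have [|u0 uu0] := @mlim_bounded _ W WU u 1.
  by apply: nearW => N; rewrite (hu' N).1.
have u01 : vnorm u0 = 1 by apply: mlim_unit uu0 _; apply: nearW => N; exact: (hu' N).1.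
have u0n : u0 != 0 by rewrite -vnorm_gt0 u01.
have := h _ u0n; rewrite leNgt => /negP; apply; apply: lt_le_trans d0 _.
apply: (stayoo_ge p_gt0 p_sum1) => m.
apply: (@stayp_usc _ W PW (fun=> B) B u u0) => // [i|]; first exact: mlim_cst.
have : \forall N \near W, (m <= N)%N by apply: W_oo; exact: nbhs_infty_ge.
apply: filterS => N mN; apply: le_trans (hu' N).2 _.
exact: stayp_le.
Qed.

(** Compactness again: a sequence of bad directions would have a bad limit. *)
Lemma stayp_uniform_near (X : Type) (U : set_system X) {UF : UltraFilter U}
    (g : X -> I -> 'M[C]_2) (B : I -> 'M[C]_2) N (d : R) :
  (forall i, mlim U (g^~ i) (B i)) ->
  (forall u, vnorm u = 1 -> stayp p B N u < d) ->
  \forall x \near U, forall u, vnorm u = 1 -> stayp p (g x) N u < d.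
Proof.
have PU : ProperFilter U by exact: ultra_proper.
move=> gB hB.
pose S := [set x | forall u, vnorm u = 1 -> stayp p (g x) N u < d].
have [//|US] := in_ultra_setVsetC S UF.
have hu x : exists u, ~ S x -> vnorm u = 1 /\ d <= stayp p (g x) N u.
  have [Sx|/existsNP[u /not_implyP[u1 /negP]]] := pselect (S x); first by exists 0.
  by rewrite -leNgt => du; exists u.
have [u hu'] := choice hu.
have [|u0 uu0] := @mlim_bounded _ U UF u 1.
  by apply: filterS US => x /hu'[->].
have u01 : vnorm u0 = 1 by apply: mlim_unit uu0 _; apply: filterS US => x /hu'[].
have := hB _ u01; rewrite ltNge => /negP; case.
by apply: (stayp_usc gB uu0); apply: filterS US => x /hu'[].
Qed.

Section Excursions.
Variables (B : I -> 'M[C]_2) (N : nat) (c : R).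
Hypothesis B_nd : nondegenerate B.
Hypothesis c_ge0 : 0 <= c.
Hypothesis B_lower : forall i (v : 'cV[C]_2), v != 0 -> ln (vnorm v) - c <= ln (vnorm (B i *m v)).

Definition unitv (u : 'cV[C]_2) : 'cV[C]_2 := ((vnorm u)^-1)%:C%C *: u.

Lemma vnorm_unitv u : u != 0 -> vnorm (unitv u) = 1.
Proof.
move=> u0; rewrite vnormZ normc_real ger0_norm ?invr_ge0 ?vnorm_ge0//.
by rewrite mulVf// vnorm_eq0.
Qed.

(** Number of times from which the orbit fails to expand within [N] steps. *)
Fixpoint stalls (w : seq I) (u : 'cV[C]_2) : nat :=
  if w is i :: v then (stay B (take N w) (unitv u) + stalls v (B i *m u))%N else 0%N.

Lemma stalls_drop k w u : (stalls (drop k w) (wprod B (take k w) *m u) <= stalls w u)%N.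
Proof.
elim: k w u => [|k IH] w u; first by rewrite drop0 take0 mul1mx.
case: w => [|i w]; first by [].
by rewrite [drop _ _]/= [take _ _]/= -mulmxA (leq_trans (IH _ _))// /= leq_addl.
Qed.

Lemma not_stay w v : ~~ stay B w v ->
  exists2 k, (k <= size w)%N & 1 < vnorm (wprod B (take k w) *m v).
Proof.
elim: w v => [|i w IH] v /=.
  by rewrite andbT -ltNge => h; exists 0%N; rewrite ?mul1mx.
rewrite negb_and => /orP[|/IH[k kw hk]].
  by rewrite -ltNge => h; exists 0%N; rewrite ?mul1mx.
by exists k.+1; rewrite //= -mulmxA.
Qed.

(** Jumping over every excursion that expands, the product only loses at the
    stalled times. *)
Lemma expansion_ge_stalls w u : u != 0 ->
  ln (vnorm u) - c * (stalls w u)%:R <= ln (vnorm (wprod B w *m u)).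
Proof.
have [n] := ubnP (size w); elim: n w u => // n IH w u wn u0.
case: w => [|i w] in wn *; first by rewrite /= mulr0 subr0 mul1mx.
have Bu : B i *m u != 0 by apply: mulmx_neq0.
case st : (stay B (take N (i :: w)) (unitv u)).
  have : stalls (i :: w) u = (stalls w (B i *m u)).+1 by rewrite [LHS]/= st.
  move=> ->; rewrite -natr1.
  have := IH w (B i *m u); rewrite -ltnS => /(_ wn Bu); have := B_lower i u0.
  by rewrite /= mulmxA; lra.
have [k] := not_stay (negbT st).
case: k => [|k]; first by rewrite take0 mul1mx vnorm_unitv ?ltxx.
rewrite size_take_min => kN.
have -> : take k.+1 (take N (i :: w)) = take k.+1 (i :: w).
  by rewrite take_takel// (leq_trans kN)// geq_minl.
have kw : (k <= size w)%N by move: kN; rewrite leq_min => /andP[].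
set y := wprod B (take k.+1 (i :: w)) => hy.
have y0 : \det y != 0 by exact: det_wprod_neq0.
have u_gt0 : 0 < vnorm u by rewrite vnorm_gt0.
have yu : ln (vnorm u) <= ln (vnorm (y *m u)).
  rewrite ler_ln ?posrE// ?vnorm_gt0 ?mulmx_neq0//.
  move: hy; rewrite /unitv -scalemxAr vnormZ normc_real.
  rewrite ger0_norm ?invr_ge0 ?vnorm_ge0// => hy.
  by move/ltW: hy; rewrite mulrC ler_pdivlMr// mul1r.
have sz : (size (drop k.+1 (i :: w)) < n)%N.
  by rewrite size_drop subSS (leq_ltn_trans (leq_subr _ _)).
have h2 := IH _ _ sz (mulmx_neq0 y0 u0).
have wE : wprod B (i :: w) = wprod B (drop k.+1 (i :: w)) *m y.
  by rewrite -{1}(cat_take_drop k.+1 (i :: w)) wprod_cat.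
rewrite wE -mulmxA; apply: le_trans h2; apply: lerB => //.
by apply: ler_wpM2l => //; rewrite ler_nat stalls_drop.
Qed.

Variable d : R.
Hypothesis d_ge0 : 0 <= d.
Hypothesis d_bound : forall u, vnorm u = 1 -> stayp p B N u < d.

(** Far from the end of the word a stall has probability at most [d]; the last
    [N] times are counted in full. *)
Lemma expect_stalls n u : u != 0 ->
  expect p n (fun w => (stalls w u)%:R) <= d * n%:R + (minn n N)%:R.
Proof.
elim: n u => [|n IH] u u0; first by rewrite min0n /= mulr0 addr0.
have -> : expect p n.+1 (fun w => (stalls w u)%:R) =
    expect p n.+1 (fun w => (stay B (take N w) (unitv u))%:R) +
    \sum_i p i * expect p n (fun w => (stalls w (B i *m u))%:R).
  rewrite /= -big_split; apply: eq_bigr => i _ /=; rewrite -mulrDr -expectD.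
  by congr (_ * _); apply: eq_expect => w _; rewrite natrD.
have h2 : \sum_i p i * expect p n (fun w => (stalls w (B i *m u))%:R) <=
    d * n%:R + (minn n N)%:R.
  rewrite -[leRHS](mean_cst p_sum1); apply: ler_sum => i _; rewrite ler_pM2l//.
  by apply: IH; exact: mulmx_neq0.
have [Nn|nN] := leqP N n.+1.
  have h1 : expect p n.+1 (fun w => (stay B (take N w) (unitv u))%:R) <= d.
    rewrite -(subnKC Nn) expect_cat; apply: le_trans (ltW (d_bound (vnorm_unitv u0))).
    apply: (le_expect p_gt0) => v sv; apply: (expect_le p_gt0 p_sum1) => w _.
    by rewrite take_size_cat.
  apply: le_trans (lerD h1 h2) _.
  have : (minn n N)%:R <= N%:R :> R by rewrite ler_nat geq_minr.
  by rewrite -(natr1 n); lra.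
have h1 : expect p n.+1 (fun w => (stay B (take N w) (unitv u))%:R) <= 1.
  by apply: (expect_le p_gt0 p_sum1) => w _; case: stay.
rewrite (minn_idPl (ltnW (ltnW nN))) in h2.
apply: le_trans (lerD h1 h2) _; rewrite -(natr1 n).
by have := d_ge0; lra.
Qed.

Lemma growth_ge_stalls n : n%:R * (- (c * d)) - (c * N%:R + ln 2) <= growth p B n.
Proof.
pose u : 'cV[C]_2 := vec 1 0.
have u1 : vnorm u = 1 by rewrite /vnorm vec0E vec1E normc1 normc0 addr0.
have u0 : u != 0 by rewrite -vnorm_gt0 u1.
apply: le_trans (_ : expect p n (fun w => - c * (stalls w u)%:R) <= _); last first.
  apply: (le_expect p_gt0) => w _.
  have := expansion_ge_stalls w u0; rewrite u1 ln1 add0r -mulNr => /le_trans; apply.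
  rewrite ler_ln ?posrE ?mnorm_wprod_gt0 ?vnorm_gt0 ?mulmx_neq0 ?det_wprod_neq0//.
  by have := vnormM (wprod B w) u; rewrite u1 mulr1.
rewrite expectZ.
have := ler_wpM2l c_ge0 (expect_stalls n u0).
have : (minn n N)%:R <= N%:R :> R by rewrite ler_nat geq_minr.
move=> /(ler_wpM2l c_ge0); have := @ln2_ge0 R; lra.
Qed.

End Excursions.

Section Near.
Context {X : Type} (U : set_system X) {UF : UltraFilter U}.
Variables (f : X -> I -> 'M[C]_2) (A : I -> 'M[C]_2).
Hypothesis fA : forall i, mlim U (f^~ i) (A i).
Hypothesis A_nd : nondegenerate A.
Let PU : ProperFilter U := ultra_proper.

Lemma growth_rescale (M : I -> 'M[C]_2) (kappa : R) n : nondegenerate M ->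
  growth p (rescale M kappa) n = growth p M n - n%:R * kappa.
Proof.
move=> Mnd; rewrite /growth -[n%:R * kappa](expect_cst p_sum1 n) -expectB.
apply: eq_expect => w <-; rewrite wprod_rescale mnormZ normc_expR.
by rewrite lnM ?posrE ?expR_gt0 ?mnorm_wprod_gt0// expRK addrC.
Qed.

Lemma nondegenerate_rescale (M : I -> 'M[C]_2) (kappa : R) :
  nondegenerate M -> nondegenerate (rescale M kappa).
Proof.
by move=> Mnd i; rewrite /rescale detZ mulf_neq0// expf_neq0// expRC_neq0.
Qed.

(** Without an invariant line of smaller drift, every direction expands at the
    full rate within a bounded time, except with small probability; this is an
    open condition on the family. *)
Lemma lexp_lsc_no_slow_line (e : R) : 0 < e -> ldet p A / 2 < lexp p A ->
  (forall (u : 'cV[C]_2) a, u != 0 -> (forall i, A i *m u = a i *: u) ->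
    lexp p A <= mean p (fun i => lnc (a i))) ->
  \forall x \near U, lexp p A - e <= lexp p (f x).
Proof.
move=> e0 gap noline.
pose kappa := lexp p A - e / 2.
have kl : kappa < lexp p A by rewrite /kappa ltrBlDr ltrDl divr_gt0.
pose B := rescale A kappa.
have B_nd : nondegenerate B by exact: nondegenerate_rescale.
have bounded0 (u : 'cV[C]_2) : u != 0 -> stayoo p B u <= 0.
  move=> u0; rewrite leNgt; apply/negP => su.
  have bu : 0 < boundp p B u.
    apply: lt_le_trans su _; rewrite -{1}[u]scale1r.
    by apply: boundp_ge => //; rewrite oner_neq0.
  have [v [a [v0 Av]]] := slow_invariant_line p_gt0 p_sum1 A_nd kl gap u0 bu.
  by move=> /(le_trans (noline v a v0 Av)); rewrite leNgt kl.
(* c bounds the logarithmic contraction in one step, by the ratio |det| / norm *)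
pose ratio i := normc (\det (B i)) / mnorm (B i).
have ratio0 i : 0 < ratio i by rewrite divr_gt0 ?normc_gt0 ?mnorm_gt0_det.
pose c := \sum_i `|ln (ratio i)| + 1.
have c0 : 0 < c by rewrite ltr_wpDl// sumr_ge0.
have [|N hN] := @stayp_uniform B (e / 2 / c) _ bounded0.
  by rewrite !divr_gt0.
pose g x := rescale (f x) kappa.
have gB i : mlim U (g^~ i) (B i) by apply: mlimZ; [exact: clim_cst|exact: fA].
have near1 := stayp_uniform_near gB hN.
have near2 := near_nondegenerate fA A_nd.
have near3 : \forall x \near U, forall i, expR (- c) * mnorm (g x i) < normc (\det (g x i)).
  apply: near_fin => i.
  have : normc (\det (g x i)) - expR (- c) * mnorm (g x i) @[x --> U] -->
      normc (\det (B i)) - expR (- c) * mnorm (B i).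
    apply: cvgB; first exact: (clim_normc (mlim_det (gB i))).
    by apply: cvgMl_tmp; exact: (mlim_mnorm (gB i)).
  move=> lim.
  have : expR (- c) * mnorm (B i) < normc (\det (B i)).
    rewrite -ltr_pdivlMr ?mnorm_gt0_det//.
    rewrite -[ltRHS](@lnK R (ratio i)) ?posrE// ltr_expR.
    have := ler_norm (- ln (ratio i)); rewrite normrN.
    have : `|ln (ratio i)| <= \sum_i `|ln (ratio i)| by rewrite (bigD1 i)//= lerDl sumr_ge0.
    by rewrite /c; lra.
  by rewrite -subr_gt0 => /(near_gt lim); apply: filterS => x; rewrite subr_gt0.
have FU : Filter U by exact: filter_filter.
near=> x.
have h1 : forall u, vnorm u = 1 -> stayp p (g x) N u < e / 2 / c by near: x; exact: near1.
have h2 : nondegenerate (f x) by near: x; exact: near2.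
have h3 : forall i, expR (- c) * mnorm (g x i) < normc (\det (g x i)) by near: x; exact: near3.
have g_nd : nondegenerate (g x) by exact: nondegenerate_rescale.
have lower i (v : 'cV[C]_2) : v != 0 -> ln (vnorm v) - c <= ln (vnorm (g x i *m v)).
  move=> v0; have -> : ln (vnorm v) - c = ln (vnorm v * expR (- c)).
    by rewrite lnM ?posrE ?expR_gt0 ?vnorm_gt0// expRK.
  have gv : 0 < vnorm (g x i *m v) by rewrite vnorm_gt0 mulmx_neq0.
  rewrite ler_ln ?posrE//; last by rewrite mulr_gt0 ?expR_gt0 ?vnorm_gt0.
  have m0 : 0 < mnorm (g x i) by rewrite mnorm_gt0_det.
  rewrite -(ler_pM2l m0); apply: le_trans (det_vnorm _ _).
  rewrite mulrCA mulrC -mulrA; have := ltW (h3 i) => /(ler_wpM2r (vnorm_ge0 v)).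
  by congr (_ <= _); ring.
have dd0 : 0 <= e / 2 / c by rewrite !divr_ge0// ltW.
apply: (@lexp_ge _ _ _ p_gt0 p_sum1 (f x) h2 _ (c * N%:R + ln 2)) => n.
have := growth_ge_stalls g_nd (ltW c0) lower dd0 h1 n.
rewrite growth_rescale// [c * (e / 2 / c)]mulrC divfK ?gt_eqF// /kappa; lra.
Unshelve. all: by end_near.
Qed.

End Near.
End LowerSemicontinuity.

(** * Families with an invariant line *)

Section Continuity.
Context {R : realType} {I : finType} (p : I -> R).
Hypothesis p_gt0 : forall i, 0 < p i.
Hypothesis p_sum1 : \sum_i p i = 1.
Local Notation C := R[i].

(** Conjugation changes the norm of products by a bounded factor. *)
Lemma lexp_conj (A B : I -> 'M[C]_2) (P : 'M[C]_2) : \det P != 0 ->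
  nondegenerate A -> nondegenerate B ->
  (forall i, P *m B i = A i *m P) -> lexp p B <= lexp p A.
Proof.
move=> dP And Bnd PBA.
have wE w : P *m wprod B w = wprod A w *m P.
  elim: w => [|i w IH] /=; first by rewrite mulmx1 mul1mx.
  by rewrite mulmxA IH -!mulmxA PBA.
have [K KE] : exists K, K = mnorm (invmx P) * mnorm P by eexists.
have K0 : 0 < K by rewrite KE mulr_gt0 ?mnorm_gt0_det// det_inv invr_eq0.
apply: (@lexp_ge _ _ _ p_gt0 p_sum1 _ And _ `|ln K|) => n.
case: n => [|n]; first by rewrite mul0r growth0 sub0r (le_trans _ (@ln2_ge0 R))// oppr_le0.
rewrite lerBlDr; apply: le_trans (lexp_le p_gt0 p_sum1 Bnd _) _ => //.
rewrite -[X in _ + X](expect_cst p_sum1 n.+1) -expectD; apply: (le_expect p_gt0) => w _.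
apply: le_trans (_ : ln (mnorm (wprod A w) * K) <= _); last first.
  by rewrite lnM ?posrE ?mnorm_wprod_gt0// lerD2l ler_norm.
rewrite ler_ln ?posrE ?mulr_gt0 ?mnorm_wprod_gt0//.
have -> : wprod B w = invmx P *m (wprod A w *m P).
  by rewrite -wE mulmxA mulVmx ?mul1mx// unitmxE unitfE.
apply: le_trans (mnormM _ _) _; rewrite KE mulrCA ler_wpM2l ?mnorm_ge0//.
exact: mnormM.
Qed.

Lemma mean_le_lexp (A : I -> 'M[C]_2) (x : I -> R) (K : R) : nondegenerate A -> 0 < K ->
  (forall w, \sum_(i <- w) x i <= ln (mnorm (wprod A w)) + K) -> mean p x <= lexp p A.
Proof.
move=> And K0 h; apply: (@lexp_ge _ _ _ p_gt0 p_sum1 _ And _ K) => n.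
rewrite lerBlDr -(expect_letters p_sum1) -[X in _ + X](expect_cst p_sum1 n) -expectD.
exact: (le_expect p_gt0).
Qed.

Lemma lexp_ge_line (A : I -> 'M[C]_2) (u : 'cV[C]_2) a : nondegenerate A -> u != 0 ->
  (forall i, A i *m u = a i *: u) -> mean p (fun i => lnc (a i)) <= lexp p A.
Proof.
move=> And u0 Au; apply: (@mean_le_lexp _ _ 1) => // w.
have a0 i : a i != 0 := eigen_neq0 And u0 (Au i).
have [q0 <-] := lnc_prod w a0.
rewrite ler_wpDr// ler_ln ?posrE ?normc_gt0 ?mnorm_wprod_gt0//.
have := vnormM (wprod A w) u; rewrite (wprod_eigen w Au) vnormZ ler_pM2r//.
by rewrite vnorm_gt0.
Qed.

Section Triangular.
Variables a b d : I -> C.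
Hypotheses (a0 : forall i, a i != 0) (d0 : forall i, d i != 0).

Definition tri (eta : C) i : 'M[C]_2 := mx2 (a i) (eta * b i) 0 (d i).

Lemma tri_nondegenerate eta : nondegenerate (tri eta).
Proof. by move=> i; rewrite det2E !mx2E mulr0 subr0 mulf_neq0. Qed.

Lemma wprod_tri eta w : [/\ wprod (tri eta) w 0 0 = \prod_(i <- w) a i,
  wprod (tri eta) w 1 0 = 0, wprod (tri eta) w 1 1 = \prod_(i <- w) d i &
  eta = 0 -> wprod (tri eta) w 0 1 = 0].
Proof.
elim: w => [|i w [h00 h10 h11 h01]].
  by split; rewrite ?big_nil !mxE.
rewrite /= !mulmx2E !mx2E h00 h10 h11 !big_cons; split; try ring.
by move=> /[dup] /h01 -> ->; ring.
Qed.

Lemma lexp_tri_ge eta : mean p (fun i => lnc (d i)) <= lexp p (tri eta).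
Proof.
apply: (@mean_le_lexp _ _ 1) => //; first exact: tri_nondegenerate.
move=> w; have [q0 <-] := lnc_prod w d0.
rewrite ler_wpDr// ler_ln ?posrE ?normc_gt0 ?mnorm_wprod_gt0//; last exact: tri_nondegenerate.
by have [_ _ <- _] := wprod_tri eta w; exact: ler_entry_mnorm.
Qed.

Let ma := mean p (fun i => lnc (a i)).
Let md := mean p (fun i => lnc (d i)).

(** For diagonal products both entries concentrate around their drifts. *)
Lemma growth_diag (e : R) : 0 < e ->
  exists2 n, (0 < n)%N & growth p (tri 0) n <= n%:R * (Num.max ma md + e).
Proof.
move=> e0; have e3 : 0 < e / 3 by rewrite divr_gt0.
have [n1 h1] := letters_deviation p_gt0 p_sum1 (fun i => lnc (a i)) e3.
have [n2 h2] := letters_deviation p_gt0 p_sum1 (fun i => lnc (d i)) e3.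
pose n := maxn (maxn n1 n2) (Num.truncn (ln 2 / (e / 3))).+1.
have n0 : (0 < n)%N by rewrite /n leq_max orbT.
have {h1} := h1 n _; rewrite /n !leq_max leqnn -/n => /(_ isT) h1.
have {h2} := h2 n _; rewrite /n !leq_max leqnn orbT -/n => /(_ isT) h2.
have n3 : ln 2 < n%:R * (e / 3).
  rewrite -ltr_pdivrMr//; apply: lt_le_trans (truncnS_gt _) _.
  by rewrite ler_nat leq_maxr.
exists n => //.
apply: le_trans (_ : expect p n (fun w => (ln 2 + n%:R * Num.max ma md) +
  (`|\sum_(i <- w) lnc (a i) - n%:R * ma| + `|\sum_(i <- w) lnc (d i) - n%:R * md|)) <= _).
  apply: (le_expect p_gt0) => w _.
  have [pa0 pa] := lnc_prod w a0; have [pd0 pd] := lnc_prod w d0.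
  have -> : mnorm (wprod (tri 0) w) =
      normc (\prod_(i <- w) a i) + normc (\prod_(i <- w) d i).
    have [h00 h10 h11 /(_ erefl) h01] := wprod_tri 0 w.
    by rewrite /mnorm h00 h10 h11 h01 !normc0 !addr0.
  have ln2M (x y : R) : 0 < x -> 0 < y -> ln (x + y) <= ln 2 + Num.max (ln x) (ln y).
    have ln2 (s t : R) : 0 < s -> 0 < t -> s <= t -> ln (s + t) <= ln 2 + ln t.
      move=> s0 t0 st; have -> : ln 2 + ln t = ln (2 * t) by rewrite lnM ?posrE.
      by rewrite ler_ln ?posrE ?addr_gt0 ?mulr_gt0//; lra.
    move=> x0 y0; have [xy|/ltW yx] := lerP x y.
      by apply: le_trans (ln2 _ _ x0 y0 xy) _; rewrite lerD2l le_max lexx orbT.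
    rewrite addrC; apply: le_trans (ln2 _ _ y0 x0 yx) _.
    by rewrite lerD2l le_max lexx.
  apply: le_trans (ln2M _ _ _ _) _; rewrite ?normc_gt0// -addrA lerD2l.
  rewrite -/(lnc _) -/(lnc _) pa pd.
  have nR : 0 <= n%:R :> R by [].
  have h1' := ler_norm (\sum_(i <- w) lnc (a i) - n%:R * ma).
  have h2' := ler_norm (\sum_(i <- w) lnc (d i) - n%:R * md).
  have h3 := normr_ge0 (\sum_(i <- w) lnc (a i) - n%:R * ma).
  have h4 := normr_ge0 (\sum_(i <- w) lnc (d i) - n%:R * md).
  have h5 : n%:R * ma <= n%:R * Num.max ma md by rewrite ler_wpM2l// le_max lexx.
  have h6 : n%:R * md <= n%:R * Num.max ma md by rewrite ler_wpM2l// le_max lexx orbT.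
  rewrite ge_max; apply/andP; split; lra.
rewrite expectD (expect_cst p_sum1) expectD; move: h1 h2.
rewrite -/ma -/md.
set E1 := expect p n _; set E2 := expect p n _ => h1 h2.
rewrite mulrDr; lra.
Qed.

(** A diagonal conjugation makes the off-diagonal entries as small as desired,
    which brings the family close to a diagonal one. *)
Lemma lexp_tri_le : lexp p (tri 1) <= Num.max ma md.
Proof.
apply/ler_addgt0Pr => e e0; have e2 : 0 < e / 2 by rewrite divr_gt0.
have [n n0 hn] := growth_diag e2.
pose eta (k : nat) : C := (harmonic k)%:C%C.
have lim i : mlim \oo (fun k => tri (eta k) i) (tri 0 i).
  have eta0 : clim \oo eta 0 by split; [exact: cvg_harmonic|exact: cvg_cst].
  apply: ord2P; apply: ord2P; rewrite /tri !mx2E; under eq_fun do rewrite mx2E; try exact: clim_cst.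
  by apply: climM => //; exact: clim_cst.
have lim2 : growth p (tri (eta k)) n @[k --> \oo] --> growth p (tri 0) n.
  by apply: cvg_growth lim _ _; exact: tri_nondegenerate.
have lt1 : growth p (tri 0) n < n%:R * (Num.max ma md + e).
  apply: le_lt_trans hn _; rewrite ltr_pM2l ?ltr0n// ltrD2l.
  by rewrite ltr_pdivrMr// ltr_pMr// ltr1n.
have [k hk] : exists k, growth p (tri (eta k)) n < n%:R * (Num.max ma md + e).
  exact: filter_ex (near_lt lim2 lt1).
have ek : eta k != 0 by rewrite -normc_eq0 normc_real normr_eq0 gt_eqF// harmonic_gt0.
have conj : lexp p (tri 1) <= lexp p (tri (eta k)).
  apply: (@lexp_conj _ _ (mx2 (eta k) 0 0 1)); try exact: tri_nondegenerate.
    by rewrite det2E !mx2E mulr1 mul0r subr0.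
  by move=> i; apply: mx2P; rewrite !mulmx2E !mx2E; ring.
apply: le_trans conj _.
have := lexp_le p_gt0 p_sum1 (tri_nondegenerate (eta k)) n0.
by move=> /le_lt_trans/(_ hk); rewrite ltr_pM2l ?ltr0n// => /ltW.
Qed.

End Triangular.

(** A family fixing a line is block triangular, and its exponent is the larger of
    the drifts along the line and along the quotient. *)
Lemma lexp_line (A : I -> 'M[C]_2) (u : 'cV[C]_2) a : nondegenerate A -> u != 0 ->
  (forall i, A i *m u = a i *: u) ->
  lexp p A <= Num.max (mean p (fun i => lnc (a i)))
                      (ldet p A - mean p (fun i => lnc (a i))).
Proof.
move=> And u0 Au; have a0 i : a i != 0 := eigen_neq0 And u0 (Au i).
have [v uv] : exists v, wedge u v != 0.
  have [u00|u00] := eqVneq (u 0 0) 0.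
    exists (vec 1 0); rewrite /wedge vec0E vec1E mulr0 mulr1 sub0r oppr_eq0.
    by apply: contra u0 => /eqP u10; apply/eqP/cv2P; rewrite mxE.
  by exists (vec 0 1); rewrite /wedge vec0E vec1E mulr1 mulr0 subr0.
pose P := frame u v.
have dP : \det P != 0 by rewrite det_frame.
have uP : P \in unitmx by rewrite unitmxE unitfE.
pose B i := invmx P *m A i *m P.
have PB i : P *m B i = A i *m P by rewrite /B !mulmxA mulmxV// mul1mx.
have B_nd : nondegenerate B.
  by move=> i; rewrite /B !det_mulmx det_inv !mulf_neq0// invr_eq0.
have B0 i : B i *m vec 1 0 = a i *: vec 1 0.
  have Pe : P *m vec 1 0 = u by apply: cv2P; rewrite mulmx2E !mx2E vec0E vec1E; ring.
  rewrite /B -!mulmxA Pe Au -scalemxAr; congr (_ *: _).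
  by rewrite -Pe mulmxA mulVmx// mul1mx.
have B00 i : B i 0 0 = a i.
  have := B0 i => /matrixP/(_ 0 0); rewrite mulmx2E vec0E vec1E !mxE /=.
  by rewrite !mulr1 mulr0 addr0.
have B10 i : B i 1 0 = 0.
  have := B0 i => /matrixP/(_ 1 0); rewrite mulmx2E vec0E vec1E !mxE /=.
  by rewrite mulr1 !mulr0 addr0.
have detB i : \det (B i) = a i * B i 1 1 by rewrite det2E B00 B10 mulr0 subr0.
have d0 i : B i 1 1 != 0.
  by apply: contraNneq (B_nd i) => d0; rewrite detB d0 mulr0.
have BE i : B i = tri a (fun i => B i 0 1) (fun i => B i 1 1) 1 i.
  by apply: mx2P; rewrite !mx2E ?mul1r.
have dAB i : \det (A i) = \det (B i).
  by rewrite /B !det_mulmx det_inv mulrAC mulVf// mul1r.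
have ldE : ldet p A - mean p (fun i => lnc (a i)) = mean p (fun i => lnc (B i 1 1)).
  apply/eqP; rewrite subr_eq -meanD; apply/eqP; apply: eq_bigr => i _.
  by rewrite dAB detB -/(lnc _) lncM// addrC.
rewrite ldE; apply: le_trans (lexp_tri_le (fun i => B i 0 1) a0 d0).
apply: (@lexp_conj _ _ (invmx P)) => //.
- by rewrite det_inv invr_eq0.
- exact: tri_nondegenerate.
by move=> i; rewrite -BE /B -!mulmxA mulmxV// mulmx1.
Qed.

(** The root of the quadratic equation that is small with [c]: written with the
    larger of the two denominators [e + s], [e - s], it stays controlled when [b]
    is small. *)
Lemma small_root (b c e : C) : e != 0 ->
  exists2 z, c + e * z - b * z ^+ 2 = 0 & normc e * normc z <= 2 * normc c.
Proof.
move=> e0; pose s := sqrtC (e ^+ 2 + 4 * b * c).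
have s2 : s ^+ 2 = e ^+ 2 + 4 * b * c by rewrite sqrtCK.
have [q [hq qe]] : exists q, q ^+ 2 = 2 * e * q + 4 * b * c /\ normc e <= normc q.
  have h : 2 * normc e <= normc (e + s) + normc (e - s).
    apply: le_trans (ler_normcD _ _).
    have -> : e + s + (e - s) = 2%:R * e by ring.
    by rewrite normcM le_eqVlt -(rmorph_nat (real_complex R)) normc_real normr_nat eqxx.
  have [h1|h1] := leP (normc e) (normc (e + s)).
    exists (e + s); split=> //; rewrite sqrrD s2; ring.
  exists (e - s); split; last by lra.
  by rewrite sqrrB s2; ring.
have q0 : q != 0.
  by rewrite -normc_gt0; apply: lt_le_trans qe; rewrite normc_gt0.
exists (- 2 * c / q).
  have -> : c + e * (- 2 * c / q) - b * (- 2 * c / q) ^+ 2 =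
      c * (q ^+ 2 - 2 * e * q - 4 * b * c) / q ^+ 2 by field.
  have -> : q ^+ 2 - 2 * e * q - 4 * b * c = 0 by rewrite hq; ring.
  by rewrite mulr0 mul0r.
have n2 : normc (- 2 : C) = 2.
  by rewrite normcN -(rmorph_nat (real_complex R)) normc_real normr_nat.
rewrite !normcM n2 normcV mulrA ler_pdivrMr ?normc_gt0// mulrC ler_wpM2l//.
by rewrite mulr_ge0 ?normc_ge0.
Qed.

End Continuity.

(** * Continuity of the Lyapunov exponent *)

Lemma real_cvg_unique (R : realType) (X : Type) (F : set_system X)
    {FF : ProperFilter F} (h : X -> R) (a b : R) :
  h x @[x --> F] --> a -> h x @[x --> F] --> b -> a = b.
Proof. by move=> ha hb; exact: (cvg_unique (@Rhausdorff R) ha hb). Qed.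

Lemma mul_diag_rescaled (R : realType) (M : 'M[R[i]]_2) (r : R[i]) : r != 0 ->
  mx2 1 0 0 r *m mx2 (M 0 0) (r * M 0 1) (M 1 0 / r) (M 1 1) = M *m mx2 1 0 0 r.
Proof.
by move=> r0; apply: mx2P; rewrite !mulmx2E !mx2E ?mulr0 ?mulr1 ?mul0r ?mul1r
  ?add0r ?addr0 // mulrC // divfK.
Qed.

Section BlowUp.
Context {R : realType} {I : finType} (p : I -> R).
Hypothesis p_gt0 : forall i, 0 < p i.
Hypothesis p_sum1 : \sum_i p i = 1.
Local Notation C := R[i].

Section Ultra.
Context {X : Type} (U : set_system X) {UF : UltraFilter U}.
Let PU : ProperFilter U := ultra_proper.
Let FU : Filter U := filter_filter.

(** Near a family fixing the first axis with small drift, conjugate so that the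
    axis is spanned by an eigenvector of one element [i0] with distinct
    eigenvalues, and rescale by the total displacement [r] of that axis. The
    rescaled families converge to a lower triangular family without other common
    line than the expanded one, to which the previous case applies. *)
Lemma lexp_lsc_upper (f : X -> I -> 'M[C]_2) (A : I -> 'M[C]_2) (e : R) :
  0 < e -> (forall i, mlim U (f^~ i) (A i)) -> nondegenerate A ->
  (forall i, A i 1 0 = 0) -> mean p (fun i => lnc (A i 0 0)) < lexp p A ->
  \forall x \near U, lexp p A - e <= lexp p (f x).
Proof.
move=> e0 fA And A10 slow.
have detA i : \det (A i) = A i 0 0 * A i 1 1 by rewrite det2E A10 mulr0 subr0.
have a0 i : A i 0 0 != 0.
  by apply: contraNneq (And i) => h; rewrite detA h mul0r.
have d0 i : A i 1 1 != 0.
  by apply: contraNneq (And i) => h; rewrite detA h mulr0.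
set ma := mean p _ in slow; pose md := mean p (fun i => lnc (A i 1 1)).
have ldE : ldet p A = ma + md.
  rewrite -meanD; apply: eq_bigr => i _; congr (_ * _).
  by rewrite detA -/(lnc _) lncM.
have lE : lexp p A = md.
  apply/eqP; rewrite eq_le; apply/andP; split; last first.
    have := lexp_tri_ge p_gt0 p_sum1 (fun i => A i 0 1) a0 d0 1.
    congr (_ <= lexp p _); apply/funext => i.
    by apply: mx2P; rewrite !mx2E ?mul1r.
  have e1 : vec 1 0 != 0 :> 'cV[C]_2.
    by rewrite -vnorm_gt0 /vnorm vec0E vec1E normc1 normc0 addr0.
  have Ae i : A i *m vec 1 0 = A i 0 0 *: vec 1 0.
    by apply: cv2P; rewrite mulmx2E !vec0E !vec1E mxE ?vec0E ?vec1E ?A10 ?mulr1 ?mulr0 ?addr0.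
  have := lexp_line p_gt0 p_sum1 And e1 Ae; rewrite -/ma ldE addrC addKr.
  by rewrite le_max leNgt slow.
have gap : ldet p A / 2 < lexp p A by rewrite ldE -lE; lra.
have [i0 ad] : exists i, A i 0 0 != A i 1 1.
  apply: contrapT => /forallNP h; move: slow; rewrite lE /ma /md.
  rewrite (_ : (fun i => lnc (A i 0 0)) = (fun i => lnc (A i 1 1))) ?ltxx//.
  apply/funext => i; congr lnc; have := h i => /negP; rewrite negbK.
  by move/eqP.
(* z x is the slope of the eigenvector of f x i0 close to the first axis *)
pose ee x := f x i0 1 1 - f x i0 0 0.
have ee_lim : clim U ee (A i0 1 1 - A i0 0 0) by apply: climB; exact: fA.
have e_neq0 : A i0 1 1 - A i0 0 0 != 0 by rewrite subr_eq0 eq_sym.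
have hz x : exists z, ee x != 0 -> f x i0 1 0 + ee x * z - f x i0 0 1 * z ^+ 2 = 0 /\
    normc (ee x) * normc z <= 2 * normc (f x i0 1 0).
  have [h|h] := eqVneq (ee x) 0; first by exists 0.
  by have [z z1 z2] := small_root (f x i0 0 1) (f x i0 1 0) h; exists z.
have {hz} [z hz] := choice hz.
have ee_near : \forall x \near U, normc (A i0 1 1 - A i0 0 0) / 2 < normc (ee x).
  apply: near_gt (clim_normc ee_lim) _.
  by rewrite ltr_pdivrMr// ltr_pMr ?normc_gt0// ltr1n.
have z_lim : clim U z 0.
  set q := normc (A i0 1 1 - A i0 0 0) in ee_near.
  have q0 : 0 < q by rewrite normc_gt0.
  apply/clim_near => eps eps0; have /clim_near := fA i0 1 0; rewrite A10.
  have ep0 : 0 < eps * q / 4 by rewrite divr_gt0// mulr_gt0.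
  move=> /(_ _ ep0); apply: filterS2 ee_near => x h1; rewrite !subr0 => h2.
  have ex0 : ee x != 0 by rewrite -normc_gt0; apply: lt_trans h1; rewrite divr_gt0.
  have [_ h3] := hz x ex0.
  have : q / 2 * normc (z x) <= normc (ee x) * normc (z x).
    by rewrite ler_wpM2r ?normc_ge0// ltW.
  move=> h4; have h5 := le_trans h4 h3.
  rewrite -(ltr_pM2l (_ : 0 < q / 2)) ?divr_gt0//; lra.
(* in the basis given by L the eigenvector is the first axis *)
pose L (s : C) : 'M[C]_2 := mx2 1 0 s 1.
pose h x i : 'M[C]_2 := L (- z x) *m f x i *m L (z x).
have detL s : \det (L s) = 1 by rewrite det2E !mx2E; ring.
have LL s : L (- s) *m L s = 1%:M.
  by apply: mx2P; rewrite !mulmx2E !mx2E !mxE /=; ring.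
have LL' s : L s *m L (- s) = 1%:M by have := LL (- s); rewrite opprK.
have hA i : mlim U (h^~ i) (A i).
  have L0 : L 0 = 1%:M by apply: mx2P; rewrite !mx2E !mxE.
  have -> : A i = L (- 0) *m A i *m L 0 by rewrite oppr0 L0 mul1mx mulmx1.
  have Llim (s : X -> C) s0 : clim U s s0 -> mlim U (fun x => L (s x)) (L s0).
    move=> ss; apply: ord2P; apply: ord2P; rewrite mx2E;
      under eq_fun do rewrite mx2E; first [exact: ss|exact: clim_cst].
  apply: mlimM; last exact: Llim.
  by apply: mlimM; [apply: Llim; exact: climN|exact: fA].
have h_nd : \forall x \near U, nondegenerate (h x) by exact: near_nondegenerate hA And.
have lexp_h x : nondegenerate (h x) -> lexp p (h x) <= lexp p (f x).
  move=> hnd; apply: (@lexp_conj _ _ _ p_gt0 p_sum1 _ _ (L (z x))) => //.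
  - by rewrite detL oner_neq0.
  - by move=> i; have := hnd i; rewrite /h !det_mulmx !detL mul1r mulr1.
  by move=> i; rewrite /h !mulmxA LL' mul1mx.
have h10_i0 : \forall x \near U, h x i0 1 0 = 0.
  apply: filterS ee_near => x h1.
  have ex0 : ee x != 0.
    by rewrite -normc_gt0; apply: le_lt_trans h1; rewrite divr_ge0 ?normc_ge0.
  have [<- _] := hz x ex0.
  by rewrite /h !mulmx2E !mx2E /ee; ring.
pose r x := \sum_i normc (h x i 1 0).
have r_ge0 x : 0 <= r x by apply: sumr_ge0 => i _; exact: normc_ge0.
have le_r x i : normc (h x i 1 0) <= r x.
  by rewrite /r (bigD1 i)//= lerDl sumr_ge0// => j _; exact: normc_ge0.
have [r0|r0] := in_ultra_setVsetC [set x | r x = 0] UF.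
  (* the eigenvector is then fixed by the whole family *)
  have c0 x : r x = 0 -> forall i, h x i 1 0 = 0.
    move=> rx i; apply: eq0_normc; apply/eqP; rewrite eq_le normc_ge0 andbT.
    by rewrite -rx le_r.
  have md_lim : mean p (fun i => lnc (h x i 1 1)) @[x --> U] --> md.
    apply: (@cvg_sum _ _ U _ _ (index_enum I) (fun x i => p i * lnc (h x i 1 1))
      (fun i => p i * lnc (A i 1 1))) => i; apply: cvgMl_tmp.
    apply: cvg_ln; first by rewrite normc_gt0.
    exact: (clim_normc (hA i 1 1)).
  have lt_md : md - e < md by rewrite ltrBlDr ltrDl.
  have md_near := near_gt md_lim lt_md.
  near=> x.
  have hnd : nondegenerate (h x) by near: x; exact: h_nd.
  have rx : r x = 0 by near: x; exact: r0.
  apply: le_trans (lexp_h x hnd); rewrite lE.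
  apply: le_trans (_ : mean p (fun i => lnc (h x i 1 1)) <= _).
    by apply/ltW; near: x; exact: md_near.
  have hx0 i := c0 x rx i.
  have hdet i : \det (h x i) = h x i 0 0 * h x i 1 1 by rewrite det2E hx0 mulr0 subr0.
  have ha0 i : h x i 0 0 != 0 by apply: contraNneq (hnd i) => q; rewrite hdet q mul0r.
  have hd0 i : h x i 1 1 != 0 by apply: contraNneq (hnd i) => q; rewrite hdet q mulr0.
  have := lexp_tri_ge p_gt0 p_sum1 (fun i => h x i 0 1) ha0 hd0 1.
  congr (_ <= lexp p _); apply/funext => i.
  by apply: mx2P; rewrite !mx2E ?mul1r.
have rpos x : r x <> 0 -> 0 < r x by move=> /eqP rx; rewrite lt_def rx r_ge0.
pose rC x : C := (r x)%:C%C.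
have r_lim : clim U rC 0.
  have -> : 0 = (0 : R)%:C%C :> C by [].
  split => /=; last exact: cvg_cst.
  rewrite -[X in _ --> X](_ : \sum_i (normc (A i 1 0)) = 0); last first.
    by rewrite big1// => i _; rewrite A10 normc0.
  apply: (@cvg_sum _ _ U _ _ (index_enum I) (fun x i => normc (h x i 1 0))
    (fun i => normc (A i 1 0))) => i.
  exact: (clim_normc (hA i 1 0)).
(* conjugation by diag(1, r) blows up the lower left entries to total size 1 *)
pose k x i : 'M[C]_2 :=
  mx2 (h x i 0 0) (rC x * h x i 0 1) (h x i 1 0 / rC x) (h x i 1 1).
have c_lim i : exists l, clim U (fun x => h x i 1 0 / rC x) l.
  apply: (@bounded_ultra_lim _ _ U UF _ 1); apply: filterS r0 => x /rpos rx.
  rewrite normcM normcV normc_real ger0_norm ?r_ge0//.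
  by rewrite ler_pdivrMr// mul1r.
have {c_lim} [c c_lim] := choice c_lim.
pose B i : 'M[C]_2 := mx2 (A i 0 0) 0 (c i) (A i 1 1).
have kB i : mlim U (k^~ i) (B i).
  apply: ord2P; apply: ord2P; rewrite /k mx2E; under eq_fun do rewrite mx2E.
  - exact: hA.
  - by rewrite -(mul0r (A i 0 1)); apply: climM => //; exact: hA.
  - exact: c_lim.
  - exact: hA.
have detB i : \det (B i) = \det (A i) by rewrite detA det2E !mx2E mul0r subr0.
have B_nd : nondegenerate B by move=> i; rewrite detB.
have ldB : ldet p B = ldet p A.
  by apply: eq_bigr => i _; rewrite detB.
have ci0 : c i0 = 0.
  have h1 : clim U (fun x => h x i0 1 0 / rC x) 0.
    apply: (@clim_eq_near _ _ U _ (fun=> 0)); last exact: clim_cst.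
    by apply: filterS h10_i0 => x ->; rewrite mul0r.
  apply/eqP; rewrite -normc_eq0; apply/eqP.
  rewrite -(@normc0 R).
  exact: (real_cvg_unique (clim_normc (c_lim i0)) (clim_normc h1)).
have csum : \sum_i normc (c i) = 1.
  have h1 : \sum_i normc (h x i 1 0 / rC x) @[x --> U] --> \sum_i normc (c i).
    apply: (@cvg_sum _ _ U _ _ (index_enum I) (fun x i => normc (h x i 1 0 / rC x))
      (fun i => normc (c i))) => i.
    exact: clim_normc.
  have h2 : \sum_i normc (h x i 1 0 / rC x) @[x --> U] --> (1 : R).
    apply: cvg_near_cst; apply: filterS r0 => x /rpos rx.
    under eq_bigr do rewrite normcM normcV normc_real ger0_norm ?r_ge0//.
    by rewrite -mulr_suml divff// gt_eqF.
  exact: (real_cvg_unique h1 h2).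
have lB_le : lexp p B <= md.
  have e2 : vec 0 1 != 0 :> 'cV[C]_2.
    by rewrite -vnorm_gt0 /vnorm vec0E vec1E normc1 normc0 add0r.
  have Be i : B i *m vec 0 1 = A i 1 1 *: vec 0 1.
    by apply: cv2P; rewrite mulmx2E [RHS]mxE !vec0E !vec1E /B !mx2E; ring.
  have := lexp_line p_gt0 p_sum1 B_nd e2 Be; rewrite -/md ldB ldE addrK.
  by rewrite max_l// -lE ltW.
have lB_ge : md <= lexp p B.
  apply: (@lexp_ge_line _ _ _ p_gt0 p_sum1 B (vec 0 1) (fun i => A i 1 1)) => //.
    by rewrite -vnorm_gt0 /vnorm vec0E vec1E normc1 normc0 add0r.
  by move=> i; apply: cv2P; rewrite mulmx2E [RHS]mxE !vec0E !vec1E /B !mx2E; ring.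
have lB : lexp p B = md by apply/eqP; rewrite eq_le lB_le.
(* a second invariant line of B would be the first axis, by i0, against csum *)
have near1 : \forall x \near U, lexp p B - e <= lexp p (k x).
  apply: lexp_lsc_no_slow_line => //; first by rewrite ldB lB -lE.
  move=> u al u0 Bu; rewrite lB.
  have Bu0 i : A i 0 0 * u 0 0 = al i * u 0 0.
    by have := Bu i => /matrixP/(_ 0 0); rewrite mulmx2E !mx2E mul0r addr0 mxE.
  have Bu1 i : c i * u 0 0 + A i 1 1 * u 1 0 = al i * u 1 0.
    by have := Bu i => /matrixP/(_ 1 0); rewrite mulmx2E !mx2E mxE.
  have [u00|u00] := eqVneq (u 0 0) 0.
    have u10 : u 1 0 != 0.
      by apply: contra u0 => /eqP u10; apply/eqP/cv2P; rewrite mxE.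
    rewrite /md (_ : al = fun i => A i 1 1)//; apply/funext => i.
    by apply: (mulIf u10); rewrite -Bu1 u00 mulr0 add0r.
  have alE i : al i = A i 0 0 by apply: (mulIf u00); rewrite Bu0.
  have u10 : u 1 0 = 0.
    have := Bu1 i0; rewrite ci0 mul0r add0r alE => /eqP.
    by rewrite -subr_eq0 -mulrBl mulf_eq0 (negbTE e_neq0) => /eqP.
  have c0 i : c i = 0.
    by have := Bu1 i; rewrite u10 !mulr0 addr0 => /eqP; rewrite mulf_eq0 (negbTE u00) orbF => /eqP.
  have : \sum_i normc (c i) = 0 by apply: big1 => i _; rewrite c0 normc0.
  by rewrite csum => /eqP; rewrite oner_eq0.
have k_nd : \forall x \near U, nondegenerate (k x) by exact: near_nondegenerate kB B_nd.
near=> x.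
have hnd : nondegenerate (h x) by near: x; exact: h_nd.
have knd : nondegenerate (k x) by near: x; exact: k_nd.
have rx : 0 < r x by near: x; apply: filterS r0 => x /rpos.
have rC0 : rC x != 0 by rewrite -normc_eq0 normc_real normr_eq0 gt_eqF.
apply: le_trans (lexp_h x hnd); rewrite lE -lB.
apply: le_trans (_ : lexp p (k x) <= _); first by near: x; exact: near1.
apply: (@lexp_conj _ _ _ p_gt0 p_sum1 _ _ (mx2 1 0 0 (rC x))) => //.
  by rewrite det2E !mx2E mul1r mul0r subr0.
by move=> i; exact: mul_diag_rescaled.
Unshelve. all: by end_near.
Qed.

(** If the two exponents coincide, the determinant alone gives the bound. If they
    differ, either every invariant line is fast, or a slow one can be moved to the
    first axis. *)
Lemma lexp_lsc_ultra (f : X -> I -> 'M[C]_2) (A : I -> 'M[C]_2) (e : R) :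
  0 < e -> (forall i, mlim U (f^~ i) (A i)) -> nondegenerate A ->
  \forall x \near U, lexp p A - e <= lexp p (f x).
Proof.
move=> e0 fA And.
have f_nd := near_nondegenerate fA And.
have [gap|nogap] := ltP (ldet p A / 2) (lexp p A); last first.
  have lim : ldet p (f x) / 2 @[x --> U] --> ldet p A / 2.
    by apply: cvgMr_tmp; exact: cvg_ldet.
  have lt1 : ldet p A / 2 - e < ldet p A / 2 by rewrite ltrBlDr ltrDl.
  have lim_near := near_gt lim lt1.
  near=> x.
  have xnd : nondegenerate (f x) by near: x; exact: f_nd.
  have h : ldet p A / 2 - e < ldet p (f x) / 2 by near: x; exact: lim_near.
  have := ldet_le_lexp p_gt0 p_sum1 xnd; lra.
have [[u [a [u0 Au slow]]]|noline] := pselect (exists (u : 'cV[C]_2) (a : I -> C),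
    [/\ u != 0, forall i, A i *m u = a i *: u & mean p (fun i => lnc (a i)) < lexp p A]);
    last first.
  apply: lexp_lsc_no_slow_line => // u a u0 Au; rewrite leNgt; apply/negP => h.
  by apply: noline; exists u, a.
have [v uv] : exists v, wedge u v != 0.
  have [u00|u00] := eqVneq (u 0 0) 0.
    exists (vec 1 0); rewrite /wedge vec0E vec1E mulr0 mulr1 sub0r oppr_eq0.
    by apply: contra u0 => /eqP u10; apply/eqP/cv2P; rewrite mxE.
  by exists (vec 0 1); rewrite /wedge vec0E vec1E mulr1 mulr0 subr0.
pose P := frame u v.
have dP : \det P != 0 by rewrite det_frame.
have uP : P \in unitmx by rewrite unitmxE unitfE.
pose cj (M : I -> 'M[C]_2) i := invmx P *m M i *m P.
have cj_nd M : nondegenerate M -> nondegenerate (cj M).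
  by move=> Mnd i; rewrite /cj !det_mulmx det_inv !mulf_neq0// invr_eq0.
have cj_le M : nondegenerate M -> lexp p (cj M) <= lexp p M.
  move=> Mnd; apply: (@lexp_conj _ _ _ p_gt0 p_sum1 _ _ P) => //; first exact: cj_nd.
  by move=> i; rewrite /cj !mulmxA mulmxV// mul1mx.
have cj_ge M : nondegenerate M -> lexp p M <= lexp p (cj M).
  move=> Mnd; apply: (@lexp_conj _ _ _ p_gt0 p_sum1 _ _ (invmx P)) => //.
  - by rewrite det_inv invr_eq0.
  - exact: cj_nd.
  by move=> i; rewrite /cj -!mulmxA mulmxV// mulmx1.
have B0 i : cj A i *m vec 1 0 = a i *: vec 1 0.
  have Pe : P *m vec 1 0 = u by apply: cv2P; rewrite mulmx2E !mx2E vec0E vec1E; ring.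
  rewrite /cj -!mulmxA Pe Au -scalemxAr; congr (_ *: _).
  by rewrite -Pe mulmxA mulVmx// mul1mx.
have B00 i : cj A i 0 0 = a i.
  have := B0 i => /matrixP/(_ 0 0); rewrite mulmx2E vec0E vec1E !mxE /=.
  by rewrite !mulr1 mulr0 addr0.
have B10 i : cj A i 1 0 = 0.
  have := B0 i => /matrixP/(_ 1 0); rewrite mulmx2E vec0E vec1E !mxE /=.
  by rewrite mulr1 !mulr0 addr0.
have fcj i : mlim U (fun x => cj (f x) i) (cj A i).
  by apply: mlimM; [apply: mlimM; [exact: mlim_cst|exact: fA]|exact: mlim_cst].
have := @lexp_lsc_upper (fun x => cj (f x)) (cj A) e e0 fcj (cj_nd _ And) B10.
have -> : mean p (fun i => lnc (cj A i 0 0)) = mean p (fun i => lnc (a i)).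
  by apply: eq_bigr => i _; rewrite B00.
move=> /(_ (lt_le_trans slow (cj_ge _ And))).
move=> h0; near=> x.
have xnd : nondegenerate (f x) by near: x; exact: f_nd.
apply: le_trans (cj_le _ xnd).
apply: le_trans (_ : lexp p (cj A) - e <= _); first by rewrite lerD2r cj_ge.
by near: x; exact: h0.
Unshelve. all: by end_near.
Qed.

End Ultra.

(** Bocker and Viana's theorem, for fixed positive weights. Upper semicontinuity
    is that of an infimum of continuous functions; lower semicontinuity is tested
    along the ultrafilters finer than [F]. *)
Theorem lexp_continuous (X : Type) (F : set_system X) {FF : Filter F}
    (f : X -> I -> 'M[C]_2) (A : I -> 'M[C]_2) :
  (forall i, mlim F (f^~ i) (A i)) -> nondegenerate A ->
  lexp p (f x) @[x --> F] --> lexp p A.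
Proof.
move=> fA And; apply/cvgrPdist_le => e e0.
have f_nd := near_nondegenerate fA And.
have upper : \forall x \near F, lexp p (f x) <= lexp p A + e.
  have [n n0 hn] := lexp_approx p_gt0 p_sum1 And e0.
  have g_near := near_lt (cvg_growth (n := n) (p := p) fA And) hn.
  near=> x.
  have xnd : nondegenerate (f x) by near: x; exact: f_nd.
  have h : growth p (f x) n < n%:R * (lexp p A + e) by near: x; exact: g_near.
  have := le_lt_trans (lexp_le p_gt0 p_sum1 xnd n0) h.
  by rewrite ltr_pM2l ?ltr0n// => /ltW.
have lower : \forall x \near F, lexp p A - e <= lexp p (f x).
  apply: contrapT => nF.
  pose S := [set x | ~ (lexp p A - e <= lexp p (f x))].
  have WP : ProperFilter (within S F).
    split; last exact: within_filter.
    move=> h; apply: nF; have {}h : F [set x | S x -> False] by exact: h.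
    by apply: filterS h => x /= hx; exact: contrapT.
  have [U [UU WU]] := ultraFilterLemma WP.
  have PU : ProperFilter U by exact: ultra_proper.
  have FU i : mlim U (f^~ i) (A i).
    have FsU : F `<=` U by move=> B FB; apply: WU; apply: filterS FB.
    move=> j l; have [h1 h2] := fA i j l.
    by split => B HB; apply: FsU; [exact: h1|exact: h2].
  have h1 := lexp_lsc_ultra e0 FU And.
  have h2 : \forall x \near U, S x by apply: WU; exact: (@nearW _ F).
  have /filter_ex[x [h3]] : U ([set x | lexp p A - e <= lexp p (f x)] `&` S).
    have UF : Filter U by exact: filter_filter.
    by apply: filterI; [exact: h1|exact: h2].
  exact.
near=> x.
have h1 : lexp p (f x) <= lexp p A + e by near: x; exact: upper.
have h2 : lexp p A - e <= lexp p (f x) by near: x; exact: lower.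
rewrite distrC ler_distl; apply/andP; split; lra.
Unshelve. all: by end_near.
Qed.

End BlowUp.

(** * Lebesgue measure on the plane *)

Section PlaneMeasure.
Context {R : realType}.
Local Notation R2 := (measurableTypeR R * measurableTypeR R)%type.

(** An open set is a countable union of boxes with rational vertices, which are
    measurable rectangles. *)
Lemma open_measurable_plane (A : set (R * R)) : open A -> @measurable _ R2 A.
Proof.
move=> oA.
pose box (q : rat * rat * (rat * rat)) : set (R * R) :=
  `]ratr q.1.1, ratr q.1.2[%classic `*` `]ratr q.2.1, ratr q.2.2[%classic.
have mbox q : @measurable _ R2 (box q) by apply: measurableX; exact: measurable_itv.
pose B (n : nat) := if @choice.unpickle (rat * rat * (rat * rat))%type n is Some q then
  (if `[< box q `<=` A >] then box q else set0) else set0.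
have -> : A = \bigcup_n B n.
  apply/seteqP; split=> [z Az|z [n _]]; last first.
    by rewrite /B; case: choice.unpickle => // q; case: asboolP => // qA /qA.
  have : nbhs z A by apply: open_nbhs_nbhs.
  move=> /nbhs_ballP[e /= e0 zA].
  have lo x : x - e < x by rewrite ltrBlDr ltrDl.
  have hi x : x < x + e by rewrite ltrDl.
  have [q1 q1z] := rat_in_itvoo (lo z.1); have [q2 q2z] := rat_in_itvoo (hi z.1).
  have [q3 q3z] := rat_in_itvoo (lo z.2); have [q4 q4z] := rat_in_itvoo (hi z.2).
  pose q := (q1, q2, (q3, q4)).
  move: q1z q2z q3z q4z; rewrite !in_itv /= => /andP[? ?] /andP[? ?] /andP[? ?] /andP[? ?].
  exists (choice.pickle q); first exact: I.
  rewrite /B choice.pickleK; case: asboolP => [_|[]].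
    by split => /=; rewrite in_itv /=; apply/andP; split; lra.
  move=> w [/=]; rewrite !in_itv /= => /andP[? ?] /andP[? ?].
  by apply: zA; split => /=; rewrite /ball /= ltr_distlC; apply/andP; split; lra.
apply: bigcupT_measurable => n; rewrite /B; case: choice.unpickle => // q.
by case: ifP.
Qed.

Lemma continuous_measurable_plane (f : R * R -> R) :
  continuous f -> @measurable_fun _ _ R2 _ setT f.
Proof.
move=> cf; apply: (measurability _ (RGenOpens.measurableE R)).
move=> /= _ [_ [a [b ->]] <-]; rewrite setTI; apply: open_measurable_plane.
by move/continuousP : cf; apply; exact: interval_open.
Qed.

Lemma usc_measurable_plane (f : R * R -> \bar R) :
  upper_semicontinuous setT f -> @measurable_fun _ _ R2 _ setT f.
Proof.
move=> uf; apply: (measurability _ (ErealGenInftyO.measurableE R)).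
move=> /= _ [_ [a ->] <-]; rewrite setTI; apply: open_measurable_plane.
rewrite openE => z; rewrite /= in_itv /= => fz.
have [_ /(_ a fz)] := uf z I; apply: filterS => w fw.
by rewrite /= in_itv.
Qed.

Lemma lebesgue2X (A B : set (measurableTypeR R)) : measurable A -> measurable B ->
  lebesgue2 (A `*` B) = (lebesgue_measure A * lebesgue_measure B)%E.
Proof. by move=> mA mB; rewrite /lebesgue2 product_measure1E. Qed.

Definition shift1 (a : R) : measurableTypeR R -> measurableTypeR R := fun x => x + a.

Lemma measurable_shift1 a : measurable_fun setT (shift1 a).
Proof. by apply: measurable_funD. Qed.

(** Translates of Lebesgue measure agree with it on intervals. *)
Lemma lebesgue_measure_shift (a : R) (A : set (measurableTypeR R)) : measurable A ->
  lebesgue_measure (shift1 a @^-1` A) = lebesgue_measure A.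
Proof.
move=> mA; have ms := measurable_shift1 a.
pose nu0 : {measure set (measurableTypeR R) -> \bar R} :=
  [the measure _ _ of pushforward lebesgue_measure (shift1 a)].
pose nu := nu0 ms.
suff : lebesgue_measure A = nu A by move=> ->.
apply: (lebesgue_measure_unique _ mA) => // _ [[u v] _ <-].
rewrite /nu /nu0 /= /pushforward.
have -> : shift1 a @^-1` `]u, v]%classic = `]u - a, v - a]%classic.
  apply/seteqP; split=> x /=; rewrite /shift1 !in_itv /= => /andP[? ?];
    apply/andP; split; lra.
rewrite !lebesgue_measure_itv /= !lte_fin ltrD2r; case: ifP => // _.
by rewrite -!EFinB; congr EFin; ring.
Qed.

Definition shift2 (a b : R) : R2 -> R2 := fun z => (z.1 + a, z.2 + b).

Lemma measurable_shift2 a b : measurable_fun setT (shift2 a b).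
Proof.
apply/measurable_fun_pairP; split; apply: measurable_funD => //.
Qed.

Lemma lebesgue2_shift a b (A : set R2) : measurable A ->
  lebesgue2 (shift2 a b @^-1` A) = lebesgue2 A.
Proof.
move=> mA; have ms := measurable_shift2 a b.
pose nu0 : {measure set R2 -> \bar R} :=
  [the measure _ _ of pushforward lebesgue2 (shift2 a b)].
pose nu := nu0 ms.
suff : lebesgue2 A = nu A by move=> ->.
apply: (@product_measure_unique _ _ _ _ R lebesgue_measure lebesgue_measure nu) => //.
move=> B C mB mC; rewrite /nu /nu0 /= /pushforward.
have -> : shift2 a b @^-1` (B `*` C) = (shift1 a @^-1` B) `*` (shift1 b @^-1` C).
  by apply/seteqP; split.
have m1 : measurable (shift1 a @^-1` B) by rewrite -[X in measurable X]setTI; exact: measurable_shift1.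
have m2 : measurable (shift1 b @^-1` C) by rewrite -[X in measurable X]setTI; exact: measurable_shift1.
by rewrite lebesgue2X// !lebesgue_measure_shift.
Qed.

Lemma integral_shift a b (f : R2 -> \bar R) : measurable_fun setT f ->
  lebesgue2.-integrable setT (f \o shift2 a b) ->
  (\int[lebesgue2]_z f (shift2 a b z) = \int[lebesgue2]_z f z)%E.
Proof.
move=> mf intf; have ms := measurable_shift2 a b.
have := @integral_pushforward _ _ R2 R2 R (shift2 a b) ms lebesgue2 setT f mf intf measurableT.
rewrite preimage_setT => <-.
by apply: eq_measure_integral => A mA _; exact: lebesgue2_shift.
Qed.

Definition box (r : R) : set R2 := `[- r, r]%classic `*` `[- r, r]%classic.

Lemma measurable_box r : measurable (box r).
Proof. by apply: measurableX; exact: measurable_itv. Qed.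

Lemma lebesgue2_box r : 0 <= r -> lebesgue2 (box r) = (4 * r ^+ 2)%:E.
Proof.
move=> r0; rewrite lebesgue2X; try exact: measurable_itv.
rewrite !lebesgue_measure_itv /= lte_fin; case: ltP => h.
  by rewrite -EFinB -EFinM; congr EFin; ring.
have -> : r = 0 by lra.
by rewrite mule0 expr0n mulr0.
Qed.

Lemma integrable_bounded_box (f : R2 -> \bar R) (K r : R) : measurable_fun setT f ->
  (forall z, `|f z| <= (K * \1_(box r) z)%:E)%E -> lebesgue2.-integrable setT f.
Proof.
move=> mf fK; have mb := measurable_box r.
have ib : lebesgue2.-integrable setT (EFin \o (fun z => K * \1_(box r) z)).
  have -> : EFin \o (fun z => K * \1_(box r) z) = (fun z => K%:E * (\1_(box r) z)%:E)%E.
    by apply/funext => z /=; rewrite EFinM.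
  apply: integrableZl => //; apply/integrableP; split; first exact/measurable_EFinP.
  rewrite (eq_integral (fun z => (\1_(box r) z)%:E)); last first.
    by move=> t _; rewrite gee0_abs// lee_fin.
  rewrite integral_indic// setIT.
  have [r0|r0] := leP 0 r; first by apply: (@le_lt_trans _ _ (4 * r ^+ 2)%:E); rewrite ?ltry// -lebesgue2_box.
  rewrite (_ : box r = set0) ?measure0//.
  by apply/seteqP; split=> // z [/=]; rewrite !in_itv /= => /andP[? ?]; lra.
apply: le_integrable ib => // z _ /=.
apply: le_trans (fK z) _; rewrite lee_fin; exact: ler_norm.
Qed.

End PlaneMeasure.

(** * Second differences *)

Section SecondDifference.
Context {R : realType}.
Implicit Types (phi : R * R -> R) (z v : R * R).

Lemma line_quotient phi z v (s : R) :
  (fun h => h^-1 *: (((fun s => phi (z + s *: v)) \o shift s) (h *: (1 : R)) -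
     (fun s => phi (z + s *: v)) s)) =
  (fun h => h^-1 *: ((phi \o shift (z + s *: v)) (h *: v) - phi (z + s *: v))).
Proof.
apply/funext => h /=; congr (_ *: (phi _ - _)).
have -> : h *: (1 : R) = h by rewrite /GRing.scale /= mulr1.
by rewrite scalerDl addrCA.
Qed.

Lemma is_derive_line phi z v (s : R) : differentiable phi (z + s *: v) ->
  is_derive s 1 (fun s => phi (z + s *: v)) ('D_v phi (z + s *: v)).
Proof.
move=> df; apply: DeriveDef.
  by rewrite /derivable line_quotient; exact: (diff_derivable (v := v) df).
by rewrite /derive line_quotient.
Qed.

Lemma is_derive_lineN phi z v (s : R) : differentiable phi (z - s *: v) ->
  is_derive s 1 (fun s => phi (z - s *: v)) (- 'D_v phi (z - s *: v)).
Proof.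
move=> df.
have eqN : (fun s => phi (z - s *: v)) = (fun s => phi (z + s *: (- v))).
  by apply/funext => t; rewrite scalerN.
have df' : differentiable phi (z + s *: (- v)) by rewrite scalerN.
rewrite eqN; have h := is_derive_line df'.
apply: is_derive_eq h _.
by rewrite scalerN !deriveE// linearN.
Qed.

(** Mean value form of the second difference quotient. *)
Lemma second_difference phi z v (r : R) : 0 < r ->
  (forall w, differentiable phi w) -> (forall w, differentiable ('D_v phi) w) ->
  exists2 xi, `|xi| <= r &
    `|phi (z + r *: v) + phi (z - r *: v) - 2 * phi z - r ^+ 2 * 'D_v ('D_v phi) z|
      <= 2 * r ^+ 2 * `|'D_v ('D_v phi) (z + xi *: v) - 'D_v ('D_v phi) z|.
Proof.
move=> r0 dphi ddphi.
set D2 := 'D_v ('D_v phi).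
pose h (s : R) := phi (z + s *: v) + phi (z - s *: v) - s ^+ 2 * D2 z.
have dh (s : R) : is_derive s 1 h
    ('D_v phi (z + s *: v) - 'D_v phi (z - s *: v) - 2 * s * D2 z).
  have i1 := is_derive_line (dphi (z + s *: v)).
  have i2 := is_derive_lineN (dphi (z - s *: v)).
  have i3 : is_derive s 1 (fun s : R => s ^+ 2 * D2 z) (2 * s * D2 z).
    by apply: is_derive_eq; rewrite /GRing.scale /= !mulr1 mulr0 add0r; ring.
  exact: is_deriveB.
have cont (f df : R -> R) (a b : R) : (forall s : R, is_derive s (1 : R) f (df s)) ->
    {within `[a, b], continuous f}.
  move=> dfs; apply: derivable_within_continuous => s _.
  by have [] := dfs s.
have [c] := MVT r0 (fun s _ => dh s) (cont _ _ _ _ dh).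
rewrite in_itv /= => /andP[c0 cr].
rewrite /h scale0r addr0 subr0 expr0n mul0r !subr0 => hE.
pose k (s : R) := 'D_v phi (z + s *: v).
have dk (s : R) : is_derive s 1 k (D2 (z + s *: v)).
  exact: is_derive_line (ddphi _).
have cc : - c < c by lra.
have [xi] := MVT cc (fun s _ => dk s) (cont _ _ _ _ dk).
rewrite in_itv /= => /andP[xi1 xi2]; rewrite /k scaleNr => kE.
exists xi.
  rewrite ler_norml (ltW (lt_trans xi2 cr)) andbT ltW//.
  by apply: lt_trans xi1; rewrite ltrN2.
have -> : phi (z + r *: v) + phi (z - r *: v) - 2 * phi z - r ^+ 2 * D2 z =
    2 * c * r * (D2 (z + xi *: v) - D2 z).
  move: hE kE; move: (phi (z + r *: v)) (phi (z - r *: v)) (phi z).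
  move: ('D_v phi (z + c *: v)) ('D_v phi (z - c *: v)) (D2 (z + xi *: v)) (D2 z).
  move=> A1 A2 X Y P1 P2 P0 hE kE.
  transitivity ((A1 - A2 - 2 * c * Y) * r); first by rewrite -hE; ring.
  by rewrite kE; ring.
rewrite normrM ler_wpM2r// ger0_norm; last by rewrite !mulr_ge0// ltW.
by rewrite expr2 mulrA ler_pM2r// ler_pM2l// ltW.
Qed.

End SecondDifference.

(** * The four-point inequality *)

Section WeakInequality.
Context {R : realType}.
Local Notation R2 := (measurableTypeR R * measurableTypeR R)%type.
Implicit Types (f g u phi : R * R -> R) (h z : R * R).

Let e1 : R * R := (1, 0).
Let e2 : R * R := (0, 1).

Lemma continuous_bounded_box f (r : R) : continuous f ->
  exists2 K, 0 <= K & forall z, box r z -> `|f z| <= K.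
Proof.
move=> cf.
have cb : compact (box r : set (R * R)).
  by apply: compact_setX; exact: segment_compact.
have : compact (f @` (box r : set (R * R))).
  apply: continuous_compact cb; exact: continuous_subspaceT.
move=> /compact_bounded[M [_ hM]].
exists (`|M| + 1); first by rewrite addr_ge0.
move=> z bz; apply: (hM (`|M| + 1)); last by exists z.
by rewrite (le_lt_trans (ler_norm M))// ltrDl.
Qed.

Definition bounded_support f := exists r, forall z, ~ box r z -> f z = 0.

Lemma box_le (r s : R) z : r <= s -> box r z -> box s z.
Proof.
move=> rs [/=]; rewrite !in_itv /= => /andP[? ?] /andP[? ?].
by split; rewrite /= in_itv /=; apply/andP; split; lra.
Qed.

Lemma integrable_continuous f : continuous f -> bounded_support f ->
  lebesgue2.-integrable setT (EFin \o f : R2 -> \bar R).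
Proof.
move=> cf [r fr]; have [K K0 fK] := continuous_bounded_box r cf.
apply: (@integrable_bounded_box _ _ K r).
  by apply/measurable_EFinP; exact: continuous_measurable_plane.
move=> z; rewrite /= lee_fin indicE; case: (boolP (z \in box r)) => bz.
  by rewrite mulr1 fK//; exact: set_mem.
by rewrite fr ?normr0 ?mulr0//; move/negP: bz => h /mem_set.
Qed.

Local Notation J f := (\int[lebesgue2 : {measure set R2 -> \bar R}]_z (f z)).

Lemma continuousD_plane f g : continuous f -> continuous g ->
  continuous (fun z => f z + g z).
Proof. by move=> cf cg z; apply: cvgD; [exact: cf|exact: cg]. Qed.

Lemma continuousM_plane f g : continuous f -> continuous g ->
  continuous (fun z => f z * g z).
Proof. by move=> cf cg z; apply: cvgM; [exact: cf|exact: cg]. Qed.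

Lemma continuous_translate f h : continuous f -> continuous (fun z => f (z + h)).
Proof.
move=> cf z; apply: (@cvg_comp _ _ _ (fun z => z + h) f); last exact: cf.
by apply: cvgD; [exact: cvg_id|exact: cvg_cst].
Qed.

Lemma bounded_supportM f g : bounded_support g -> bounded_support (fun z => f z * g z).
Proof. by move=> [r gr]; exists r => z bz; rewrite gr ?mulr0. Qed.

Lemma bounded_support_translate f h :
  bounded_support f -> bounded_support (fun z => f (z + h)).
Proof.
move=> [r fr]; exists (`|r| + `|h.1| + `|h.2|) => z bz; apply: fr => bzh; apply: bz.
move: bzh => [/=]; rewrite !in_itv /= => /andP[a1 a2] /andP[a3 a4].
have b1 := ler_norm h.1; have b2 := ler_norm (- h.1); rewrite normrN in b2.
have b3 := ler_norm h.2; have b4 := ler_norm (- h.2); rewrite normrN in b4.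
have b5 := ler_norm r.
have b6 := normr_ge0 h.1; have b7 := normr_ge0 h.2.
move: a1 a2 a3 a4.
move: `|h.1| `|h.2| `|r| h.1 h.2 b1 b2 b3 b4 b5 b6 b7 => H1 H2 r' h1 h2.
by move=> b1 b2 b3 b4 b5 b6 b7 a1 a2 a3 a4; split; rewrite /= in_itv /=;
  apply/andP; split; lra.
Qed.

Lemma Rintegral_translate f h : continuous f -> bounded_support f ->
  J (fun z => f (z + h)) = J f.
Proof.
move=> cf bf; rewrite /Rintegral; congr fine.
have := @integral_shift R h.1 h.2 (EFin \o f).
rewrite /= /shift2; case: h => a b /=; apply.
  by apply/measurable_EFinP; exact: continuous_measurable_plane.
apply: (@integrable_continuous (fun z => f (z + (a, b)))).
  exact: continuous_translate.
exact: bounded_support_translate.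
Qed.

Definition four_point u z (r : R) : R :=
  u (z + r *: e1) + u (z - r *: e1) + u (z + r *: e2) + u (z - r *: e2).

(** A discrete form of subharmonicity, stable under maxima: the mean over four
    neighbours at distance [r] falls below the value by at most O(r^3). *)
Definition submean u := continuous u /\ forall rho : R,
  exists2 c : R, 0 <= c & exists2 r0 : R, 0 < r0 & forall z (r : R), box rho z -> 0 < r < r0 ->
    4 * u z - c * r ^+ 3 <= four_point u z r.

Lemma J_sum4 f1 f2 f3 f4 :
  continuous f1 -> continuous f2 -> continuous f3 -> continuous f4 ->
  bounded_support f1 -> bounded_support f2 -> bounded_support f3 -> bounded_support f4 ->
  J (fun z => f1 z + f2 z + f3 z + f4 z) = J f1 + J f2 + J f3 + J f4.
Proof.
move=> c1 c2 c3 c4 b1 b2 b3 b4.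
have bD f g : bounded_support f -> bounded_support g -> bounded_support (fun z => f z + g z).
  move=> [r fr] [s gs]; exists (Num.max r s) => z bz.
  rewrite fr ?gs ?addr0// => h; apply: bz; apply: box_le h; rewrite le_max lexx ?orbT//.
have c12 := continuousD_plane c1 c2; have c123 := continuousD_plane c12 c3.
have b12 := bD _ _ b1 b2; have b123 := bD _ _ b12 b3.
have i1 := integrable_continuous c1 b1; have i2 := integrable_continuous c2 b2.
have i3 := integrable_continuous c3 b3; have i4 := integrable_continuous c4 b4.
have i12 := integrable_continuous c12 b12; have i123 := integrable_continuous c123 b123.
by rewrite !RintegralD.
Qed.

(** Translation invariance moves the four translations from [phi] to [u]. *)
Lemma four_point_symmetric u phi (r : R) : continuous u -> continuous phi ->
  bounded_support phi ->
  J (fun z => u z * four_point phi z r) = J (fun z => four_point u z r * phi z).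
Proof.
move=> cu cp bp.
have cM h : continuous (fun z => u z * phi (z + h)).
  by apply: continuousM_plane => //; exact: continuous_translate.
have cM' h : continuous (fun z => u (z + h) * phi z).
  by apply: continuousM_plane => //; exact: continuous_translate.
have bM h : bounded_support (fun z => u z * phi (z + h)).
  by apply: (@bounded_supportM u (fun z => phi (z + h))); exact: bounded_support_translate.
have bM' h : bounded_support (fun z => u (z + h) * phi z).
  exact: (@bounded_supportM (fun z => u (z + h)) phi).
have sh h : J (fun z => u z * phi (z + h)) = J (fun z => u (z - h) * phi z).
  rewrite -(@Rintegral_translate (fun z => u (z - h) * phi z) h) //.
  by apply: eq_Rintegral => z _; rewrite addrK.
transitivity (J (fun z => u z * phi (z + r *: e1)) + J (fun z => u z * phi (z - r *: e1))
   + J (fun z => u z * phi (z + r *: e2)) + J (fun z => u z * phi (z - r *: e2))).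
  by rewrite -J_sum4//; apply: eq_Rintegral => z _; rewrite !mulrDr.
rewrite !sh !opprK.
rewrite -J_sum4//; apply: eq_Rintegral => z _; rewrite /four_point !mulrDl.
by rewrite [_ + u (z + r *: e1) * _]addrC -!addrA [u (z - r *: e2) * _ + _]addrC.
Qed.

End WeakInequality.

(** * From the four-point inequality to the distributional Laplacian *)

Section SubmeanWeak.
Context {R : realType}.
Local Notation R2 := (measurableTypeR R * measurableTypeR R)%type.
Implicit Types (f g u phi : R * R -> R) (h z : R * R).
Local Notation e1 := ((1, 0) : R * R).
Local Notation e2 := ((0, 1) : R * R).
Local Notation J f := (\int[lebesgue2 : {measure set R2 -> \bar R}]_z (f z)).

Lemma compact_in_box (K : set (R * R)) : compact K -> exists r, forall z, K z -> box r z.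
Proof.
move=> cK.
have bnd f : continuous f -> exists M, forall z, K z -> `|f z| <= M.
  move=> cf; have : compact (f @` K).
    apply: continuous_compact cK; exact: continuous_subspaceT.
  move=> /compact_bounded[M [_ hM]]; exists (`|M| + 1) => z Kz.
  apply: (hM (`|M| + 1)); last by exists z.
  by rewrite (le_lt_trans (ler_norm M))// ltrDl.
have [|M1 h1] := bnd fst; first by move=> z; exact: cvg_fst.
have [|M2 h2] := bnd snd; first by move=> z; exact: cvg_snd.
exists (Num.max M1 M2) => z Kz; split; rewrite /= in_itv /= -ler_norml le_max.
  by rewrite h1.
by rewrite h2 ?orbT.
Qed.

Lemma test_function_support phi : test_function setT phi ->
  exists r, forall z, ~ box r z ->
    [/\ phi z = 0, 'D_e1 ('D_e1 phi) z = 0 & 'D_e2 ('D_e2 phi) z = 0].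
Proof.
move=> [_ cK _]; have [r hr] := compact_in_box cK; exists r => z bz.
have nz : ~ tsupport phi z by move=> /hr.
have near0 : \forall w \near z, phi w = 0.
  have oC : open (~` tsupport phi).
    by apply: closed_openC; exact: closed_closure.
  have : nbhs z (~` tsupport phi) by apply: open_nbhs_nbhs.
  apply: filterS => w nw; apply/eqP; apply: contrapT => /negP pw; apply: nw.
  exact: subset_closure.
have D0 v : 'D_v ('D_v phi) z = 0.
  have near1 : \forall w \near z, 'D_v phi w = (cst 0 : R * R -> R) w.
    have : \forall w \near z, \forall w' \near w, phi w' = 0 by apply: near_join near0.
    apply: filterS => w nw.
    rewrite (near_eq_derive v (g := cst 0))//.
    by rewrite derive_cst.
  by rewrite (near_eq_derive v near1) derive_cst.
by split; [exact: nbhs_singleton near0|exact: D0|exact: D0].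
Qed.

Lemma test_function_continuous phi : test_function setT phi ->
  [/\ forall w, differentiable phi w,
    forall v w, differentiable ('D_v phi) w &
    forall v, continuous ('D_v ('D_v phi))].
Proof.
move=> [sm _ _]; split.
- by move=> w; exact: (sm [::] w).
- by move=> v w; exact: (sm [:: v] w).
- by move=> v w; apply: differentiable_continuous; exact: (sm [:: v; v] w).
Qed.

Definition diff4 phi (r : R) z := (four_point phi z r - 4 * phi z) / r ^+ 2.

Lemma second_difference_add (A B C D P L1 L2 X1 X2 r : R) : 0 < r ->
  `|A + B - 2 * P - r ^+ 2 * L1| <= 2 * r ^+ 2 * `|X1 - L1| ->
  `|C + D - 2 * P - r ^+ 2 * L2| <= 2 * r ^+ 2 * `|X2 - L2| ->
  `|(A + B + C + D - 4 * P) / r ^+ 2 - (L1 + L2)| <= 2 * `|X1 - L1| + 2 * `|X2 - L2|.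
Proof.
move=> r0 h1 h2; have r20 : 0 < r ^+ 2 by rewrite exprn_gt0.
have -> : (A + B + C + D - 4 * P) / r ^+ 2 - (L1 + L2) =
  ((A + B - 2 * P - r ^+ 2 * L1) + (C + D - 2 * P - r ^+ 2 * L2)) / r ^+ 2.
  by field; rewrite gt_eqF.
rewrite normrM normfV (gtr0_norm r20) ler_pdivrMr//.
apply: le_trans (ler_normD _ _) _; lra.
Qed.

Lemma diff4_laplacian phi (r : R) z : test_function setT phi -> 0 < r ->
  exists2 xi : R * R, `|xi.1| <= r /\ `|xi.2| <= r &
  `|diff4 phi r z - laplacian phi z| <=
    2 * `|'D_e1 ('D_e1 phi) (z + xi.1 *: e1) - 'D_e1 ('D_e1 phi) z| +
    2 * `|'D_e2 ('D_e2 phi) (z + xi.2 *: e2) - 'D_e2 ('D_e2 phi) z|.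
Proof.
move=> tf r0; have [d0 d1 _] := test_function_continuous tf.
have [x1 hx1 h1] := second_difference z r0 d0 (d1 e1).
have [x2 hx2 h2] := second_difference z r0 d0 (d1 e2).
exists (x1, x2) => //=.
exact: second_difference_add r0 h1 h2.
Qed.

End SubmeanWeak.

Section SubmeanWeakTheorem.
Context {R : realType}.
Local Notation R2 := (measurableTypeR R * measurableTypeR R)%type.
Implicit Types (f g u phi : R * R -> R) (h z : R * R).
Local Notation e1 := ((1, 0) : R * R).
Local Notation e2 := ((0, 1) : R * R).
Local Notation J f := (\int[lebesgue2 : {measure set R2 -> \bar R}]_z (f z)).

(** The second derivatives are abstracted into two functions [D1] and [D2]: their
    continuity and bounded support are what the convergence of the difference
    quotients rests on. *)
Lemma test_function_derivatives phi : test_function setT phi ->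
  exists D1 D2 : R * R -> R, exists rho : R, [/\ continuous phi,
    continuous D1 /\ continuous D2, forall z, laplacian phi z = D1 z + D2 z,
    forall z, ~ box rho z -> [/\ phi z = 0, D1 z = 0 & D2 z = 0] &
    forall r z, 0 < r -> exists2 xi : R * R, `|xi.1| <= r /\ `|xi.2| <= r &
    `|diff4 phi r z - laplacian phi z| <=
      2 * `|D1 (z + xi.1 *: e1) - D1 z| + 2 * `|D2 (z + xi.2 *: e2) - D2 z|].
Proof.
move=> tf; have [d0 d1 c2] := test_function_continuous tf.
have [rho hrho] := test_function_support tf.
exists ('D_e1 ('D_e1 phi)), ('D_e2 ('D_e2 phi)), rho; split.
- by move=> z; apply: differentiable_continuous; exact: d0.
- by split; [exact: c2 e1|exact: c2 e2].
- by move=> z; exact: erefl.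
- exact: hrho.
- by move=> r z; exact: diff4_laplacian.
Qed.

Lemma continuous_four_point u (r : R) : continuous u ->
  continuous (fun z => four_point u z r).
Proof.
move=> cu; apply: continuousD_plane; last exact: (@continuous_translate R u (- (r *: e2)) cu).
apply: continuousD_plane; last exact: (@continuous_translate R u (r *: e2) cu).
apply: continuousD_plane; last exact: (@continuous_translate R u (- (r *: e1)) cu).
exact: (@continuous_translate R u (r *: e1) cu).
Qed.

(** Replace the Laplacian of the test function by its second difference quotient
    with step [r], and move the differences to [u]: the four-point inequality
    bounds the integral below by a multiple of [- r]. Then let [r] tend to 0. *)
Theorem submean_weakly_subharmonic u phi : submean u -> test_function setT phi ->
  (forall z, 0 <= phi z) -> (0 <= \int[lebesgue2]_z (u z * laplacian phi z)%:E)%E.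
Proof.
move=> [cu su] tf phi0.
have [D1 [D2 [rho [cphi [cD1 cD2] lapE hrho d4lap]]]] := test_function_derivatives tf.
have bphi : bounded_support phi by exists rho => z /hrho[].
have [K1 K10 hK1] : exists2 K, 0 <= K & forall z, `|D1 z| <= K.
  have [K K0 hK] := continuous_bounded_box rho cD1; exists K => // z.
  by have [/hK//|/hrho[_ h _]] := pselect (box rho z); rewrite h normr0.
have [K2 K20 hK2] : exists2 K, 0 <= K & forall z, `|D2 z| <= K.
  have [K K0 hK] := continuous_bounded_box rho cD2; exists K => // z.
  by have [/hK//|/hrho[_ _ h]] := pselect (box rho z); rewrite h normr0.
have clap : continuous (laplacian phi).
  have -> : laplacian phi = fun w => D1 w + D2 w by apply/funext => w; exact: lapE.
  exact: continuousD_plane.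
pose L n := diff4 phi n.+1%:R^-1.
have rn0 n : 0 < n.+1%:R^-1 :> R by rewrite invr_gt0.
have rn1 n : n.+1%:R^-1 <= 1 :> R by rewrite invf_le1// ler1n.
have Lbound n z : `|L n z| <= 5 * (K1 + K2).
  have [xi _ h] := d4lap _ z (rn0 n).
  rewrite lapE in h.
  have h1 := ler_normB (D1 (z + xi.1 *: e1)) (D1 z).
  have h2 := ler_normB (D2 (z + xi.2 *: e2)) (D2 z).
  have h3 := ler_normD (diff4 phi n.+1%:R^-1 z - (D1 z + D2 z)) (D1 z + D2 z).
  rewrite subrK in h3; have h4 := ler_normD (D1 z) (D2 z).
  have h5 := hK1 z; have h6 := hK2 z.
  have h7 := hK1 (z + xi.1 *: e1); have h8 := hK2 (z + xi.2 *: e2).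
  rewrite /L; apply: le_trans h3 _; clear -h h1 h2 h4 h5 h6 h7 h8; lra.
have Lsupp n z : ~ box (rho + 1) z -> L n z = 0.
  move=> bz; have far h : `|h.1| <= 1 -> `|h.2| <= 1 -> phi (z + h) = 0.
    rewrite !ler_norml => /andP[a1 a2] /andP[a3 a4].
    have [bzh|/hrho[]//] := pselect (box rho (z + h)).
    case: bz; move: bzh => [/=]; rewrite !in_itv /= => /andP[b1 b2] /andP[b3 b4].
    by split; rewrite /= in_itv /=; apply/andP; split; clear -a1 a2 a3 a4 b1 b2 b3 b4; lra.
  have rr : `|n.+1%:R^-1| <= 1 :> R by rewrite ger0_norm ?rn1// ltW.
  have z0 : phi z = 0 by rewrite -(addr0 z) far //= normr0.
  have near_axis (v : R * R) : v = e1 \/ v = e2 ->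
      phi (z + n.+1%:R^-1 *: v) = 0 /\ phi (z - n.+1%:R^-1 *: v) = 0.
    by case=> ->; split; apply: far;
      rewrite /= /GRing.scale /= ?normrN ?mulr1 ?mulr0 ?normr0.
  have [p1 p2] := near_axis e1 (or_introl erefl).
  have [p3 p4] := near_axis e2 (or_intror erefl).
  by rewrite /L /diff4 /four_point z0 p1 p2 p3 p4 !addr0 mulr0 subr0 mul0r.
have cL n : continuous (L n).
  move=> z; apply: cvgM; last exact: cvg_cst.
  apply: cvgB; last by apply: cvgM; [exact: cvg_cst|exact: cphi].
  exact: continuous_four_point.
have bL n : bounded_support (L n) by exists (rho + 1) => z /Lsupp.
have cuL n : continuous (fun z => u z * L n z) by exact: continuousM_plane.
have [Ku Ku0 hKu] := continuous_bounded_box (rho + 1) cu.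
have bulap : bounded_support (fun z => u z * laplacian phi z).
  by exists rho => z /hrho[_ h1 h2]; rewrite lapE h1 h2 addr0 mulr0.
have culap : continuous (fun z => u z * laplacian phi z) by exact: continuousM_plane.
have Lcvg z : L n z @[n --> \oo] --> laplacian phi z.
  apply/cvgrPdist_le => e e0.
  have e8 : 0 < e / 8 by rewrite divr_gt0.
  have near_of (D : R * R -> R) v : continuous D -> exists2 r, 0 < r &
      forall x : R, `|x| <= r -> `|D (z + x *: v) - D z| <= e / 8.
    move=> cD.
    have : D (z + x *: v) @[x --> (0 : R)] --> D z.
      have : z + x *: v @[x --> (0 : R)] --> z + 0 *: v.
        apply: cvgD; first exact: cvg_cst.
        by apply: cvgZr_tmp; exact: cvg_id.
      rewrite scale0r addr0 => h; exact: (cvg_comp _ _ h (cD z)).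
    move=> /cvgrPdist_le/(_ _ e8)/nbhs_ballP[r /= r0 hr].
    exists (r / 2); first by rewrite divr_gt0.
    move=> x xr; rewrite distrC; apply: hr; rewrite /ball /= sub0r normrN.
    by apply: le_lt_trans xr _; rewrite ltr_pdivrMr// ltr_pMr// ltr1n.
  have [r1 r10 h1] := near_of D1 e1 cD1.
  have [r2 r20 h2] := near_of D2 e2 cD2.
  have rm : 0 < Num.min r1 r2 by rewrite lt_min r10.
  near=> n.
  have [xi [x1 x2] h] := d4lap _ z (rn0 n).
  have nr : n.+1%:R^-1 <= Num.min r1 r2.
    by apply/ltW; near: n; exact: (near_infty_natSinv_lt (PosNum rm)).
  have {}nr : n.+1%:R^-1 <= r1 /\ n.+1%:R^-1 <= r2.
    by move: nr; rewrite le_min => /andP[].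
  have b1 := h1 _ (le_trans x1 nr.1); have b2 := h2 _ (le_trans x2 nr.2).
  rewrite distrC; apply: le_trans h _; clear -b1 b2 e0; lra.
have conv : (\int[lebesgue2]_z (u z * L n z)%:E)%E @[n --> \oo] -->
    (\int[lebesgue2]_z (u z * laplacian phi z)%:E)%E.
  pose K := Ku * (5 * (K1 + K2)).
  have ig : (lebesgue2 : {measure set R2 -> \bar R}).-integrable setT
      (fun z => (K * \1_(box (rho + 1)) z)%:E).
    apply: (@integrable_bounded_box R _ K (rho + 1)).
      by apply/measurable_EFinP; apply: measurable_funM => //; exact: measurable_indic (measurable_box _).
    move=> z; rewrite gee0_abs// lee_fin mulr_ge0//.
    by rewrite !mulr_ge0// addr_ge0.
  have [] := @dominated_convergence _ R2 R lebesgue2 setT measurableT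
    (fun n z => (u z * L n z)%:E) (fun z => (u z * laplacian phi z)%:E)
    (fun z => (K * \1_(box (rho + 1)) z)%:E) _ _ _ ig _ => //.
  - by move=> n; apply/measurable_EFinP; exact: continuous_measurable_plane.
  - by apply/measurable_EFinP; exact: continuous_measurable_plane.
  - apply: aeW => z _; apply: cvg_EFin; first exact: nearW.
    by apply: cvgMl_tmp; exact: Lcvg.
  - apply: aeW => z n _; rewrite lee_fin indicE.
    case: (boolP (z \in box _)) => bz.
      rewrite mulr1 normrM; apply: ler_pM => //.
      by apply: hKu; exact: set_mem.
    rewrite Lsupp ?mulr0 ?normr0//; by move/negP: bz => nb /mem_set.
have intE n : (\int[lebesgue2]_z (u z * L n z)%:E)%E = (J (fun z => u z * L n z))%:E.
  rewrite /Rintegral fineK//; apply: integrable_fin_num => //.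
  by apply: integrable_continuous => //; exact: bounded_supportM.
have [c c0 [r0 r00 hsub]] := su rho.
have cf n : continuous (fun z => four_point u z n.+1%:R^-1).
  exact: continuous_four_point.
have low n : n.+1%:R^-1 < r0 -> - c * n.+1%:R^-1 * J phi <= J (fun z => u z * L n z).
  move=> nr; set r := n.+1%:R^-1 in nr *; have r_gt0 : 0 < r := rn0 n.
  have bf : bounded_support (fun z => four_point phi z r).
    exists (Num.max rho (rho + 1)) => z bz.
    have h1 : phi z = 0.
      have [|//] := hrho z _; apply: contra_not bz; apply: box_le.
      by rewrite le_max lexx.
    have h2 : L n z = 0.
      by apply: Lsupp; apply: contra_not bz; apply: box_le; rewrite le_max lexx orbT.
    move: h2; rewrite /L /diff4 h1 !mulr0 !subr0 => /eqP.
    by rewrite mulf_eq0 invr_eq0 expf_eq0 /= (gt_eqF r_gt0) orbF => /eqP.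
  have cf' := @continuous_four_point phi r cphi.
  have i1 : lebesgue2.-integrable setT (EFin \o (fun z => u z * four_point phi z r) : R2 -> \bar R).
    by apply: integrable_continuous; [apply: continuousM_plane|apply: bounded_supportM].
  have i2 : lebesgue2.-integrable setT (EFin \o (fun z => u z * (4 * phi z)) : R2 -> \bar R).
    apply: integrable_continuous; last by do 2?apply: bounded_supportM.
    apply: continuousM_plane => //; apply: continuousM_plane => // z; exact: cvg_cst.
  have b3 : bounded_support (fun z => four_point u z r * phi z - u z * (4 * phi z)).
    by exists rho => z /hrho[h _ _]; rewrite h !mulr0 subr0.
  have c3 : continuous (fun z => four_point u z r * phi z - u z * (4 * phi z)).
    move=> z; apply: cvgB; first by apply: cvgM; [exact: cf|exact: cphi].
    by apply: cvgM; [exact: cu|apply: cvgM; [exact: cvg_cst|exact: cphi]].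
  have -> : J (fun z => u z * L n z) =
      (r ^+ 2)^-1 * J (fun z => four_point u z r * phi z - u z * (4 * phi z)).
    have i3 : lebesgue2.-integrable setT (EFin \o (fun z => four_point u z r * phi z) : R2 -> \bar R).
      apply: integrable_continuous; first by apply: continuousM_plane => //; exact: cf.
      exact: (@bounded_supportM R (fun z => four_point u z r) phi bphi).
    have i4 : lebesgue2.-integrable setT
        (EFin \o (fun z => u z * four_point phi z r - u z * (4 * phi z)) : R2 -> \bar R).
      have -> : EFin \o (fun z => u z * four_point phi z r - u z * (4 * phi z)) =
          EFin \o (fun z => u z * (four_point phi z r - 4 * phi z)).
        by apply/funext => z /=; rewrite mulrBr.
      apply: integrable_continuous.
        apply: continuousM_plane => // z; apply: cvgB; first exact: cf'.
        by apply: cvgM; [exact: cvg_cst|exact: cphi].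
      apply: bounded_supportM; have [r1 h1] := bL n; exists r1 => z /h1.
      rewrite /L /diff4 -/r => /eqP.
      by rewrite mulf_eq0 invr_eq0 expf_eq0 /= (gt_eqF r_gt0) orbF => /eqP.
    rewrite RintegralB// -four_point_symmetric// -RintegralB// -RintegralZl//.
    by apply: eq_Rintegral => z _; rewrite /L /diff4 -/r; ring.
  have r20 : 0 < r ^+ 2 by rewrite exprn_gt0.
  rewrite -(ler_pM2l r20) mulVKf ?gt_eqF//.
  have -> : r ^+ 2 * (- c * r * J phi) = J (fun z => (- c * r ^+ 3) * phi z).
    rewrite RintegralZl//; last exact: integrable_continuous.
    by rewrite !exprS expr0; ring.
  apply: le_Rintegral => //.
  - apply: (@integrable_continuous _ (fun z => - c * r ^+ 3 * phi z)).
      by move=> z; apply: cvgM; [exact: cvg_cst|exact: cphi].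
    exact: (@bounded_supportM R (fun=> - c * r ^+ 3) phi bphi).
  - exact: integrable_continuous.
  move=> z _; have [bz|/hrho[h _ _]] := pselect (box rho z); last first.
    by rewrite h !mulr0 subr0.
  have := hsub z r bz; rewrite r_gt0 nr => /(_ isT) h.
  have := ler_wpM2r (phi0 z) h; clear; lra.
apply/lee_addgt0Pr => e e0.
rewrite -leeBlDr// sub0e.
apply: cvge_ge conv.
pose q := Num.min r0 (e / (c * `|J phi| + 1)).
have q0 : 0 < q by rewrite lt_min r00 divr_gt0// ltr_wpDl// mulr_ge0.
have hq := near_infty_natSinv_lt (PosNum q0).
near=> n.
have : n.+1%:R^-1 < q by near: n; exact: hq.
rewrite lt_min => /andP[n1 n2].
rewrite intE -EFinN lee_fin; apply: le_trans (low n n1).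
rewrite mulNr mulNr lerN2.
apply: le_trans (_ : c * n.+1%:R^-1 * `|J phi| <= _).
  by rewrite ler_wpM2l ?ler_norm// mulr_ge0// ltW.
have d0 : 0 < c * `|J phi| + 1 by rewrite ltr_wpDl// mulr_ge0.
move: n2; rewrite ltr_pdivlMr// => n2.
have fin (x a y b : R) : 0 < x -> x * (a * y + 1) < b -> a * x * y <= b by lra.
exact: fin (rn0 n) n2.
Unshelve. all: by end_near.
Qed.

End SubmeanWeakTheorem.

(** * Logarithms of polynomials *)

Section SubmeanExamples.
Context {R : realType}.
Local Notation C := R[i].
Implicit Types (u v : R * R -> R) (z : R * R).
Local Notation e1 := ((1, 0) : R * R).
Local Notation e2 := ((0, 1) : R * R).

Lemma submean_cst (a : R) : submean (fun=> a).
Proof.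
split; first by move=> z; exact: cvg_cst.
move=> rho; exists 0 => //; exists 1 => // z r _ _.
by rewrite /four_point mul0r subr0; lra.
Qed.

Lemma submeanD u v : submean u -> submean v -> submean (fun z => u z + v z).
Proof.
move=> [cu su] [cv sv]; split; first exact: continuousD_plane.
move=> rho; have [c1 c10 [r1 r10 h1]] := su rho; have [c2 c20 [r2 r20 h2]] := sv rho.
exists (c1 + c2); first exact: addr_ge0.
exists (Num.min r1 r2); first by rewrite lt_min r10.
move=> z r bz /andP[r0]; rewrite lt_min => /andP[rr1 rr2].
have := h1 z r bz; rewrite r0 rr1 => /(_ isT).
have := h2 z r bz; rewrite r0 rr2 => /(_ isT).
rewrite /four_point; lra.
Qed.

Lemma submeanZ (k : R) u : 0 <= k -> submean u -> submean (fun z => k * u z).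
Proof.
move=> k0 [cu su]; split.
  by apply: continuousM_plane => // z; exact: cvg_cst.
move=> rho; have [c c0 [r1 r10 h]] := su rho.
exists (k * c); first exact: mulr_ge0.
exists r1 => // z r bz rr; have := ler_wpM2l k0 (h z r bz rr).
rewrite /four_point; lra.
Qed.

Lemma cvg_max_real (X : Type) (F : set_system X) {FF : Filter F} (f g : X -> R) (a b : R) :
  f x @[x --> F] --> a -> g x @[x --> F] --> b ->
  Num.max (f x) (g x) @[x --> F] --> (Num.max a b : R).
Proof.
move=> fa gb; rewrite maxr_absE.
have -> : (fun x => Num.max (f x) (g x)) = (fun x => (f x + g x + `|f x - g x|) / 2 : R).
  by apply/funext => x; rewrite maxr_absE.
apply: cvgM; last exact: cvg_cst.
by apply: cvgD; [exact: cvgD|apply: cvg_norm; exact: cvgB].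
Qed.

Lemma continuous_max u v : continuous u -> continuous v ->
  continuous (fun z => Num.max (u z) (v z)).
Proof. by move=> cu cv z; apply: cvg_max_real; [exact: cu|exact: cv]. Qed.

(** At a point where [u] is the larger, the inequality of [u] holds for the maximum,
    which dominates [u] at the four neighbours. *)
Lemma submean_max u v : submean u -> submean v -> submean (fun z => Num.max (u z) (v z)).
Proof.
move=> [cu su] [cv sv]; split; first exact: continuous_max.
move=> rho; have [c1 c10 [r1 r10 h1]] := su rho; have [c2 c20 [r2 r20 h2]] := sv rho.
exists (c1 + c2); first exact: addr_ge0.
exists (Num.min r1 r2); first by rewrite lt_min r10.
move=> z r bz /andP[r0]; rewrite lt_min => /andP[rr1 rr2].
have := h1 z r bz; rewrite r0 rr1 => /(_ isT) {}h1.
have := h2 z r bz; rewrite r0 rr2 => /(_ isT) {}h2.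
have r3 : 0 <= r ^+ 3 by rewrite exprn_ge0// ltW.
have c1r := mulr_ge0 c10 r3; have c2r := mulr_ge0 c20 r3.
have mono (f : R * R -> R) : (forall w, f w <= Num.max (u w) (v w)) ->
    four_point f z r <= four_point (fun w => Num.max (u w) (v w)) z r.
  by move=> fw; rewrite /four_point !lerD.
have /mono mu : forall w, u w <= Num.max (u w) (v w) by move=> w; rewrite le_max lexx.
have /mono mv : forall w, v w <= Num.max (u w) (v w) by move=> w; rewrite le_max lexx orbT.
have [uv|vu] := lerP (u z) (v z).
  by apply: le_trans mv; apply: le_trans h2; lra.
by apply: le_trans mu; apply: le_trans h1; lra.
Qed.

Lemma submean_expect (I : finType) (p : I -> R) n (F : seq I -> R * R -> R) :
  (forall i, 0 < p i) -> (forall w, submean (F w)) ->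
  submean (fun z => expect p n (fun w => F w z)).
Proof.
move=> p0; elim: n F => [|n IH] F sF /=; first exact: sF.
have : forall s : seq I, submean (fun z => \sum_(i <- s) p i * expect p n (fun w => F (i :: w) z)).
  elim=> [|i s IHs].
    by under eq_fun do rewrite big_nil; exact: submean_cst.
  under eq_fun do rewrite big_cons; apply: submeanD => //.
  by apply: submeanZ; [exact: ltW|apply: IH].
exact.
Qed.

Lemma poly_taylor2 (q : {poly C}) (rho : R) : exists2 K, 0 <= K &
  forall t : C, normc t <= rho -> normc q.[t] <= K /\
  exists a b, [/\ normc a <= K, normc b <= K & forall h : C, normc h <= 1 ->
    exists2 s, normc s <= K & q.[t + h] = q.[t] + a * h + b * h ^+ 2 + s * h ^+ 3].
Proof.
elim/poly_ind: q => [|q c [K K0 IH]].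
  exists 0 => // t _; rewrite horner0 normc0; split=> //.
  exists 0, 0; rewrite normc0; split=> // h _; exists 0; rewrite ?normc0//.
  by rewrite horner0; ring.
pose rho' := Num.max rho 0.
have rho0 : 0 <= rho' by rewrite le_max lexx orbT.
exists (K * rho' + 2 * K + normc c); first by rewrite !addr_ge0 ?mulr_ge0 ?normc_ge0.
move=> t ht; have [hq [a [b [ha hb hs]]]] := IH t ht.
have tr : normc t <= rho' by rewrite le_max ht.
have c0 := normc_ge0 c.
have bd x : normc x <= K -> normc (x * t) <= K * rho'.
  by move=> xK; rewrite normcM ler_pM ?normc_ge0.
rewrite hornerMXaddC; split.
  by apply: le_trans (ler_normcD _ _) _; have := bd _ hq; lra.
exists (a * t + q.[t]), (b * t + a); split.
- by apply: le_trans (ler_normcD _ _) _; have := bd _ ha; lra.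
- by apply: le_trans (ler_normcD _ _) _; have := bd _ hb; lra.
move=> h h1; have [s sK sE] := hs h h1.
exists (s * t + b + s * h); last first.
  by rewrite hornerMXaddC sE; ring.
have sh : normc (s * h) <= K.
  by rewrite normcM; apply: le_trans sK; rewrite ler_piMr// normc_ge0.
have := ler_normcD (s * t + b) (s * h); have := ler_normcD (s * t) b.
by have := bd _ sK; lra.
Qed.

(** Telescoping of the difference of two products. *)
Lemma prod4_perturb (x1 x2 x3 x4 e1 e2 e3 e4 : C) (M E : R) : 0 <= E ->
  normc x1 <= M -> normc x2 <= M -> normc x3 <= M -> normc x4 <= M ->
  normc (x1 + e1) <= M -> normc (x2 + e2) <= M -> normc (x3 + e3) <= M ->
  normc (x4 + e4) <= M ->
  normc e1 <= E -> normc e2 <= E -> normc e3 <= E -> normc e4 <= E ->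
  normc ((x1 + e1) * (x2 + e2) * (x3 + e3) * (x4 + e4) - x1 * x2 * x3 * x4) <=
  4 * (E * (M * M * M)).
Proof.
move=> E0 h1 h2 h3 h4 k1 k2 k3 k4 l1 l2 l3 l4.
have bd (a b c d : C) : normc a <= E -> normc b <= M -> normc c <= M -> normc d <= M ->
    normc (a * (b * c * d)) <= E * (M * M * M).
  by move=> ha hb hc hd; rewrite !normcM !ler_pM ?mulr_ge0 ?normc_ge0.
set P := (X in normc X).
have -> : P = e1 * ((x2 + e2) * (x3 + e3) * (x4 + e4)) + e2 * (x1 * (x3 + e3) * (x4 + e4))
    + e3 * (x1 * x2 * (x4 + e4)) + e4 * (x1 * x2 * x3) by rewrite /P; ring.
set p1 := e1 * _; set p2 := e2 * _; set p3 := e3 * _; set p4 := e4 * _.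
have := ler_normcD (p1 + p2 + p3) p4; have := ler_normcD (p1 + p2) p3.
have := ler_normcD p1 p2.
have : normc p1 <= E * (M * M * M) by exact: bd.
have : normc p2 <= E * (M * M * M) by exact: bd.
have : normc p3 <= E * (M * M * M) by exact: bd.
have : normc p4 <= E * (M * M * M) by exact: bd.
lra.
Qed.

(** Over the four directions 1, -1, i, -i the terms of order 1 and 2 cancel, so the
    product of the four Taylor expansions is 1 up to O(r^3). *)
Lemma four_point_product (a b s1 s2 s3 s4 : C) (K r : R) : 0 <= r <= 1 ->
  normc a <= K -> normc b <= K ->
  normc s1 <= K -> normc s2 <= K -> normc s3 <= K -> normc s4 <= K ->
  let B s (h : C) := 1 + a * h + b * h ^+ 2 + s * h ^+ 3 in
  let x : C := (r%:C)%C in let y : C := ('i%C : C) * x in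
  is_true (normc (B s1 x * B s2 (- x) * B s3 y * B s4 (- y) - 1) <=
  (2 * K ^+ 2 + K ^+ 4 + 4 * K ^+ 3 + K ^+ 4 + 4 * (K * (1 + 3 * K) ^+ 3)) * r ^+ 3).
Proof.
move=> /andP[r0 r1] ha hb h1 h2 h3 h4 B x y.
have K0 : 0 <= K by apply: le_trans ha; exact: normc_ge0.
have xE : normc x = r by rewrite normc_real ger0_norm.
have y2 : y ^+ 2 = - x ^+ 2 by rewrite exprMn sqr_i mulN1r.
have yE : normc y = r.
  have : normc y ^+ 2 = r ^+ 2 by rewrite -normcX y2 normcN normcX xE.
  by move/eqP; rewrite eqrXn2 ?normc_ge0// => /eqP.
pose A (h : C) := 1 + a * h + b * h ^+ 2.
have rn n : 0 <= r ^+ n <= 1 by rewrite exprn_ge0//= exprn_ile1.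
have hA h : normc h = r -> normc (A h) <= 1 + 2 * K.
  move=> hr; have := ler_normcD (1 + a * h) (b * h ^+ 2); have := ler_normcD 1 (a * h).
  have : normc (a * h) <= K.
    by rewrite normcM hr -[leRHS]mulr1 ler_pM ?normc_ge0.
  have : normc (b * h ^+ 2) <= K.
    by have /andP[? ?] := rn 2%N; rewrite normcM normcX hr -[leRHS]mulr1 ler_pM ?normc_ge0.
  by rewrite normc1 /A; lra.
have hE s h : normc s <= K -> normc h = r -> normc (s * h ^+ 3) <= K * r ^+ 3.
  by move=> sK hr; rewrite normcM normcX hr ler_wpM2r// exprn_ge0.
have E1 : K * r ^+ 3 <= K by rewrite ler_piMr//; have /andP[] := rn 3%N.
have hAE s h : normc s <= K -> normc h = r -> normc (A h + s * h ^+ 3) <= 1 + 3 * K.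
  move=> sK hr; have := hA _ hr; have := hE s h sK hr.
  by have := ler_normcD (A h) (s * h ^+ 3); lra.
have hA' h : normc h = r -> normc (A h) <= 1 + 3 * K by move=> /hA; lra.
have nx : normc (- x) = r by rewrite normcN.
have ny : normc (- y) = r by rewrite normcN.
have := prod4_perturb (mulr_ge0 K0 (exprn_ge0 3 r0)) (hA' _ xE) (hA' _ nx) (hA' _ yE) (hA' _ ny)
  (hAE _ _ h1 xE) (hAE _ _ h2 nx) (hAE _ _ h3 yE) (hAE _ _ h4 ny)
  (hE _ _ h1 xE) (hE _ _ h2 nx) (hE _ _ h3 yE) (hE _ _ h4 ny).
rewrite -!/(B _ _); set PB := (X in normc (X - _)).
have AE : A x * A (- x) * A y * A (- y) - 1 =
    (- (2%:R * b ^+ 2) + b ^+ 4 * x ^+ 4 + 4%:R * (a ^+ 2 * b) - a ^+ 4) * x ^+ 4.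
  have -> : A x * A (- x) * A y * A (- y) =
      ((1 + b * x ^+ 2) ^+ 2 - a ^+ 2 * x ^+ 2) * ((1 + b * y ^+ 2) ^+ 2 - a ^+ 2 * y ^+ 2).
    by rewrite /A; ring.
  by rewrite y2; ring.
have Kp (c : C) n : normc c <= K -> normc (c ^+ n) <= K ^+ n.
  by move=> cK; rewrite normcX lerXn2r ?nnegrE// normc_ge0.
have n2 : normc (2%:R : C) = 2.
  by rewrite (_ : (2%:R : C) = ((2 : R)%:C)%C) ?normc_real ?ger0_norm// rmorph_nat.
have n4 : normc (4%:R : C) = 4.
  by rewrite (_ : (4%:R : C) = ((4 : R)%:C)%C) ?normc_real ?ger0_norm// rmorph_nat.
have nA : normc (A x * A (- x) * A y * A (- y) - 1) <=
    (2 * K ^+ 2 + K ^+ 4 + 4 * K ^+ 3 + K ^+ 4) * r ^+ 3.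
  rewrite AE normcM normcX xE; apply: ler_pM; rewrite ?normc_ge0 ?exprn_ge0//; last first.
    by rewrite exprSr ler_piMr// exprn_ge0.
  set p1 := 2%:R * _; set p2 := b ^+ 4 * _; set p3 := 4%:R * _; set p4 := a ^+ 4.
  have := ler_normcB (- p1 + p2 + p3) p4; have := ler_normcD (- p1 + p2) p3.
  have := ler_normcD (- p1) p2; rewrite normcN.
  have : normc p1 <= 2 * K ^+ 2 by rewrite normcM n2 ler_wpM2l// Kp.
  have : normc p2 <= K ^+ 4.
    rewrite normcM -[leRHS]mulr1; have /andP[? ?] := rn 4%N.
    by rewrite ler_pM ?normc_ge0 ?Kp// normcX xE.
  have : normc p3 <= 4 * K ^+ 3.
    rewrite normcM n4 ler_wpM2l// normcM [K ^+ 3]exprSr.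
    by rewrite ler_pM ?normc_ge0//; exact: Kp.
  have : normc p4 <= K ^+ 4 by exact: Kp.
  lra.
set PA := A x * _ * _ * _ in nA *.
move=> hP; have -> : PB - 1 = (PB - PA) + (PA - 1) by rewrite addrA subrK.
apply: le_trans (ler_normcD _ _) _; apply: le_trans (lerD hP nA) _.
rewrite le_eqVlt; apply/orP; left; apply/eqP; ring.
Qed.

Lemma ln1B_ge (x : R) : 0 <= x <= 2^-1 -> - (2 * x) <= ln (1 - x).
Proof.
move=> /andP[x0 x1]; have d0 : 0 < 1 - x by lra.
rewrite lerNl -lnV ?posrE//; apply: le_trans (_ : (1 - x)^-1 - 1 <= _).
  have := @le_ln1Dx R ((1 - x)^-1 - 1); rewrite addrCA subrr addr0; apply.
  by have := invr_gt0 (1 - x); rewrite d0 => h; rewrite ltrBrDr addNr.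
have -> : (1 - x)^-1 - 1 = x / (1 - x) by field; rewrite gt_eqF.
by rewrite ler_pdivrMr//; nra.
Qed.

Lemma complexP (x y : C) : complex.Re x = complex.Re y -> complex.Im x = complex.Im y -> x = y.
Proof. by case: x y => [a b] [c d] /= -> ->. Qed.

Lemma clim_toC z : clim (nbhs z) toC (toC z).
Proof. by split; [exact: cvg_fst|exact: cvg_snd]. Qed.

Lemma normc_i : normc ('i%C : C) = 1.
Proof.
have : normc ('i%C : C) ^+ 2 = 1 ^+ 2 by rewrite -normcX sqr_i normcN normc1 expr1n.
by move/eqP; rewrite eqrXn2 ?normc_ge0// => /eqP.
Qed.

Lemma normc_toC_le z : normc (toC z) <= `|z.1| + `|z.2|.
Proof.
have -> : toC z = (z.1%:C)%C + 'i%C * (z.2%:C)%C.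
  by apply: complexP => /=; ring.
by apply: le_trans (ler_normcD _ _) _; rewrite normcM normc_i mul1r !normc_real.
Qed.

(** Where [|q|] is below [m] the function takes its minimum. Elsewhere the four
    values are at least those of the logarithm of [|q|], whose sum is four times
    the central value up to the logarithm of a product close to 1. *)
Lemma submean_ln_poly (q : {poly C}) (m : R) : 0 < m ->
  submean (fun z : R * R => ln (Num.max (normc q.[toC z]) m)).
Proof.
move=> m0; have max0 x : 0 < Num.max x m by rewrite lt_max m0 orbT.
split.
  have cq : continuous (fun z : R * R => normc q.[toC z]).
    by move=> z; exact: clim_normc (clim_horner q (clim_toC z)).
  have cm : continuous ((fun=> m) : R * R -> R) by move=> z; exact: cvg_cst.
  by move=> z; apply: cvg_ln; [exact: max0|exact: (continuous_max cq cm)].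
move=> rho; have [K0 K00 hK] := poly_taylor2 q (2 * Num.max rho 0).
pose K := K0 / m.
have K_ge0 : 0 <= K by rewrite divr_ge0// ltW.
pose L := 2 * K ^+ 2 + K ^+ 4 + 4 * K ^+ 3 + K ^+ 4 + 4 * (K * (1 + 3 * K) ^+ 3).
have L0 : 0 <= L.
  have K3 : 0 <= 1 + 3 * K by apply: addr_ge0 => //; exact: mulr_ge0.
  by rewrite /L; repeat first [exact: K_ge0|exact: K3|exact: ler0n|apply: addr_ge0|apply: exprn_ge0|apply: mulr_ge0].
have [L' LE] : exists L', L' = L by exists L.
rewrite -LE in L0; exists (2 * L'); first exact: mulr_ge0.
exists (2 * L' + 1)^-1; first by rewrite invr_gt0; lra.
move=> z r bz /andP[r0 rL].
have r1 : r <= 1.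
  by apply: (le_trans (ltW rL)); rewrite invf_le1 ?lerDr ?mulr_ge0//; lra.
have Lr : 0 <= L' * r ^+ 3 <= 2^-1.
  have r3 : r ^+ 3 <= r by rewrite exprSr ler_piMl ?exprn_ile1// ltW.
  have r30 : 0 <= r ^+ 3 by rewrite exprn_ge0// ltW.
  rewrite mulr_ge0//=.
  have : r * (2 * L' + 1) < 1 by rewrite -ltr_pdivlMr ?div1r//; lra.
  have := ler_wpM2l L0 r3; lra.
have zr : normc (toC z) <= 2 * Num.max rho 0.
  have := bz; rewrite /box /= !in_itv /= => -[/andP[z1 z2] /andP[z3 z4]].
  apply: le_trans (normc_toC_le z) _; rewrite mulr2n mulrDl mul1r.
  have rM : rho <= Num.max rho 0 by rewrite le_max lexx.
  by apply: lerD; apply: le_trans rM; rewrite ler_norml ?z1 ?z3.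
have [hq [a [b [ha hb hs]]]] := hK _ zr.
set t := toC z in hq hs zr *.
have x1 : normc (r%:C)%C <= 1 by rewrite normc_real ger0_norm// ltW.
pose x : C := (r%:C)%C; pose y : C := ('i%C : C) * x.
have sE1 : toC (z + r *: e1) = t + x.
  by apply: complexP; rewrite /= /GRing.scale /=; ring.
have sE2 : toC (z - r *: e1) = t - x.
  by apply: complexP; rewrite /= /GRing.scale /=; ring.
have sE3 : toC (z + r *: e2) = t + y.
  by apply: complexP; rewrite /= /GRing.scale /=; ring.
have sE4 : toC (z - r *: e2) = t - y.
  by apply: complexP; rewrite /= /GRing.scale /=; ring.
have y1 : normc y <= 1 by rewrite normcM normc_i mul1r.
have nN (h : C) : normc h <= 1 -> normc (- h) <= 1 by rewrite normcN.
have [s1 h1 E1] := hs _ x1; have [s2 h2 E2] := hs _ (nN _ x1).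
have [s3 h3 E3] := hs _ y1; have [s4 h4 E4] := hs _ (nN _ y1).
rewrite /four_point sE1 sE2 sE3 sE4 /= -/t.
have mle (w : C) : ln m <= ln (Num.max (normc w) m).
  by rewrite ler_ln ?posrE// le_max lexx orbT.
have r30 : 0 <= 2 * L' * r ^+ 3 by rewrite !mulr_ge0 ?exprn_ge0// ltW.
have [qm|mq] := lerP (normc q.[t]) m.
  have := mle q.[t + x]; have := mle q.[t - x]; have := mle q.[t + y]; have := mle q.[t - y].
  lra.
have q0 : q.[t] != 0 by rewrite -normc_gt0; exact: lt_trans mq.
have nq : 0 < normc q.[t] by rewrite normc_gt0.
have div (c : C) : normc c <= K0 -> normc (c / q.[t]) <= K.
  by move=> cK; rewrite normcM normcV ler_pM ?invr_ge0 ?normc_ge0// lef_pV2 ?posrE// ltW.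
have r01 : 0 <= r <= 1 by rewrite r1 ltW.
have := four_point_product r01 (div _ ha) (div _ hb) (div _ h1) (div _ h2) (div _ h3) (div _ h4).
cbv zeta; rewrite -/L -LE -/x -/y.
pose B s h := 1 + a / q.[t] * h + b / q.[t] * h ^+ 2 + s / q.[t] * h ^+ 3.
rewrite -!/(B _ _) => hB.
have BE s h : q.[t] + a * h + b * h ^+ 2 + s * h ^+ 3 = q.[t] * B s h.
  by rewrite /B; field.
rewrite E1 E2 E3 E4 !BE.
set P := B s1 x * _ * _ * _ in hB.
have P1 : 1 - L' * r ^+ 3 <= normc P.
  have := ler_dist_normc P 1; rewrite normc1 ler_distl => /andP[+ _]; lra.
have P0 : 0 < normc P by apply: lt_le_trans P1; lra.
have : 0 < normc (B s1 x) * normc (B s2 (- x)) * normc (B s3 y) * normc (B s4 (- y)).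
  by rewrite -!normcM.
have Bge s h : 0 <= normc (B s h) by exact: normc_ge0.
have [b1|] := eqVneq (normc (B s1 x)) 0; first by rewrite b1 !mul0r ltxx.
have [b1|] := eqVneq (normc (B s2 (- x))) 0; first by rewrite b1 !(mul0r, mulr0) ltxx.
have [b1|] := eqVneq (normc (B s3 y)) 0; first by rewrite b1 !(mul0r, mulr0) ltxx.
have [b1|] := eqVneq (normc (B s4 (- y))) 0; first by rewrite b1 !(mul0r, mulr0) ltxx.
move=> n4 n3 n2 n1 _.
have low s h : normc (B s h) != 0 ->
    ln (normc q.[t]) + ln (normc (B s h)) <= ln (Num.max (normc (q.[t] * B s h)) m).
  move=> Bn; have Bp : 0 < normc (B s h) by rewrite lt_def Bn Bge.
  by rewrite -lnM ?posrE// ler_ln ?posrE ?mulr_gt0// ?normcM ?max0// le_max lexx.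
have sumB : ln (normc (B s1 x)) + ln (normc (B s2 (- x))) + ln (normc (B s3 y)) +
    ln (normc (B s4 (- y))) = ln (normc P).
  by rewrite /P !normcM !lnM ?posrE ?mulr_gt0 ?lt_def ?n1 ?n2 ?n3 ?n4 ?Bge.
have : - (2 * (L' * r ^+ 3)) <= ln (normc P).
  apply: le_trans (ln1B_ge Lr) _; rewrite ler_ln ?posrE//; lra.
have := low _ _ n1; have := low _ _ n2; have := low _ _ n3; have := low _ _ n4.
lra.
Qed.

End SubmeanExamples.

(** * Limits with a logarithmic pole *)

Section LogPole.
Context {R : realType}.
Local Notation R2 := (measurableTypeR R * measurableTypeR R)%type.
Implicit Types (z : R * R).

(** An integrable function that dominates the logarithm of [1/|z|]: the number of
    boxes of half side [e^-k] that contain [z]. *)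
Definition pole (z : R2) : \bar R := \sum_(k <oo) (\1_(box (expR (- k%:R))) z : R)%:E.

Lemma measurable_indic_box (r : R) : measurable_fun setT (fun z : R2 => (\1_(box r) z : R)%:E).
Proof. by apply/measurable_EFinP; apply: measurable_indic; exact: measurable_box. Qed.

Lemma indic_ge0 (A : set R2) (z : R2) : (0 <= (\1_A z : R)%:E)%E.
Proof. by rewrite lee_fin. Qed.

Lemma pole_ge0 z : (0 <= pole z)%E.
Proof. by apply: nneseries_ge0 => k _ _; exact: indic_ge0. Qed.

Lemma measurable_pole : measurable_fun setT pole.
Proof.
apply: (@ge0_emeasurable_sum _ _ _ setT (fun k z => (\1_(box (expR (- k%:R))) z : R)%:E) predT).
  by move=> k z _ _; exact: indic_ge0.
by move=> k _; exact: measurable_indic_box.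
Qed.

Lemma integral_indic_box (r : R) : 0 <= r ->
  (\int[lebesgue2]_z (\1_(box r) z)%:E = (4 * r ^+ 2)%:E)%E.
Proof.
move=> r0; rewrite integral_indic//; last exact: measurable_box.
rewrite setIT; exact: lebesgue2_box.
Qed.

Lemma integral_pole : (\int[lebesgue2]_z pole z < +oo)%E.
Proof.
rewrite /pole (@integral_nneseries _ _ _ lebesgue2 setT measurableT (fun k z => (\1_(box (expR (- k%:R))) z : R)%:E)); last 2 first.
- by move=> k; exact: measurable_indic_box.
- by move=> k z _; exact: indic_ge0.
pose q : R := expR (- 1) ^+ 2.
have q0 : 0 <= q by rewrite exprn_ge0// expR_ge0.
have q1 : q < 1 by rewrite expr_lt1 ?expR_ge0// -[ltRHS]expR0 ltr_expR; lra.
apply: (@le_lt_trans _ _ (4 / (1 - q))%:E); last exact: ltry.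
apply: lime_le.
  by apply: is_cvg_nneseries => k _ _; apply: integral_ge0 => z _; exact: indic_ge0.
apply: nearW => n.
rewrite (eq_bigr (fun k => (4 * q ^+ k)%:E)); last first.
  move=> k _; rewrite integral_indic_box ?expR_ge0//; congr EFin; congr (_ * _).
  by rewrite -mulN1r expRM_natr -!exprM mulnC.
rewrite sumEFin lee_fin -mulr_sumr ler_wpM2l// -[leRHS]mul1r ler_pdivlMr ?subr_gt0//.
rewrite big_mkord mulrC -opprB mulNr -subrX1 opprB lerBlDr lerDl exprn_ge0//.
Qed.

Lemma pole_ge_nat n z : (forall k, (k < n)%N -> box (expR (- k%:R)) z) ->
  ((n%:R)%:E <= pole z)%E.
Proof.
move=> hz; apply: le_trans (nneseries_lim_ge n _); last by move=> k _ _; exact: indic_ge0.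
rewrite big_mkord (eq_bigr (fun=> 1%E)); last first.
  by move=> k _; rewrite indicE mem_set//; exact: hz.
by rewrite sumEFin sumr_const card_ord.
Qed.

Lemma ler_norm_fst z : `|z.1| <= normc (toC z).
Proof. by rewrite /= -sqrtr_sqr ler_wsqrtr// lerDl sqr_ge0. Qed.

Lemma ler_norm_snd z : `|z.2| <= normc (toC z).
Proof. by rewrite /= -sqrtr_sqr ler_wsqrtr// lerDr sqr_ge0. Qed.

Lemma pole0 : pole (0, 0) = +oo%E.
Proof.
apply/eqyP => a a0; have /andP[_ ha] := truncn_itv (ltW a0).
apply: le_trans (pole_ge_nat (n := (Num.truncn a).+1) _); first by rewrite lee_fin ltW.
move=> k _; split; rewrite /= in_itv /= oppr_le0 expR_ge0//.
Qed.

Lemma toC_eq0 z : z != (0, 0) -> 0 < normc (toC z).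
Proof.
move=> z0; rewrite normc_gt0; apply: contra_neq z0.
by case: z => a b [-> ->].
Qed.

Lemma ln_le_pole z : z != (0, 0) ->
  ((Num.max 0 (- ln (normc (toC z))))%:E <= pole z)%E.
Proof.
move=> z0; have nz := toC_eq0 z0.
have [l0|l0] := lerP 0 (- ln (normc (toC z))); last exact: pole_ge0.
have /andP[h1 h2] := truncn_itv l0.
apply: le_trans (pole_ge_nat (n := (Num.truncn (- ln (normc (toC z)))).+1) _).
  by rewrite lee_fin ltW.
move=> k kn; have hk : normc (toC z) <= expR (- k%:R).
  rewrite -[leLHS]lnK ?posrE// ler_expR lerNr; apply: le_trans h1.
  by rewrite ler_nat -ltnS.
split; rewrite /= in_itv /= -ler_norml; apply: le_trans hk.
  exact: ler_norm_fst.
exact: ler_norm_snd.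
Qed.

(** It is infinite at the origin, so that domination needs no exception there. *)
Definition dominator (c rho : R) (z : R2) : \bar R :=
  (c%:E * ((\1_(box rho) z : R)%:E + pole z))%E.

Lemma integrable_dominator (c rho : R) :
  lebesgue2.-integrable setT (dominator c rho).
Proof.
apply: integrableZl => //; apply: integrableD => //.
  apply: (@integrable_bounded_box _ _ 1 rho); first exact: measurable_indic_box.
  by move=> z; rewrite mul1r gee0_abs// indic_ge0.
apply/integrableP; split; first exact: measurable_pole.
rewrite (eq_integral pole); first exact: integral_pole.
by move=> z _; rewrite gee0_abs// pole_ge0.
Qed.

End LogPole.

Section LimitOfSubmean.
Context {R : realType}.
Local Notation R2 := (measurableTypeR R * measurableTypeR R)%type.
Variables (u : nat -> R * R -> R) (f : R * R -> \bar R).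
Hypothesis su : forall n, submean (u n).
Hypothesis uf : forall z, z != (0, 0) -> (u n z)%:E @[n --> \oo] --> f z.
Hypothesis ub : forall rho : R, exists K : R, forall n z, box rho z -> z != (0, 0) ->
  `|u n z| <= K * (1 + Num.max 0 (- ln (normc (toC z)))).
Hypothesis fusc : upper_semicontinuous setT f.

Lemma dominated rho : exists2 c : R, 0 < c & forall z, box rho z ->
  (forall n, (`|u n z|%:E <= dominator c rho z)%E) /\ (`|f z| <= dominator c rho z)%E.
Proof.
have [K hK] := ub rho; exists (`|K| + 1); first by rewrite ltr_wpDl.
move=> z bz; rewrite /dominator indicE mem_set//=.
have [->|z0] := eqVneq z (0, 0).
  by rewrite pole0 addey// gt0_muley ?lte_fin ?ltr_wpDl//; split=> *; rewrite leey.
have h n : (`|u n z|%:E <= (`|K| + 1)%:E * (1%:E + pole z))%E.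
  apply: (@le_trans _ _ ((`|K| + 1) * (1 + Num.max 0 (- ln (normc (toC z)))))%:E).
    rewrite lee_fin; apply: le_trans (hK n z bz z0) _; apply: ler_wpM2r.
      by rewrite addr_ge0// le_max lexx.
    by apply: le_trans (ler_norm K) _; rewrite lerDl.
  rewrite EFinM; apply: lee_wpmul2l; first by rewrite lee_fin addr_ge0.
  by rewrite EFinD; apply: leeD => //; exact: ln_le_pole.
split=> //.
apply: (cvge_le _ (cvg_abse (uf z0))).
by apply: nearW => n; exact: h.
Qed.

Lemma origin_null : lebesgue2 ([set (0, 0)] : set R2) = 0%E.
Proof.
have -> : ([set (0, 0)] : set R2) = [set 0] `*` [set 0].
  by apply/seteqP; split=> [_ -> //|[a b] [/= -> ->]].
by rewrite lebesgue2X// lebesgue_measure_set1 mul0e.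
Qed.

Lemma usc_limit_L1loc : L1loc setT f.
Proof.
have mf := usc_measurable_plane fusc.
split=> //; first exact: openT.
move=> K cK _; have [rho hrho] := compact_in_box cK.
have mK : @measurable _ R2 K.
  rewrite -(setCK K); apply: measurableC; apply: open_measurable_plane.
  by apply: closed_openC; apply: compact_closed.
have [c c0 hc] := dominated rho.
apply: (@le_integrable _ _ _ _ _ mK _ (dominator c rho)).
- exact: measurable_funTS.
- move=> z Kz; have [_ h] := hc z (hrho z Kz); apply: le_trans h _; exact: lee_abs.
by apply: integrableS (integrable_dominator c rho).
Qed.

(** Dominated convergence, the dominating function being an integrable pole times
    a bound for the Laplacian of the test function. *)
Lemma weakly_subharmonic_limit : weakly_subharmonic setT f.
Proof.
split; first exact: usc_limit_L1loc.
move=> phi tf phi0.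
have [D1 [D2 [rho [_ [c1 c2] lapE hrho _]]]] := test_function_derivatives tf.
have cD : continuous (laplacian phi).
  have -> : laplacian phi = (fun z => D1 z + D2 z) by apply/funext.
  exact: continuousD_plane.
have [M M0 hM] := continuous_bounded_box rho cD.
have [c c0 hc] := dominated rho.
have mf := usc_measurable_plane fusc.
have mD : measurable_fun setT (fun z : R2 => (laplacian phi z)%:E).
  by apply/measurable_EFinP; exact: continuous_measurable_plane.
have mfn n : measurable_fun setT (fun z : R2 => (u n z * laplacian phi z)%:E).
  apply/measurable_EFinP; apply: continuous_measurable_plane.
  by apply: continuousM_plane => //; case: (su n).
have ae : {ae lebesgue2, forall z, setT z -> (u n z * laplacian phi z)%:E @[n --> \oo] -->
    (f z * (laplacian phi z)%:E)%E}.
  exists [set (0, 0)]; split.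
  - rewrite (_ : [set (0, 0)] = [set 0] `*` [set 0]); first exact: measurableX.
    by apply/seteqP; split=> [_ -> //|[a b] [/= -> ->]].
  - exact: origin_null.
  move=> z /= hz; have [//|z0] := eqVneq z (0, 0); exfalso; apply: hz => _.
  under eq_fun do rewrite EFinM; apply: cvgeZr => //; exact: uf.
have bound : {ae lebesgue2, forall z n, setT z ->
    (`|(u n z * laplacian phi z)%:E| <= M%:E * dominator c rho z)%E}.
  apply: aeW => z n _; have [bz|/hrho[_ h1 h2]] := pselect (box rho z); last first.
    rewrite lapE h1 h2 addr0 mulr0 abse0; apply: mule_ge0; first by rewrite lee_fin.
    rewrite /dominator mule_ge0 ?adde_ge0 ?indic_ge0 ?pole_ge0// lee_fin ltW//.
  rewrite mulrC EFinM abseM; apply: lee_pmul => //; first by rewrite lee_fin hM.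
  by have [h _] := hc z bz; exact: h.
have [_ _] := dominated_convergence measurableT mfn (emeasurable_funM mf mD) ae
  (integrableZl measurableT M (integrable_dominator c rho)) bound.
apply: cvge_ge; apply: nearW => n.
exact: (submean_weakly_subharmonic (su n) tf phi0).
Qed.

End LimitOfSubmean.

(** * The law of the random walk *)

Section Words.
Context {R : realType} {I : finType} (p : I -> R).

Fixpoint words n : seq (seq I) :=
  if n is m.+1 then [seq i :: w | i <- enum I, w <- words m] else [:: [::]].

Lemma mem_words n w : (w \in words n) = (size w == n).
Proof.
elim: n w => [|n IH] [|i w] //=.
  by apply/negP => /allpairsP[[i w] []].
rewrite eqSS -IH; apply/allpairsP/idP => [[[j v] [/= _ vn [_ ->]]]//|wn].
by exists (i, w); rewrite mem_enum.
Qed.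

Lemma words_uniq n : uniq (words n).
Proof.
elim: n => // n IH /=; apply: allpairs_uniq => //; first exact: enum_uniq.
by move=> [i u] [j v] _ _ [-> ->].
Qed.

Lemma expect_words n F :
  expect p n F = \sum_(w <- words n) (\prod_(i <- w) p i) * F w.
Proof.
elim: n F => [|n IH] F /=; first by rewrite big_seq1 big_nil mul1r.
rewrite big_allpairs_dep big_enum; apply: eq_bigr => i _.
rewrite IH mulr_sumr; apply: eq_bigr => w _; by rewrite big_cons mulrA.
Qed.

End Words.

Section Law.
Context {R : realType}.

Lemma countable_Br3p : countable [set: Br3p].
Proof.
apply/countable_injP; exists (fun x : Br3p => choice.pickle (repr (val x))).
move=> x y _ _ /(pcan_inj choice.pickleK) xy; apply: val_inj.
by rewrite -(braid_repr (val x)) xy braid_repr.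
Qed.

(** Points of measure zero are removed from the support, so that all the weights
    are positive. *)
Lemma finite_law (mu : probability Br3p R) : finitely_supported mu ->
  exists k, exists s : 'I_k -> Br3p, exists p : 'I_k -> R,
    [/\ injective s, forall i, 0 < p i, \sum_i p i = 1 &
        forall i, mu [set s i] = (p i)%:E].
Proof.
move=> [A /finite_seqP[r ->] muA].
have mset (x : Br3p) : measurable [set x] by [].
have muE x : mu [set x] = (fine (mu [set x]))%:E by rewrite fineK// fin_num_measure.
pose t := [seq x <- undup r | fine (mu [set x]) != 0].
have ut : uniq t by rewrite filter_uniq// undup_uniq.
exists (size t), (tnth (in_tuple t)), (fun i => fine (mu [set tnth (in_tuple t) i])).
split.
- by move=> i j /eqP; rewrite !(tnth_nth 1%g) nth_uniq ?ltn_ord// => /eqP ij; exact: val_inj.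
- move=> i; rewrite lt_def fine_ge0 ?measure_ge0// andbT.
  by have := mem_tnth i (in_tuple t); rewrite mem_filter => /andP[].
- rewrite -(big_tnth _ _ t predT (fun x => fine (mu [set x]))) /t big_filter.
  rewrite big_rmcond; last by move=> x; rewrite negbK => /eqP.
  apply: EFin_inj; rewrite -sumEFin -muA.
  transitivity (\sum_(x <- undup r) mu [set x])%E; first by apply: eq_bigr => x _; rewrite -muE.
  rewrite fsbig_seq ?undup_uniq// -measure_fin_bigcup//; last first.
    by move=> x y _ _ [z [/= -> ->]].
  congr (mu _); rewrite bigcup_imset1 image_id.
  by apply/seteqP; split=> x /=; rewrite mem_undup.
- by move=> i; rewrite -muE.
Qed.

Section Walk.
Context {d : measure_display} {T : measurableType d} (P : probability T R).
Variables (mu : probability Br3p R) (g : nat -> {RV P >-> Br3p}).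
Hypothesis hg : iid_with_law g mu.
Variables (k : nat) (s : 'I_k -> Br3p) (p : 'I_k -> R).
Hypothesis s_inj : injective s.
Hypothesis p_gt0 : forall i, 0 < p i.
Hypothesis p_sum1 : \sum_i p i = 1.
Hypothesis mu_s : forall i, mu [set s i] = (p i)%:E.
Implicit Types (w : seq 'I_k).

Lemma measurable_to_discrete (f : T -> Br3p) :
  (forall b, measurable (f @^-1` [set b])) -> measurable_fun setT f.
Proof.
move=> mf _ Y _; rewrite setTI.
have -> : f @^-1` Y = \bigcup_(b : Br3p) (if `[< Y b >] then f @^-1` [set b] else set0).
  apply/seteqP; split=> [x Yx|x [b _]].
    by exists (f x) => //; rewrite asboolT.
  by case: asboolP => // Yb /= ->.
apply: countable_bigcupT_measurable; first exact: countable_Br3p.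
by move=> b; case: ifP.
Qed.

(** The group is countable, so measurability can be checked on the values. *)
Lemma measurable_walk n : measurable_fun setT (walk g n).
Proof.
elim: n => [|n IH].
  rewrite (_ : walk g 0 = cst 1%g); first exact: measurable_cst.
  by apply/funext => x; rewrite /walk big_ord0.
apply: measurable_to_discrete => b.
have -> : walk g n.+1 @^-1` [set b] = \bigcup_(a : Br3p)
    (walk g n @^-1` [set a] `&` g n @^-1` [set c | (a * c)%g = b]).
  apply/seteqP; split=> [x <-|x [a _ [/= <- <-]]]; last by rewrite /walk big_ord_recr.
  by exists (walk g n x) => //; split=> //=; rewrite /walk big_ord_recr.
apply: countable_bigcupT_measurable; first exact: countable_Br3p.
move=> a; apply: measurableI; first by rewrite -[X in measurable X]setTI; exact: IH.
by rewrite -[X in measurable X]setTI; exact: measurable_funP.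
Qed.

Definition spells w : set T :=
  [set x | [seq g i x | i <- iota 0 (size w)] = map s w].

Lemma spellsE w : spells w =
  \bigcap_(i in [set` [fset i in iota 0 (size w)]%fset]) (g i @^-1` [set nth 1%g (map s w) i]).
Proof.
apply/seteqP; split=> x /=.
  move=> hx i; rewrite /= !inE mem_iota add0n /= => iw.
  by rewrite -hx (nth_map 0%N) ?size_iota// nth_iota.
move=> hx; apply: (@eq_from_nth _ 1%g); rewrite !size_map size_iota// => i iw.
rewrite (nth_map 0%N) ?size_iota// nth_iota// add0n.
by apply: hx; rewrite /= !inE mem_iota.
Qed.

Lemma measurable_spells w : measurable (spells w).
Proof.
rewrite spellsE; apply: bigcap_measurableType => i _.
by rewrite -[X in measurable X]setTI; exact: measurable_funP.
Qed.

Lemma prob_spells w : P (spells w) = (\prod_(i <- w) p i)%:E.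
Proof.
rewrite spellsE (hg.1 _ (fun i => [set nth 1%g (map s w) i]))//.
have -> : (\prod_(i <- [fset i in iota 0 (size w)]%fset) P (g i @^-1` [set nth 1%g (map s w) i]) =
   \prod_(i <- iota 0 (size w)) mu [set nth 1%g (map s w) i])%E.
  transitivity (\prod_(i <- [fset i in iota 0 (size w)]%fset) mu [set nth 1%g (map s w) i])%E.
    by apply: eq_bigr => i _; rewrite -(hg.2 i).
  apply: perm_big; apply: uniq_perm; rewrite ?fset_uniq ?iota_uniq// => i.
  by rewrite !inE.
case: w => [|i0 w]; first by rewrite !big_nil.
move: (i0 :: w) => {}w; rewrite -prodEFin [RHS](big_nth i0) /index_iota subn0.
apply: eq_big_seq => i; rewrite mem_iota add0n /= => iw.
by rewrite (nth_map i0)// mu_s.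
Qed.

Lemma walk_spells n w x : size w = n -> spells w x ->
  walk g n x = (\prod_(i <- w) s i)%g.
Proof.
move=> <- hx; transitivity (\prod_(y <- map s w) y)%g; last by rewrite big_map.
by rewrite -hx big_map /walk -(big_mkord predT (fun i => g i x)) /index_iota subn0.
Qed.

Lemma trivIset_spells n : trivIset [set` words n] spells.
Proof.
move=> u v /=; rewrite !mem_words => /eqP su /eqP sv [x [hu hv]].
by apply: (inj_map s_inj); rewrite -hu -hv su sv.
Qed.

(** The words of length [n] partition the probability space up to a null set, by
    independence of the steps. *)
Lemma integral_walk n (psi : Br3p -> \bar R) : (forall b, 0 <= psi b)%E ->
  (\int[P]_x psi (walk g n x) =
   \sum_(w <- words n) (\prod_(i <- w) p i)%:E * psi (\prod_(i <- w) s i)%g)%E.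
Proof.
move=> psi0.
pose E := \big[setU/set0]_(w <- words n) spells w.
have cell (c : \bar R) w :
    (\int[P]_(x in spells w) cst c x = (\prod_(i <- w) p i)%:E * c)%E.
  rewrite integral_cst; last exact: measurable_spells.
  by rewrite -prob_spells muleC.
have mE : measurable E by apply: bigsetU_measurable => w _; exact: measurable_spells.
have mpsi : measurable_fun setT (fun x => psi (walk g n x)).
  by apply: (@measurableT_comp _ _ _ _ _ _ psi); [move=> ? ? ?|exact: measurable_walk].
have PE : P E = 1%E.
  rewrite -[P E]mul1e -integral_cst// ge0_integral_bigsetU//; first last.
  - exact: trivIset_spells.
  - exact: words_uniq.
  - exact: measurable_spells.
  under eq_bigr do rewrite cell mule1.
  rewrite sumEFin; congr EFin.
  rewrite -[RHS](expect_cst p_sum1 n 1) expect_words.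
  by apply: eq_bigr => w _; rewrite mulr1.
rewrite (@ge0_negligible_integral _ _ _ _ _ (~` E))//; last 2 first.
- exact: measurableC.
- by have := probability_setC P mE; rewrite PE subee.
rewrite setTD setCK ge0_integral_bigsetU//; first last.
- exact: measurable_funTS.
- exact: trivIset_spells.
- exact: words_uniq.
- exact: measurable_spells.
apply: eq_big_seq => w; rewrite mem_words => /eqP sw.
rewrite (eq_integral (cst (psi (\prod_(i <- w) s i)%g))); last first.
  by move=> x; rewrite inE => hx; rewrite (walk_spells sw hx).
by rewrite cell.
Qed.

Let pos_part (H : Br3p -> \bar R) n :
  (\int[P]_x (fun x => H (walk g n x))^\+ x =
   \sum_(w <- words n) (\prod_(i <- w) p i)%:E * maxe (H (\prod_(i <- w) s i)%g) 0)%E.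
Proof.
rewrite funepos.unlock -(@integral_walk n (fun b => maxe (H b) 0)%E) => [//|b].
by rewrite le_max lexx orbT.
Qed.

Let neg_part (H : Br3p -> \bar R) n :
  (\int[P]_x (fun x => H (walk g n x))^\- x =
   \sum_(w <- words n) (\prod_(i <- w) p i)%:E * maxe (- H (\prod_(i <- w) s i)%g) 0)%E.
Proof.
rewrite funeneg.unlock -(@integral_walk n (fun b => maxe (- H b) 0)%E) => [//|b].
by rewrite le_max lexx orbT.
Qed.

Let sum_words n (G : seq 'I_k -> \bar R) (h : seq 'I_k -> R) :
  (forall w, size w = n -> G w = (h w)%:E) ->
  (\sum_(w <- words n) (\prod_(i <- w) p i)%:E * G w = (expect p n h)%:E)%E.
Proof.
move=> Gh; rewrite expect_words -sumEFin; apply: eq_big_seq => w.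
by rewrite mem_words => /eqP /Gh ->.
Qed.

Lemma integral_walk_fin n (H : Br3p -> \bar R) (h : seq 'I_k -> R) :
  (forall w, size w = n -> H (\prod_(i <- w) s i)%g = (h w)%:E) ->
  (\int[P]_x H (walk g n x) = (expect p n h)%:E)%E.
Proof.
move=> Hh; rewrite integralE pos_part neg_part.
rewrite (@sum_words _ _ (fun w => Num.max (h w) 0)); last first.
  by move=> w /Hh ->; rewrite EFin_max.
rewrite (@sum_words _ _ (fun w => Num.max (- h w) 0)); last first.
  by move=> w /Hh ->; rewrite EFin_max.
rewrite -EFinB -expectB; congr EFin; apply: eq_expect => w _.
by have [h0|h0] := lerP (h w) 0; have [h1|h1] := lerP (- h w) 0; lra.
Qed.

(** A single value [-oo] of positive probability decides the integral. *)
Lemma integral_walk_Ny n (H : Br3p -> \bar R) (w0 : seq 'I_k) :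
  (forall b, H b < +oo)%E -> size w0 = n -> H (\prod_(i <- w0) s i)%g = -oo%E ->
  (\int[P]_x H (walk g n x) = -oo)%E.
Proof.
move=> Hoo sw0 H0; rewrite integralE pos_part neg_part.
have -> : (\sum_(w <- words n) (\prod_(i <- w) p i)%:E *
    maxe (- H (\prod_(i <- w) s i)%g) 0 = +oo)%E.
  have w0n : w0 \in words n by rewrite mem_words sw0.
  rewrite (big_rem w0)//= H0 gt0_muley ?addye//.
    rewrite gt_eqF// (@lt_le_trans _ _ 0%E)//.
    apply: sume_ge0 => w _; apply: mule_ge0; last by rewrite le_max lexx orbT.
    by rewrite lee_fin prodr_ge0// => i _; exact: ltW.
  by rewrite lte_fin prodr_gt0.
rewrite (@sum_words _ _ (fun w => fine (maxe (H (\prod_(i <- w) s i)%g) 0%E))).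
  by rewrite addeNy.
move=> w _; rewrite fineK// fin_numE; case: (H _) (Hoo (\prod_(i <- w) s i)%g) => [r _|//|_].
  by rewrite -EFin_max.
by rewrite maxNye.
Qed.

End Walk.
End Law.

(** * The Burau matrices at a complex number *)

Section BurauSpecialization.
Context {R : realType}.
Local Notation C := R[i].
Implicit Types (x y : Br3p) (t : C).

(** Identities between Burau matrices descend from the fraction field to the
    polynomials. *)
Lemma map_tofrac_inj (A B : 'M[{poly int}]_2) :
  map_mx (@tofrac _) A = map_mx (@tofrac _) B -> A = B.
Proof.
move=> /matrixP AB; apply/matrixP => k l; have := AB k l; rewrite !mxE => /eqP.
by rewrite tofrac_eq => /eqP.
Qed.

Lemma burau_polyM x y : burau_poly (x * y)%g = burau_poly x *m burau_poly y.
Proof.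
apply: map_tofrac_inj.
by rewrite map_mxM !burau_polyE (_ : val (x * y)%g = (val x * val y)%g)// burauM.
Qed.

Definition gen_positive (i : bool) : sigma i \in positive.
Proof. by apply/asboolP; exists [:: i]; rewrite big_seq1. Qed.

Definition gen i : Br3p := exist _ (sigma i) (gen_positive i).

Lemma Br3p_ind (Q : Br3p -> Prop) :
  Q 1%g -> (forall i x, Q x -> Q (gen i * x)%g) -> forall x, Q x.
Proof.
move=> Q1 QM x; have /asboolP[s xs] := valP x.
have -> : x = (\prod_(i <- s) gen i)%g.
  apply: val_inj; rewrite xs; elim: s {xs} => [|i s IH]; first by rewrite !big_nil.
  by rewrite !big_cons IH.
by elim: s {xs} => [|i s IH]; rewrite ?big_nil// big_cons; exact: QM.
Qed.

Lemma burau_poly_gen i : burau_poly (gen i) = burau_gen_poly i.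
Proof.
by apply: map_tofrac_inj; rewrite burau_polyE burau_sigma.
Qed.

Lemma burau_poly1 : burau_poly 1%g = 1%:M.
Proof.
by apply: map_tofrac_inj; rewrite burau_polyE map_mx1 burau1.
Qed.

Lemma burau_atE t x k l : burau_at t x k l = (map_poly intr (burau_poly x k l)).[t].
Proof. by rewrite mxE. Qed.

Lemma burau_atM t x y : burau_at t (x * y)%g = burau_at t x *m burau_at t y.
Proof.
apply/matrixP => k l; rewrite mulmx2E !burau_atE burau_polyM !mxE sum_ord2.
by rewrite rmorphD !rmorphM /= hornerD !hornerM.
Qed.

Lemma burau_at1 t : burau_at t 1%g = 1%:M.
Proof.
apply/matrixP => k l; rewrite burau_atE burau_poly1 !mxE.
by case: (k == l); rewrite ?mulr1n ?mulr0n ?rmorph1 ?rmorph0 ?hornerC ?horner0.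
Qed.

Lemma burau_at_gen t i : burau_at t (gen i) =
  if i then mx2 1 0 t (- t) else mx2 (- t) 1 0 1.
Proof.
apply/matrixP => k l; rewrite burau_atE burau_poly_gen.
case: i; rewrite !mxE; case: (k == 0); case: (l == 0);
  by rewrite ?rmorphN ?rmorph1 ?rmorph0 /= ?map_polyX ?hornerN ?hornerX ?hornerC ?horner0.
Qed.

Lemma det_burau_at x : exists k, forall t, \det (burau_at t x) = (- t) ^+ k.
Proof.
elim/Br3p_ind: x => [|i x [k IH]].
  by exists 0%N => t; rewrite burau_at1 det1.
exists k.+1 => t; rewrite burau_atM det_mulmx IH burau_at_gen exprS; congr (_ * _).
by rewrite det2E; case: i; rewrite !mxE /=; ring.
Qed.

(** At [t = 0] both generators become idempotent and the product of the first by
    the second vanishes, so that few products remain. *)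
Lemma burau_at0 x : burau_at (0 : C) x \in
  [:: 0; 1%:M; mx2 0 1 0 1; mx2 1 0 0 0; mx2 0 1 0 0 : 'M[C]_2].
Proof.
elim/Br3p_ind: x => [|i x]; first by rewrite burau_at1 !inE eqxx orbT.
rewrite burau_atM burau_at_gen oppr0 !inE.
have E (a b c d a' b' c' d' : C) : a = a' -> b = b' -> c = c' -> d = d' ->
    mx2 a b c d == mx2 a' b' c' d' by move=> -> -> -> ->.
have M (a b c d a' b' c' d' : C) : mx2 a b c d *m mx2 a' b' c' d' =
    mx2 (a * a' + b * c') (a * b' + b * d') (c * a' + d * c') (c * b' + d * d').
  by apply: mx2P; rewrite mulmx2E !mxE.
have Z : (0 : 'M[C]_2) = mx2 0 0 0 0 by apply: mx2P; rewrite !mxE.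
have D : (1%:M : 'M[C]_2) = mx2 1 0 0 1 by apply: mx2P; rewrite !mxE.
rewrite Z D => /or4P[/eqP -> | /eqP -> | /eqP -> | /orP[] /eqP ->]; case: i; rewrite M;
  rewrite !(mulr0, mul0r, mulr1, addr0, add0r) ?eqxx ?orbT//.
Qed.

Lemma mnorm_burau_at0 x : burau_at (0 : C) x = 0 \/ 1 <= mnorm (burau_at (0 : C) x) <= 2.
Proof.
have := burau_at0 x; rewrite !inE.
case/or4P => [/eqP -> | /eqP -> | /eqP -> | /orP[] /eqP ->]; [by left|right..].
all: rewrite /mnorm !mxE ?mulr1n ?mulr0n /= ?expr1n ?expr0n ?addr0 ?sqrtr1 ?sqrtr0; lra.
Qed.

End BurauSpecialization.

(** * Equivalence of norms *)

Section NormEquivalence.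
Context {R : realType}.
Local Notation C := R[i].
Variable N : 'M[C]_2 -> R.
Hypothesis hN : is_norm N.

Let ND A B : N (A + B) <= N A + N B. Proof. by case: hN. Qed.
Let NZ (c : C) A : N (c *: A) = normc c * N A. Proof. by case: hN. Qed.
Let N_eq0 A : N A = 0 -> A = 0. Proof. by case: hN => _ _; exact. Qed.

Lemma is_norm_ge0 A : 0 <= N A.
Proof.
have N0 : N 0 = 0 by rewrite -(scale0r (0 : 'M[C]_2)) NZ normc0 mul0r.
have := ND A (- A); rewrite subrr N0 -scaleN1r NZ normcN normc1 mul1r; lra.
Qed.

Lemma is_norm_upper : exists2 K, 0 < K & forall A, N A <= K * mnorm A.
Proof.
pose K := N (mx2 1 0 0 0) + N (mx2 0 1 0 0) + N (mx2 0 0 1 0) + N (mx2 0 0 0 1) + 1.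
have n1 := is_norm_ge0 (mx2 1 0 0 0); have n2 := is_norm_ge0 (mx2 0 1 0 0).
have n3 := is_norm_ge0 (mx2 0 0 1 0); have n4 := is_norm_ge0 (mx2 0 0 0 1).
exists K; first by rewrite /K; lra.
move=> A; have -> : N A = N (A 0 0 *: mx2 1 0 0 0 + A 0 1 *: mx2 0 1 0 0 +
    A 1 0 *: mx2 0 0 1 0 + A 1 1 *: mx2 0 0 0 1).
  by congr N; apply: mx2P; rewrite !mxE /= ?mulr1 ?mulr0 ?addr0 ?add0r.
set a := _ *: mx2 1 0 0 0; set b := _ *: mx2 0 1 0 0.
set c := _ *: mx2 0 0 1 0; set d := _ *: mx2 0 0 0 1.
have := ND (a + b + c) d; have := ND (a + b) c; have := ND a b.
rewrite !NZ /K /mnorm.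
have := normc_ge0 (A 0 0); have := normc_ge0 (A 0 1).
have := normc_ge0 (A 1 0); have := normc_ge0 (A 1 1).
move: (normc (A 0 0)) (normc (A 0 1)) (normc (A 1 0)) (normc (A 1 1)) => x1 x2 x3 x4.
move: (N (mx2 1 0 0 0)) (N (mx2 0 1 0 0)) (N (mx2 0 0 1 0)) (N (mx2 0 0 0 1)) n1 n2 n3 n4.
clear; move=> n1 n2 n3 n4 h1 h2 h3 h4 x40 x30 x20 x10 k1 k2 k3.
apply: le_trans k3 _; apply: le_trans (lerD k2 (lexx _)) _.
apply: le_trans (lerD (lerD k1 (lexx _)) (lexx _)) _.
have -> : (n1 + n2 + n3 + n4 + 1) * (x1 + x2 + x3 + x4) =
  x1 * n1 + x2 * n2 + x3 * n3 + x4 * n4 + (x1 * (n2 + n3 + n4 + 1) + x2 * (n1 + n3 + n4 + 1) +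
  x3 * (n1 + n2 + n4 + 1) + x4 * (n1 + n2 + n3 + 1)) by ring.
by rewrite lerDl !addr_ge0 ?mulr_ge0 ?addr_ge0.
Qed.

(** All norms on a finite-dimensional space are equivalent: along an
   ultrafilter the unit sphere of the reference norm is compact. *)
Lemma is_norm_lower : exists2 k, 0 < k & forall A, mnorm A <= k * N A.
Proof.
apply: contrapT => nk.
have far n : exists A, mnorm A = 1 /\ n.+1%:R * N A < 1.
  apply: contrapT => hn; apply: nk; exists n.+1%:R => // A.
  have [A0|A0] := eqVneq (mnorm A) 0.
    by rewrite A0 mulr_ge0// is_norm_ge0.
  rewrite leNgt; apply/negP => hA; apply: hn.
  have Ap : 0 < mnorm A by rewrite lt_def A0 mnorm_ge0.
  exists ((((mnorm A)^-1)%:C)%C *: A); rewrite mnormZ NZ normc_real ger0_norm ?invr_ge0 ?ltW//.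
  by rewrite mulVf// mulrCA mulrC ltr_pdivrMr// mul1r.
have [A hA] := choice far.
have [U [UU sU]] := @ultraFilterLemma nat \oo _.
have PU : ProperFilter U by exact: ultra_proper.
have UF : Filter U by exact: filter_filter.
have bd k l : exists z, clim U (fun n => A n k l) z.
  apply: (bounded_ultra_lim (K := 1)); apply: nearW => n.
  by rewrite -(hA n).1; exact: ler_entry_mnorm.
have [z00 h00] := bd 0 0; have [z01 h01] := bd 0 1.
have [z10 h10] := bd 1 0; have [z11 h11] := bd 1 1.
pose L := mx2 z00 z01 z10 z11.
have AL : mlim U A L.
  by apply: ord2P; apply: ord2P; rewrite /L mxE.
have L1 : mnorm L = 1.
  have h1 : mnorm (A n) @[n --> U] --> mnorm L by exact: mlim_mnorm.
  have h2 : mnorm (A n) @[n --> U] --> (1 : R).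
    by under eq_fun do rewrite (hA _).1; exact: cvg_cst.
  exact: real_cvg_unique h1 h2.
have [K K0 hK] := is_norm_upper.
have d0 : mnorm (L - A n) @[n --> U] --> (0 : R).
  have h k l : normc (L k l - A n k l) @[n --> U] --> (0 : R).
    rewrite -(normc0 R) -[X in normc X](subrr (L k l)); apply: clim_normc.
    by apply: climB; [exact: clim_cst|exact: AL].
  have -> : (fun n => mnorm (L - A n)) = (fun n => normc (L 0 0 - A n 0 0) +
      normc (L 0 1 - A n 0 1) + normc (L 1 0 - A n 1 0) + normc (L 1 1 - A n 1 1)).
    by apply/funext => n; rewrite /mnorm !mxE.
  have hD := cvgD (cvgD (cvgD (h 0 0) (h 0 1)) (h 1 0)) (h 1 1).
  by rewrite !addr0 in hD; exact: hD.
suff /N_eq0 L0 : N L = 0.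
  by move: L1; rewrite L0 /mnorm !mxE normc0 !addr0 => /eqP; rewrite eq_sym oner_eq0.
apply/eqP; rewrite eq_le is_norm_ge0 andbT; apply/ler_addgt0Pr => e e0; rewrite add0r.
have e2 : 0 < e / 2 by rewrite divr_gt0.
have eK : 0 < e / 2 / K by rewrite divr_gt0.
have near1 := near_lt d0 eK.
have near2 : \forall n \near U, n.+1%:R^-1 < e / 2.
  by apply: sU; exact: (near_infty_natSinv_lt (PosNum e2)).
have /filter_ex[n [/= h1 h2]] : U ([set n | mnorm (L - A n) < e / 2 / K] `&`
    [set n | n.+1%:R^-1 < e / 2]).
  by apply: filterI; [exact: near1|exact: near2].
have := ND (L - A n) (A n); rewrite subrK => h; apply: le_trans h _.
have hL : N (L - A n) <= e / 2.
  by apply: le_trans (hK _) _; rewrite mulrC -ler_pdivlMr// ltW.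
have : N (A n) <= e / 2.
  apply: le_trans (ltW h2); rewrite -[leRHS]mul1r ler_pdivlMr// mulrC.
  by have [_ /ltW] := hA n.
move: hL; clear; lra.
Qed.

Lemma is_norm_ln : exists2 c, 0 <= c & forall A, 0 < mnorm A ->
  0 < N A /\ `|ln (N A) - ln (mnorm A)| <= c.
Proof.
have [K K0 hK] := is_norm_upper; have [k k0 hk] := is_norm_lower.
exists (`|ln K| + `|ln k|); first by rewrite addr_ge0.
move=> A A0; have NA : 0 < N A by rewrite -(pmulr_rgt0 _ k0); exact: lt_le_trans (hk A).
split=> //; have h1 : ln (N A) <= ln K + ln (mnorm A).
  by rewrite -lnM ?posrE// ler_ln ?posrE ?mulr_gt0.
have h2 : ln (mnorm A) <= ln k + ln (N A).
  by rewrite -lnM ?posrE// ler_ln ?posrE ?mulr_gt0.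
have := ler_norm (ln K); have := ler_norm (ln k).
have := normr_ge0 (ln K); have := normr_ge0 (ln k).
rewrite ler_norml; move=> ? ? ? ?; apply/andP; split; lra.
Qed.

End NormEquivalence.

(** * Growth rates *)

Section GrowthRate.
Context {R : realType} {I : finType} (p : I -> R).
Hypothesis p_gt0 : forall i, 0 < p i.
Hypothesis p_sum1 : \sum_i p i = 1.
Variable A : I -> 'M[R[i]]_2.
Hypothesis A_nd : nondegenerate A.

(** Fekete's lemma, by division with remainder by a length at which the infimum
    is nearly attained. The bounded error allows another norm, or a truncation. *)
Lemma growth_cvg (G : nat -> R) (c : R) (n0 : nat) :
  (forall n, (n0 <= n)%N -> `|G n - growth p A n| <= c) ->
  n%:R^-1 * G n @[n --> \oo] --> lexp p A.
Proof.
move=> Gc; apply/cvgrPdist_le => e e0.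
have e2 : 0 < e / 2 by rewrite divr_gt0.
have [m m0 hm] := lexp_approx p_gt0 p_sum1 A_nd e2.
pose l := lexp p A.
pose D : R := m%:R * `|l + e / 2| + \sum_(r < m) `|growth p A r| + `|c|.
have D0 : 0 <= D by rewrite !addr_ge0 ?mulr_ge0 ?sumr_ge0.
have up n : (m <= n)%N -> growth p A n <= n%:R * (l + e / 2) + (D - `|c|).
  move=> mn; have r_lt : (n %% m < m)%N by rewrite ltn_mod.
  rewrite [in leLHS](divn_eq n m).
  apply: le_trans (growthD p_gt0 p_sum1 A_nd _ _) _.
  have d0 : (0 < n %/ m)%N by rewrite divn_gt0.
  have h1 := growth_mul p_gt0 p_sum1 A_nd m d0.
  have h2 : (n %/ m)%:R * growth p A m <= (n %/ m)%:R * (m%:R * (l + e / 2)).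
    by apply: ler_wpM2l => //; exact: ltW.
  have h3 : growth p A (n %% m) <= \sum_(r < m) `|growth p A r|.
    rewrite (bigD1 (Ordinal r_lt))//=; apply: le_trans (ler_norm _) _.
    by rewrite lerDl sumr_ge0.
  have h4 : (n %/ m)%:R * (m%:R * (l + e / 2)) <= n%:R * (l + e / 2) + m%:R * `|l + e / 2|.
    have -> : n%:R = (n %/ m)%:R * m%:R + (n %% m)%:R :> R by rewrite -natrM -natrD -divn_eq.
    rewrite mulrDl mulrA -addrA lerDl.
    rewrite -lerBlDl sub0r; apply: le_trans (_ : (n %% m)%:R * `|l + e / 2| <= _); last first.
      by rewrite ler_wpM2r// ler_nat ltnW.
    by rewrite -mulrN ler_wpM2l// -normrN ler_norm.
  by rewrite /D addrK; move: h1 h2 h3 h4; clear; lra.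
have [n1 hn1] : exists n1 : nat, forall n, (n1 <= n)%N -> D <= n%:R * (e / 2).
  exists (Num.truncn (D / (e / 2))).+1 => n hn.
  rewrite -ler_pdivrMr//; apply/ltW; apply: lt_le_trans (truncnS_gt _) _.
  by rewrite ler_nat.
near=> n.
have mn : (m <= n)%N by near: n; exact: nbhs_infty_ge.
have nn : (n1 <= n)%N by near: n; exact: nbhs_infty_ge.
have n00 : (n0 <= n)%N by near: n; exact: nbhs_infty_ge.
have n_gt0 : (0 < n)%N by exact: leq_trans mn.
have n0R : 0 < n%:R :> R by rewrite ltr0n.
have hu := up n mn; have hD := hn1 n nn; have hl := lexp_le p_gt0 p_sum1 A_nd n_gt0.
have := Gc n n00; rewrite ler_norml => /andP[g1 g2]; have cc := ler_norm c.
rewrite distrC ler_distl -/l; apply/andP; split.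
  rewrite mulrC ler_pdivlMr//; rewrite -/l in hl.
  have hc : `|c| <= n%:R * (e / 2).
    by apply: le_trans hD; rewrite /D lerDr addr_ge0 ?mulr_ge0 ?sumr_ge0.
  have := mulr_ge0 (ltW n0R) (ltW e0).
  move: hl g1 cc hc; clear; move: n%:R => x; lra.
rewrite mulrC ler_pdivrMr//.
by move: hu hD g2 cc; clear; move: n%:R => x; lra.
Unshelve. all: by end_near.
Qed.

End GrowthRate.

(** * The Lyapunov exponent of the walk *)

Section LyapunovFormula.
Context {R : realType} {d : measure_display} {T : measurableType d} (P : probability T R).
Variables (mu : probability Br3p R) (g : nat -> {RV P >-> Br3p}).
Hypothesis hg : iid_with_law g mu.
Variable N : 'M[R[i]]_2 -> R.
Hypothesis hN : is_norm N.
Variables (k : nat) (s : 'I_k -> Br3p) (p : 'I_k -> R).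
Hypothesis s_inj : injective s.
Hypothesis p_gt0 : forall i, 0 < p i.
Hypothesis p_sum1 : \sum_i p i = 1.
Hypothesis mu_s : forall i, mu [set s i] = (p i)%:E.
Local Notation C := R[i].
Implicit Types (t : C) (w : seq 'I_k).

Definition family t (i : 'I_k) : 'M[C]_2 := burau_at t (s i).

Lemma burau_at_prod t w : burau_at t (\prod_(i <- w) s i)%g = wprod (family t) (rev w).
Proof.
elim: w => [|i w IH]; first by rewrite big_nil burau_at1.
by rewrite big_cons burau_atM IH rev_cons -cats1 wprod_cat /= mul1mx.
Qed.

Lemma wprod_family t w : wprod (family t) w = burau_at t (\prod_(i <- rev w) s i)%g.
Proof. by rewrite burau_at_prod revK. Qed.

Lemma integral_lne_walk t n : (forall w, size w = n -> 0 < mnorm (wprod (family t) w)) ->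
  (\int[P]_x lne (N (burau_at t (walk g n x)))%:E =
   (expect p n (fun w => ln (N (wprod (family t) w))))%:E)%E.
Proof.
move=> tw; have [c _ ln_N] := is_norm_ln hN.
rewrite (@integral_walk_fin _ _ _ _ _ _ hg _ _ _ s_inj p_sum1 mu_s n
  (fun b => lne (N (burau_at t b))%:E) (fun w => ln (N (wprod (family t) (rev w))))).
  by congr EFin; exact: expect_rev.
move=> w sw; rewrite burau_at_prod lne_EFin//.
by have [] := ln_N _ (tw (rev w) _); rewrite ?size_rev.
Qed.

Lemma ln_norm_growth t n c : (forall A, 0 < mnorm A -> `|ln (N A) - ln (mnorm A)| <= c) ->
  (forall w, size w = n -> 0 < mnorm (wprod (family t) w)) ->
  `|expect p n (fun w => ln (N (wprod (family t) w))) - growth p (family t) n| <= c.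
Proof.
move=> hc tw; rewrite /growth -expectB; apply: le_trans (ler_norm_expect p_gt0 _ _) _.
by apply: (expect_le p_gt0 p_sum1) => w /tw; exact: hc.
Qed.

Lemma lyapunov_nondegenerate t : nondegenerate (family t) ->
  lyapunov N g t = (lexp p (family t))%:E.
Proof.
move=> nd; have [c c0 ln_N] := is_norm_ln hN.
have tw n w : size w = n -> 0 < mnorm (wprod (family t) w).
  by move=> _; exact: mnorm_wprod_gt0.
rewrite /lyapunov; under eq_fun do rewrite (integral_lne_walk (tw _)) -EFinM.
apply/cvg_lim => //; apply: cvg_EFin; first by apply: nearW.
apply: (growth_cvg p_gt0 p_sum1 nd (c := c) (n0 := 0%N)) => n _.
by apply: ln_norm_growth (tw n) => A A0; have [] := ln_N A A0.
Qed.

Lemma lyapunov_bounded t (m M : R) : 0 < m ->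
  (forall w, m <= mnorm (wprod (family t) w) <= M) -> lyapunov N g t = 0%E.
Proof.
move=> m0 hw; have [c c0 ln_N] := is_norm_ln hN.
have tw n w : size w = n -> 0 < mnorm (wprod (family t) w).
  by move=> _; apply: lt_le_trans m0 _; have /andP[] := hw w.
rewrite /lyapunov; under eq_fun do rewrite (integral_lne_walk (tw _)) -EFinM.
apply/cvg_lim => //; apply: cvg_EFin; first by apply: nearW.
pose b := c + `|ln m| + `|ln M|.
have bd n : `|expect p n (fun w => ln (N (wprod (family t) w)))| <= b.
  apply: le_trans (ler_norm_expect p_gt0 _ _) _; apply: (expect_le p_gt0 p_sum1) => w sw.
  have [_ h] := ln_N _ (tw n w sw); have /andP[h1 h2] := hw w.
  have w0 := tw n w sw.
  have g1 : ln m <= ln (mnorm (wprod (family t) w)) by rewrite ler_ln ?posrE.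
  have g2 : ln (mnorm (wprod (family t) w)) <= ln M.
    by rewrite ler_ln ?posrE//; exact: lt_le_trans h2.
  move: h; rewrite /b !ler_norml => /andP[? ?].
  have := ler_norm (ln M); have := ler_norm (- ln m); rewrite normrN.
  have := normr_ge0 (ln M); have := normr_ge0 (ln m).
  by move=> ? ? ? ?; apply/andP; split; lra.
apply/cvgrPdist_le => e e0; near=> n.
rewrite sub0r normrN normrM ger0_norm ?invr_ge0//.
have n0 : 0 < n%:R :> R by rewrite ltr0n; near: n; exact: nbhs_infty_gt.
rewrite mulrC ler_pdivrMr//; apply: le_trans (bd n) _.
have : (Num.truncn (b / e) < n)%N by near: n; exact: nbhs_infty_gt.
rewrite -(ler_nat R) => h; rewrite mulrC -ler_pdivrMr//.
by apply/ltW; apply: lt_le_trans h; exact: truncnS_gt.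
Unshelve. all: by end_near.
Qed.

Lemma lyapunov_zero_word t w0 : wprod (family t) w0 = 0 -> lyapunov N g t = -oo%E.
Proof.
move=> w00.
have [i0 i0w] : exists i0, i0 \in w0.
  case: w0 w00 => [/matrixP/(_ 0 0)|i w _]; last by exists i; rewrite inE eqxx.
  by rewrite !mxE /= => /eqP; rewrite oner_eq0.
rewrite /lyapunov; apply/cvg_lim => //.
apply: (@cvg_near_cst _ _ -oo%E); near=> n.
have wn : (size w0 <= n)%N by near: n; exact: nbhs_infty_ge.
have n0 : (0 < n)%N.
  by apply: leq_trans wn; case: (w0) i0w.
pose w := rev (w0 ++ nseq (n - size w0) i0).
rewrite (@integral_walk_Ny _ _ _ _ _ _ hg _ _ _ s_inj p_gt0 p_sum1 mu_s n
  (fun b => lne (N (burau_at t b))%:E) w).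
- by rewrite gt0_muleNy// lte_fin invr_gt0 ltr0n.
- by move=> b; rewrite /=; case: ifP => _; rewrite ?ltry.
- by rewrite size_rev size_cat size_nseq subnKC.
- rewrite burau_at_prod revK wprod_cat w00 mulmx0.
  have -> : N 0 = 0 by rewrite -(scale0r (0 : 'M[C]_2)); case: hN => _ -> _; rewrite normc0 mul0r.
  by rewrite /= lexx.
Unshelve. all: by end_near.
Qed.

(** At [t = 0] either all the products stay in a finite set of matrices other
   than zero, or some word has product zero. *)
Lemma lyapunov0 : (forall w, 1 <= mnorm (wprod (family (0 : C)) w) <= 2) /\ lyapunov N g 0 = 0%E \/
  (exists w0, wprod (family (0 : C)) w0 = 0) /\ lyapunov N g 0 = -oo%E.
Proof.
have [[w0 hw0]|h] := pselect (exists w0, wprod (family (0 : C)) w0 = 0); [right|left].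
  by split; [exists w0|exact: lyapunov_zero_word hw0].
have hw w : 1 <= mnorm (wprod (family (0 : C)) w) <= 2.
  rewrite wprod_family; case: (@mnorm_burau_at0 R (\prod_(i <- rev w) s i)%g) => // h0.
  by exfalso; apply: h; exists w; rewrite wprod_family.
by split=> //; apply: (@lyapunov_bounded _ 1 2).
Qed.

Lemma det_family : exists e : 'I_k -> nat, forall t i, \det (family t i) = (- t) ^+ e i.
Proof. by have [e he] := choice (fun i => @det_burau_at R (s i)); exists e => t i; exact: he. Qed.

Lemma family_nondegenerate t : t != 0 -> nondegenerate (family t).
Proof. by have [e he] := det_family; move=> t0 i; rewrite he expf_neq0// oppr_eq0. Qed.

Lemma mlim_family (z : R * R) i : mlim (nbhs z) (fun y => family (toC y) i) (family (toC z) i).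
Proof.
move=> a b; rewrite burau_atE; under eq_fun do rewrite burau_atE.
by apply: clim_horner; exact: clim_toC.
Qed.

End LyapunovFormula.

(** * Approximation of the exponent by submean functions *)

Section TruncatedLogarithm.
Context {R : realType}.
Local Notation C := R[i].

(** The logarithm of the largest entry, truncated at [m]. In contrast with the
    [mnorm], it is a maximum of logarithms of moduli of single entries, hence
    submean when these are polynomials. *)
Definition logent (m : R) (A : 'M[C]_2) : R :=
  Num.max (Num.max (ln (Num.max (normc (A 0 0)) m)) (ln (Num.max (normc (A 0 1)) m)))
          (Num.max (ln (Num.max (normc (A 1 0)) m)) (ln (Num.max (normc (A 1 1)) m))).

Lemma logent_ge (m : R) A : 0 < m -> 0 < mnorm A -> ln (mnorm A) - ln 4 <= logent m A.
Proof.
move=> m0 A0; have le_ent k l : normc (A k l) <= expR (logent m A).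
  have m1 : 0 < Num.max (normc (A k l)) m by rewrite lt_max m0 orbT.
  apply: (@le_trans _ _ (Num.max (normc (A k l)) m)); first by rewrite le_max lexx.
  rewrite -[leLHS]lnK ?posrE// ler_expR /logent !le_max.
  by move: k l m1; apply: ord2P; apply: ord2P => _; rewrite lexx ?orbT.
rewrite lerBlDr -[logent m A]expRK -lnM ?posrE ?expR_gt0//.
rewrite ler_ln ?posrE ?mulr_gt0 ?expR_gt0// /mnorm.
have := le_ent 0 0; have := le_ent 0 1; have := le_ent 1 0; have := le_ent 1 1.
lra.
Qed.

Lemma logent_le (m : R) A B : 0 < m -> m <= B -> mnorm A <= B -> logent m A <= ln B.
Proof.
move=> m0 mB AB.
have h k l : ln (Num.max (normc (A k l)) m) <= ln B.
  have m1 : 0 < Num.max (normc (A k l)) m by rewrite lt_max m0 orbT.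
  rewrite ler_ln ?posrE//; last exact: lt_le_trans mB.
  by rewrite ge_max mB andbT; apply: le_trans AB; exact: ler_entry_mnorm.
by rewrite /logent !ge_max !h.
Qed.

End TruncatedLogarithm.

Section WordProbability.
Context {R : realType} {I : finType} (p : I -> R).
Hypothesis p_gt0 : forall i, 0 < p i.

Lemma expect_word n (w0 : seq I) : size w0 = n ->
  0 < expect p n (fun w => (w == w0)%:R).
Proof.
move=> sw; rewrite expect_words (bigD1_seq w0) ?words_uniq ?mem_words ?sw//=.
rewrite eqxx mulr1 [X in _ + X]big1 => [|w /negPf ->]; last by rewrite mulr0.
by rewrite addr0 prodr_gt0.
Qed.

End WordProbability.

Section Approximation.
Context {R : realType}.
Variables (k : nat) (s : 'I_k -> Br3p) (p : 'I_k -> R).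
Hypothesis p_gt0 : forall i, 0 < p i.
Hypothesis p_sum1 : \sum_i p i = 1.
Local Notation C := R[i].
Implicit Types (t : C) (w : seq 'I_k) (z : R * R).
Local Notation A := (@family R k s).

(** The truncation at [e^(-n^2)] is eventually inactive at each point other than
    the origin, since the norm of a product of [n] matrices is bounded below by an
    exponential in [n]. *)
Definition approximant n z : R := n.+1%:R^-1 *
  expect p n.+1 (fun w => logent (expR (- n.+1%:R ^+ 2)) (wprod (A (toC z)) w)).

Lemma submean_approximant n : submean (approximant n).
Proof.
apply: submeanZ; first by rewrite invr_ge0.
apply: submean_expect => // w.
have sE a b : submean (fun z => ln (Num.max (normc (wprod (A (toC z)) w a b))
    (expR (- n.+1%:R ^+ 2)))).
  under eq_fun do rewrite wprod_family burau_atE.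
  by apply: submean_ln_poly; exact: expR_gt0.
by apply: submean_max; apply: submean_max; exact: sE.
Qed.

Definition pole_part z : R := Num.max 0 (- ln (normc (toC z))).

(** The determinant of each matrix is a power of [- t], and it is bounded by the
    square of the norm. *)
Lemma ln_mnorm_family_ge : exists2 e : R, 0 <= e & forall z w, z != (0, 0) ->
  - ((size w)%:R * (e * pole_part z)) <= ln (mnorm (wprod (A (toC z)) w)).
Proof.
have [e he] := @det_family R k s.
have [E EE] : exists E, E = \sum_i (e i)%:R :> R by eexists.
have E0 : 0 <= E by rewrite EE sumr_ge0.
exists E => //.
move=> z w z0; set t := toC z; set L := pole_part z.
have t0 : 0 < normc t by exact: toC_eq0.
have nd : nondegenerate (A t) by apply: family_nondegenerate; rewrite -normc_gt0.
have L0 : 0 <= L by rewrite /L le_max lexx.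
have L1 : - ln (normc t) <= L by rewrite /L le_max lexx orbT.
have hdet : - ((size w)%:R * (E * L)) <= ln (normc (\det (wprod (A t) w))).
  rewrite (ln_det_wprod nd); elim: w => [|i w IH]; first by rewrite big_nil mul0r oppr0.
  rewrite big_cons /= -natr1 mulrDl mul1r opprD addrC; apply: lerD => //.
  rewrite he normcX normcN lnXn// lerNl -mulNrn -mulr_natl.
  apply: le_trans (_ : (e i)%:R * L <= _); first by rewrite ler_wpM2l.
  by rewrite ler_wpM2r// EE (bigD1 i)//= lerDl sumr_ge0.
have dw : 0 < normc (\det (wprod (A t) w)) by rewrite normc_gt0 det_wprod_neq0.
have mw : 0 < mnorm (wprod (A t) w) by exact: mnorm_wprod_gt0.
have : ln (normc (\det (wprod (A t) w))) <= 2 * ln (mnorm (wprod (A t) w)).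
  by rewrite mulr_natl -lnXn// ler_ln ?posrE ?exprn_gt0//; exact: det_mnorm.
have : 0 <= (size w)%:R * (E * L) by rewrite !mulr_ge0.
move: hdet; lra.
Qed.

Lemma mnorm_family_le (rho : R) : exists2 B : R, 1 <= B &
  forall z w, box rho z -> mnorm (wprod (A (toC z)) w) <= 2 * B ^+ size w.
Proof.
have bd i : exists K : R, 0 <= K /\ forall z, box rho z -> mnorm (A (toC z) i) <= K.
  have [|K K0 hK] := @continuous_bounded_box R (fun z => mnorm (A (toC z) i)) rho.
    by move=> z; apply: mlim_mnorm; exact: mlim_family.
  by exists K; split=> // z bz; apply: le_trans (hK z bz); exact: ler_norm.
have [K hK] := choice bd.
have S0 : 0 <= \sum_i K i by rewrite sumr_ge0// => i _; case: (hK i).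
exists (1 + \sum_i K i); first by rewrite lerDl.
move=> z w bz; elim: w => [|i w IH]; first by rewrite /= mnorm1 mulr1.
rewrite /= exprSr mulrA; apply: le_trans (mnormM _ _) _.
apply: ler_pM; rewrite ?mnorm_ge0//.
have [_ /(_ z bz) h] := hK i; apply: le_trans h _.
rewrite (bigD1 i)//= addrCA lerDl addr_ge0// sumr_ge0// => j _.
by case: (hK j).
Qed.

Lemma approximant_bound (rho : R) : exists K : R, forall n z, box rho z -> z != (0, 0) ->
  `|approximant n z| <= K * (1 + pole_part z).
Proof.
have [e e0 he] := ln_mnorm_family_ge; have [B B1 hB] := mnorm_family_le rho.
have B0 : 0 < B by exact: lt_le_trans B1.
have lB : 0 <= ln B by rewrite ln_ge0.
have l2 : 0 <= ln 2 :> R by exact: ln2_ge0.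
have l4 : 0 <= ln 4 :> R by rewrite ln_ge0// ler1n.
exists (ln 2 + ln B + ln 4 + e) => n z bz z0; set L := pole_part z.
have L0 : 0 <= L by rewrite /L le_max lexx.
have t0 : 0 < normc (toC z) by exact: toC_eq0.
have nd : nondegenerate (A (toC z)) by apply: family_nondegenerate; rewrite -normc_gt0.
have n0 : 1 <= n.+1%:R :> R by rewrite ler1n.
have n00 : 0 < n.+1%:R :> R by exact: lt_le_trans n0.
have up : expect p n.+1 (fun w => logent (expR (- n.+1%:R ^+ 2)) (wprod (A (toC z)) w)) <=
    ln 2 + n.+1%:R * ln B.
  apply: (expect_le p_gt0 p_sum1) => w sw.
  have -> : ln 2 + n.+1%:R * ln B = ln (2 * B ^+ n.+1).
    by rewrite lnM ?posrE ?exprn_gt0// lnXn// mulr_natl.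
  apply: logent_le; rewrite ?expR_gt0//; last by rewrite -sw; exact: hB.
  apply: (@le_trans _ _ 1); first by rewrite -[leRHS]expR0 ler_expR oppr_le0 sqr_ge0.
  have : 1 <= B ^+ n.+1 by rewrite exprn_ege1.
  lra.
have lo : - (n.+1%:R * (e * L)) - ln 4 <=
    expect p n.+1 (fun w => logent (expR (- n.+1%:R ^+ 2)) (wprod (A (toC z)) w)).
  apply: (expect_ge p_gt0 p_sum1) => w sw.
  apply: le_trans (logent_ge (expR_gt0 _) (mnorm_wprod_gt0 nd w)).
  by rewrite lerD2r -sw; exact: he.
rewrite /approximant; move: (expect _ _ _) up lo => G up lo.
have eL := mulr_ge0 e0 L0.
have K1 : ln 2 + ln B + ln 4 + e * L <= (ln 2 + ln B + ln 4 + e) * (1 + L).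
  rewrite -subr_ge0 (_ : _ - _ = (ln 2 + ln B + ln 4) * L + e); last by ring.
  by rewrite addr_ge0// mulr_ge0// !addr_ge0.
apply: le_trans K1.
rewrite normrM normfV [ `|_%:R| ]ger0_norm ?ler0n// [leLHS]mulrC ler_pdivrMr//.
have h2 := ler_peMl l2 n0; have h4 := ler_peMl l4 n0.
have hL := mulr_ge0 (ltW n00) eL; have hB' := mulr_ge0 (ltW n00) lB.
rewrite ler_norml; move: l2 l4 up lo h2 h4 hL hB'; clear; move: n.+1%:R (ln 2) (ln B) (ln 4) (e * L).
by move=> x a b c f h7 h8 h1 h2 h3 h4 h5 h6; apply/andP; split; lra.
Qed.

Lemma approximant_cvg z : z != (0, 0) ->
  approximant n z @[n --> \oo] --> lexp p (A (toC z)).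
Proof.
move=> z0; have [e e0 he] := ln_mnorm_family_ge; set L := pole_part z.
have t0 : 0 < normc (toC z) by exact: toC_eq0.
have nd : nondegenerate (A (toC z)) by apply: family_nondegenerate; rewrite -normc_gt0.
have L0 : 0 <= L by rewrite /L le_max lexx.
pose G n := expect p n (fun w => logent (expR (- n%:R ^+ 2)) (wprod (A (toC z)) w)).
suff : n%:R^-1 * G n @[n --> \oo] --> lexp p (A (toC z)) by rewrite -(cvg_shiftS).
apply: (growth_cvg p_gt0 p_sum1 nd (c := ln 4) (n0 := (Num.truncn (e * L)).+1)) => n hn.
have nL : e * L <= n%:R.
  by apply/ltW; apply: lt_le_trans (truncnS_gt _) _; rewrite ler_nat.
rewrite /G /growth -expectB; apply: le_trans (ler_norm_expect p_gt0 _ _) _.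
apply: (expect_le p_gt0 p_sum1) => w sw.
have mw := mnorm_wprod_gt0 nd w.
have mle : expR (- n%:R ^+ 2) <= mnorm (wprod (A (toC z)) w).
  rewrite -[leRHS]lnK ?posrE// ler_expR; apply: le_trans (he z w z0).
  by rewrite sw lerN2 -/L expr2 ler_wpM2l.
have := logent_le (expR_gt0 _) mle (lexx _).
have := logent_ge (expR_gt0 (- n%:R ^+ 2)) mw.
rewrite ler_norml => h1 h2; apply/andP; split; first by move: h1; clear; lra.
have : 0 <= ln 4 :> R by rewrite ln_ge0// ler1n.
move: h2; clear; lra.
Qed.

End Approximation.

(** * Regularity of the exponent and of its modification *)

Section Regularity.
Context {R : realType} {d : measure_display} {T : measurableType d} (P : probability T R).
Variables (mu : probability Br3p R) (g : nat -> {RV P >-> Br3p}).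
Hypothesis hg : iid_with_law g mu.
Variable N : 'M[R[i]]_2 -> R.
Hypothesis hN : is_norm N.
Variables (k : nat) (s : 'I_k -> Br3p) (p : 'I_k -> R).
Hypothesis s_inj : injective s.
Hypothesis p_gt0 : forall i, 0 < p i.
Hypothesis p_sum1 : \sum_i p i = 1.
Hypothesis mu_s : forall i, mu [set s i] = (p i)%:E.
Implicit Types (z : R * R).
Local Notation A := (@family R k s).
Local Notation lambda z := (lyapunov N g (toC z)).
Local Notation L z := (lexp p (A (toC z))).
Local Notation O := ((0, 0) : R * R).

Let nondeg z : z != O -> nondegenerate (A (toC z)).
Proof. by move=> z0; apply: family_nondegenerate; rewrite -normc_gt0 toC_eq0. Qed.

Lemma lyapunovE z : z != O -> lambda z = (L z)%:E.
Proof.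
by move=> z0; apply: (lyapunov_nondegenerate hg hN s_inj p_gt0 p_sum1 mu_s); exact: nondeg.
Qed.

Lemma near_neq0 z : z != O -> \forall w \near z, w != O.
Proof.
move=> z0; have : nbhs z (~` [set O]).
  apply: open_nbhs_nbhs; split; last by move=> zO; rewrite zO eqxx in z0.
  by apply: closed_openC; apply: accessible_closed_set1; exact: hausdorff_accessible.
by apply: filterS => w /eqP.
Qed.

Lemma lexp_continuous_at z : z != O -> L w @[w --> z] --> L z.
Proof.
by move=> z0; apply: (lexp_continuous p_gt0 p_sum1 (fun i => mlim_family s z i) (nondeg z0)).
Qed.

Lemma lyapunov_continuous_at z : z != O ->
  {for z, continuous (fun w : R * R => lambda w)}.
Proof.
move=> z0; suff : lambda w @[w --> z] --> (L z)%:E by rewrite -(lyapunovE z0).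
have h : (L w)%:E @[w --> z] --> (L z)%:E.
  by apply: cvg_EFin; [exact: nearW|exact: lexp_continuous_at].
apply: cvg_trans h; apply: near_eq_cvg.
by apply: filterS (near_neq0 z0) => w w0; rewrite (lyapunovE w0).
Qed.

Let toC0 : toC O = 0 :> R[i]. Proof. by []. Qed.

(** By subadditivity the growth over one fixed length bounds the exponent, so it
    suffices to dominate this growth by a continuous function. *)
Let near_origin (m : nat) (c : R) (F : R * R -> R) : (0 < m)%N ->
  F w @[w --> O] --> F O -> F O < m%:R * c ->
  (forall z, z != O -> growth p (A (toC z)) m <= F z) ->
  \forall w \near O, w != O -> (lambda w < c%:E)%E.
Proof.
move=> m0 cF F0 hF.
have : \forall w \near O, F w < m%:R * c by exact: (near_lt cF F0).
apply: filterS => w hw w0.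
rewrite lyapunovE// lte_fin -(@ltr_pM2l _ m%:R) ?ltr0n//.
apply: le_lt_trans hw; apply: le_trans (hF w w0).
by apply: lexp_le => //; exact: nondeg.
Qed.

Let mnorm_cvg (w : seq 'I_k) :
  mnorm (wprod (A (toC z)) w) @[z --> O] --> mnorm (wprod (A (0 : R[i])) w).
Proof. by apply: mlim_mnorm; apply: mlim_wprod => i; exact: mlim_family. Qed.

(** If no product vanishes at the origin, the growth over a long word is continuous
    there and small compared with the length. Otherwise the word with product zero
    makes the truncated growth as negative as desired. *)
Lemma lyapunov_usc_origin (c : R) : (lambda O < c%:E)%E ->
  \forall w \near O, (lambda w < c%:E)%E.
Proof.
move=> l0; suff : \forall w \near O, w != O -> (lambda w < c%:E)%E.
  by apply: filterS => w hw; have [->//|/hw] := eqVneq w O.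
move: l0; rewrite toC0.
case: (lyapunov0 hg hN s_inj p_gt0 p_sum1 mu_s) => [[hw ->]|[[w0 hw0] ->]].
  rewrite lte_fin => c0.
  pose m := (Num.truncn (ln 2 / c)).+1.
  have mc : ln 2 < m%:R * c by rewrite -ltr_pdivrMr//; exact: truncnS_gt.
  apply: (@near_origin m c (fun z => growth p (A (toC z)) m)) => //.
    apply: cvg_expect => w; apply: cvg_ln; last exact: mnorm_cvg.
    by apply: lt_le_trans ltr01 _; rewrite toC0; have /andP[] := hw w.
  apply: le_lt_trans mc; apply: (expect_le p_gt0 p_sum1) => w _.
  have /andP[h1 h2] := hw w; rewrite toC0.
  by rewrite ler_ln ?posrE//; exact: lt_le_trans h1.
have m0 : (0 < size w0)%N.
  case: w0 hw0 => // /matrixP/(_ 0 0).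
  by rewrite !mxE /= => /eqP; rewrite oner_eq0.
move=> _; pose m := size w0.
have q0 := expect_word p_gt0 (erefl m).
set q := expect _ _ _ in q0.
(* the truncation level M makes the word w0, of weight q, outweigh the others *)
pose M := Num.max 0 ((ln 2 - m%:R * c) / q) + 1.
have M0 : 0 < M by rewrite ltr_wpDl// le_max lexx.
have Mq : ln 2 - M * q < m%:R * c.
  have : (ln 2 - m%:R * c) / q < M.
    by rewrite (@le_lt_trans _ _ (Num.max 0 ((ln 2 - m%:R * c) / q)))// ?ltrDl// le_max lexx orbT.
  by rewrite ltr_pdivrMr// => h; lra.
have eM0 := expR_gt0 (- M).
have maxp (x : R) : 0 < Num.max x (expR (- M)) by rewrite lt_max eM0 orbT.
apply: (@near_origin m c (fun z => expect p m (fun w =>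
    ln (Num.max (mnorm (wprod (A (toC z)) w)) (expR (- M)))))) => //.
- apply: cvg_expect => w; apply: cvg_ln => //.
  by apply: cvg_max_real; [exact: mnorm_cvg|exact: cvg_cst].
- apply: le_lt_trans Mq; rewrite -(expect_cst p_sum1 m (ln 2)) /q -expectZ -expectB.
  apply: (le_expect p_gt0) => w _; rewrite toC0.
  have eM1 : expR (- M) <= 1 by rewrite -[leRHS]expR0 ler_expR oppr_le0 ltW.
  have [->|ww0] := eqVneq w w0.
    have -> : Num.max (mnorm (wprod (A (0 : R[i])) w0)) (expR (- M)) = expR (- M).
      rewrite hw0; apply/max_idPr; rewrite /mnorm !mxE normc0 !addr0; exact: ltW.
    rewrite expRK mulr1; have := @ln2_ge0 R; lra.
  rewrite mulr0 subr0 ler_ln ?posrE//.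
  rewrite ge_max (le_trans eM1) ?ler1n// andbT wprod_family.
  case: (@mnorm_burau_at0 R (\prod_(i <- rev w) s i)%g) => [->|/andP[]//].
  by rewrite /mnorm !mxE normc0 !addr0.
- move=> z z0; apply: (le_expect p_gt0) => w _.
  rewrite ler_ln ?posrE//; first by rewrite le_max lexx.
  exact: (mnorm_wprod_gt0 (nondeg z0)).
Qed.

Lemma lyapunov_usc : upper_semicontinuous setT (fun z : R * R => lambda z).
Proof.
move=> z _; have [->|z0] := eqVneq z O.
  split; last exact: lyapunov_usc_origin.
  by rewrite toC0; case: (lyapunov0 hg hN s_inj p_gt0 p_sum1 mu_s) => -[_ ->]; rewrite ?ltry ?ltNyr.
split; first by rewrite lyapunovE// ltry.
move=> a; rewrite lyapunovE// lte_fin => La.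
have h : \forall w \near z, L w < a by exact: (near_lt (lexp_continuous_at z0) La).
by apply: filterS2 (near_neq0 z0) h => w w0 hw; rewrite lyapunovE// lte_fin.
Qed.

Definition lplus z : R := ln (Num.max (normc (toC z)) 1).

Lemma log_plusE z : log_plus (toC z) = (lplus z)%:E.
Proof.
rewrite /log_plus /lplus /lne /=; case: ifP => h.
  by rewrite maxeNy (_ : Num.max _ _ = 1) ?ln1//; apply/max_idPr; exact: le_trans ler01.
rewrite -EFin_max; congr EFin; move/negbT: h; rewrite -ltNge => h.
have [n1|n1] := lerP (normc (toC z)) 1.
  by rewrite ln1; apply/max_idPl; rewrite ln_le0.
by apply/max_idPr; rewrite ln_ge0// ltW.
Qed.

Lemma lplus_ge0 z : 0 <= lplus z.
Proof. by rewrite ln_ge0// le_max lexx orbT. Qed.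

Lemma lplus0 : lplus O = 0.
Proof. by rewrite /lplus toC0 normc0 (_ : Num.max _ _ = 1) ?ln1//; apply/max_idPr. Qed.

Lemma submean_lplus : submean lplus.
Proof.
have := @submean_ln_poly R 'X 1 ltr01.
by under eq_fun do rewrite hornerX.
Qed.

(** The modified exponent is finite everywhere: at the origin both entries of the
    maximum are at most 0, and one is 0. *)
Let chiR z : R := if z == O then 0 else Num.max (L z) (lplus z).

Lemma chiE z : chi N g (toC z) = (chiR z)%:E.
Proof.
rewrite /chi log_plusE /chiR; case: eqVneq => [->|z0]; last by rewrite lyapunovE// -EFin_max.
rewrite lplus0 toC0; case: (lyapunov0 hg hN s_inj p_gt0 p_sum1 mu_s) => -[_ ->].
  by rewrite maxxx.
by rewrite maxNye.
Qed.

Lemma chiR_continuous : continuous chiR.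
Proof.
have [clp _] := submean_lplus.
move=> z; rewrite /continuous_at; have [->|z0] := eqVneq z O; last first.
  have h : Num.max (L w) (lplus w) @[w --> z] --> Num.max (L z) (lplus z).
    by apply: cvg_max_real; [exact: lexp_continuous_at|exact: clp].
  have -> : chiR z = Num.max (L z) (lplus z) by rewrite /chiR (negPf z0).
  apply: cvg_trans h; apply: near_eq_cvg.
  by apply: filterS (near_neq0 z0) => w w0; rewrite /chiR (negPf w0).
have -> : chiR O = 0 by rewrite /chiR eqxx.
apply/cvgrPdist_lt => e e0.
have h1 : \forall w \near O, (lambda w < e%:E)%E.
  apply: lyapunov_usc_origin; rewrite toC0.
  by case: (lyapunov0 hg hN s_inj p_gt0 p_sum1 mu_s) => -[_ ->]; rewrite ?lte_fin ?ltNyr.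
have h2 : \forall w \near O, lplus w < e.
  by apply: (near_lt (clp O)); rewrite lplus0.
apply: filterS2 h1 h2 => w hw1 hw2; rewrite sub0r normrN /chiR.
case: eqVneq => [_|w0]; first by rewrite normr0.
rewrite ger0_norm; last by rewrite le_max lplus_ge0 orbT.
by rewrite gt_max hw2 andbT; move: hw1; rewrite lyapunovE// lte_fin.
Qed.

Lemma chi_continuous : continuous (fun z : R * R => chi N g (toC z)).
Proof.
move=> z; rewrite /continuous_at chiE; under eq_fun do rewrite chiE.
by apply: cvg_EFin; [exact: nearW|exact: chiR_continuous].
Qed.

Lemma chi_usc : upper_semicontinuous setT (fun z : R * R => chi N g (toC z)).
Proof.
move=> z _; rewrite chiE; split; first exact: ltry.
move=> a; rewrite lte_fin => h.
have cz : chiR w @[w --> z] --> chiR z by exact: chiR_continuous.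
have : \forall w \near z, chiR w < a by exact: (near_lt cz h).
by apply: filterS => w; rewrite chiE lte_fin.
Qed.

Lemma lyapunov_subharmonic : subharmonic setT (fun z : R * R => lambda z).
Proof.
split; last exact: lyapunov_usc.
apply: (@weakly_subharmonic_limit R (@approximant R k s p)).
- by move=> n; exact: submean_approximant.
- move=> z z0; rewrite lyapunovE//; apply: cvg_EFin; first exact: nearW.
  exact: approximant_cvg.
- exact: approximant_bound.
- exact: lyapunov_usc.
Qed.

Lemma chi_subharmonic : subharmonic setT (fun z : R * R => chi N g (toC z)).
Proof.
split; last exact: chi_usc.
apply: (@weakly_subharmonic_limit R (fun n z => Num.max (@approximant R k s p n z) (lplus z))).
- by move=> n; apply: submean_max; [exact: submean_approximant|exact: submean_lplus].
- move=> z z0; rewrite chiE /chiR (negPf z0); apply: cvg_EFin; first exact: nearW.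
  by apply: cvg_max_real; [exact: approximant_cvg|exact: cvg_cst].
- move=> rho; have [K hK] := approximant_bound s p_gt0 p_sum1 rho.
  have [clp _] := submean_lplus.
  have [M M0 hM] := continuous_bounded_box rho clp.
  exists (K + M) => n z bz z0.
  have h1 := hK n z bz z0; have h2 := hM z bz.
  have L0 : 0 <= Num.max 0 (- ln (normc (toC z))) by rewrite le_max lexx.
  have h3 := mulr_ge0 M0 L0.
  rewrite mulrDl; apply: le_trans (lerD h1 (_ : _ <= M * (1 + _))); last first.
    by apply: le_trans h2 _; rewrite mulrDr mulr1 lerDl.
  have [_|_] := lerP (approximant s p n z) (lplus z).
    by rewrite lerDr.
  by rewrite lerDl.
- exact: chi_usc.
Qed.

End Regularity.

Theorem lemma8p3 (R : realType) (mu : probability Br3p R)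
    (hmu : finitely_supported mu)
    (d : measure_display) (T : measurableType d) (P : probability T R)
    (g : nat -> {RV P >-> Br3p}) (hg : iid_with_law g mu)
    (N : 'M[R[i]]_2 -> R) (hN : is_norm N) :
  [/\ subharmonic [set: R * R] (fun z : R * R => chi N g (toC z)),
      subharmonic [set: R * R] (fun z : R * R => lyapunov N g (toC z)),
      continuous (fun z : R * R => chi N g (toC z)) &
      forall z : R * R, z != (0, 0) ->
        {for z, continuous (fun w : R * R => lyapunov N g (toC w))}].
Proof.
have [k [s [p [s_inj p_gt0 p_sum1 mu_s]]]] := finite_law hmu.
split.
- exact: (chi_subharmonic hg hN s_inj p_gt0 p_sum1 mu_s).
- exact: (lyapunov_subharmonic hg hN s_inj p_gt0 p_sum1 mu_s).
- exact: (chi_continuous hg hN s_inj p_gt0 p_sum1 mu_s).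
- move=> z; exact: (lyapunov_continuous_at hg hN s_inj p_gt0 p_sum1 mu_s).
Qed.
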